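(* Let $Z=\mathbb R^{2N}$, let $E$ be an affine subspace of $Z$ of dimension $N$, $E_0$ the translate of $E$ through the origin, $E_0^\perp$ the orthogonal complement of $E_0$, and $\mu\in\mathcal M(Z\times Z)$. Assume: (i) (Regularity) $\mu=(L_D\,\mathcal L^{2N})\times(\mathcal H^N\llcorner E)$ with $L_D\in L^1_{\rm loc}(Z)$ non-negative. (ii) (Continuity) The pointwise limit $$L_D(\xi)=\lim_{\lambda\to+\infty}L_D\Big(\xi+\frac{\eta}{\lambda}\Big)$$ holds for $\mathcal H^N$-a.e. $\xi\in E$ and $\mathcal H^N$-a.e. $\eta\in E_0^\perp$. (iii) (Equi-integrability) There are a function $g\in L^1(E\times E_0^\perp\times E_0;\mathcal H^{3N})$, $\lambda_0>0$ and $\beta_0>0$ such that $$e^{-\beta_0(\|\eta\|^2+\|\zeta\|^2)}L_D\Big(\xi+\frac{\eta}{\lambda}\Big)\le g(\xi,\eta,\zeta)$$ for $\mathcal H^{3N}$-a.e. $(\xi,\eta,\zeta)\in E\times E_0^\perp\times E_0$ and for all $\lambda\ge\lambda_0$. Then the weak limit $\mu_\infty$ of $\mu_\beta$ as $\beta\to+\infty$ exists in $\mathcal M_b(Z\times Z)$ (convergence tested against all $f\in C_b(Z\times Z)$), and $$\mu_\infty(f)=\int_E f(\xi,\xi)\,L_D(\xi)\,d\mathcal H^N(\xi)\qquad\text{for all } f\in C_b(Z\times Z).$$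
   Context: $N\ge1$ is an integer; $Z=\mathbb R^{2N}$ is endowed with a scalar product, with corresponding norm $\|\cdot\|$; orthogonality refers to this scalar product. For a metric space $X$, $\mathcal M(X)$ is the set of (positive) Radon measures on $X$ and $\mathcal M_b(X)=\{\mu\in\mathcal M(X):\mu(X)<\infty\}$; $\mu(f):=\int_X f\,d\mu$; $C_b(X)$ is the set of bounded continuous real functions on $X$. $\mathcal H^N$ is the $N$-dimensional Hausdorff measure and $\mathcal H^N\llcorner E$ its restriction to $E$; on $E\times E_0^\perp\times E_0$, $\mathcal H^{3N}$ is the product of the three measures $\mathcal H^N$. $L_D:Z\to[0,\infty)$ is regarded as a fixed, pointwise defined function. Weak convergence $\nu_j\rightharpoonup\nu$ in $\mathcal M_b(X)$ means $\nu_j(f)\to\nu(f)$ for all $f\in C_b(X)$; for $\mu_\beta$ with $\beta\to+\infty$ this is understood with $\mu_\beta\in\mathcal M_b$ for all sufficiently large $\beta$. For $\mu\in\mathcal M(Z\times Z)$ and $\beta>0$, the thermalized measure is $$\mu_\beta:=w_\beta\,\mu,\quad w_\beta(y,z):=B_\beta^{-1}e^{-\beta\|y-z\|^2},\quad B_\beta:=\int_Z e^{-\beta\|\xi\|^2}\,d\xi .$$ *)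

(* Defs.v *)
From HB Require Import structures.
From mathcomp Require Import all_boot all_order all_algebra.
From mathcomp Require Import all_classical all_reals all_analysis.

Set Implicit Arguments.
Unset Strict Implicit.
Unset Printing Implicit Defensive.
Import Order.TTheory GRing.Theory Num.Theory.
Import numFieldNormedType.Exports.

Local Open Scope classical_set_scope.
Local Open Scope ring_scope.

(* Matrices, in particular R^n = 'rV[R]_n, carry the Borel sigma-algebra of
   their canonical topology; on 'rV[R]_n * 'rV[R]_n the library's product
   sigma-algebra is then the Borel one, by second countability. *)
HB.instance Definition _ (R : realType) (m n : nat) :=
  @isMeasurable.Build (sigma_display (@open 'M[R]_(m, n))) 'M[R]_(m, n)
    <<s @open 'M[R]_(m, n) >> (@sigma_algebra0 _ setT _) (@sigma_algebraC _ _)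
    (@sigma_algebra_bigcup _ setT _).

(* Below, measures are mostly given as bare functions set T -> \bar R, which is
   what the library's [integral], [almost_everywhere] and [\x] take; only their
   values on measurable sets matter. *)

(* L^n as the n-fold iterated product of the one-dimensional Lebesgue measure,
   splitting off the first coordinate; L^0 is the Dirac mass on R^0. *)
Fixpoint lebesgue_rV (R : realType) (n : nat) : set 'rV[R]_n -> \bar R :=
  match n with
  | 0 => fun A => \d_(0 : 'rV[R]_0) A
  | n'.+1 => fun A => (\int[lebesgue_measure]_x
      lebesgue_rV [set v : 'rV[R]_n' | A (row_mx (x%:M : 'rV[R]_1) v)])%E
  end.
Arguments lebesgue_rV {R} n _.

Section ScalarProduct.
Context (R : realType) (n : nat) (ip : {dot 'rV[R]_n for idfun}).

Definition ipnorm (x : 'rV[R]_n) : R := Num.sqrt (ip x x).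

Definition ipdist (x y : 'rV[R]_n) : R := ipnorm (x - y).

End ScalarProduct.

Section Hausdorff.
Context (R : realType) (T : Type) (dist : T -> T -> R).
Local Open Scope ereal_scope.

(* the 0 makes the diameter of the empty set 0 *)
Definition diam (A : set T) : \bar R :=
  ereal_sup ([set 0] `|` [set (dist p.1 p.2)%:E | p in A `*` A]).

Definition unit_ball_volume (d : nat) : \bar R :=
  lebesgue_rV d [set x : 'rV[R]_d | \sum_i x ord0 i ^+ 2 <= 1]%R.

(* Normalised by omega_d / 2^d, so that H^d agrees with Lebesgue measure on
   Euclidean R^d. Only for d >= 1: for d = 0 empty sets in a covering would count 1. *)
Definition hausdorff_content (d : nat) (delta : R) (A : set T) : \bar R :=
  ereal_inf
    [set \sum_(0 <= k <oo) unit_ball_volume d * (diam (U k) * 2^-1%:E) ^+ d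
    | U in [set U : nat -> set T |
             A `<=` \bigcup_k U k /\ forall k, diam (U k) <= delta%:E]].

Definition hausdorff (d : nat) (A : set T) : \bar R :=
  ereal_sup [set hausdorff_content d delta A | delta in [set r : R | (0 < r)%R]].

Definition hausdorff_on (d : nat) (E : set T) (A : set T) : \bar R :=
  hausdorff d (A `&` E).

End Hausdorff.

Section Integrability.
Local Open Scope ereal_scope.

(* f need only be measurable for the mu-completion of the sigma-algebra. For
   such f >= 0 the library integral, a supremum over measurable simple functions
   below f, is the integral with respect to the completion of mu. *)
Definition L1 d (T : measurableType d) (R : realType) (mu : set T -> \bar R)
    (f : T -> R) : Prop :=
  exists2 g : T -> R, mu.-integrable [set: T] (EFin \o g) &
    \forall x \ae mu, f x = g x.

Definition L1loc (R : realType) (n : nat) (f : 'rV[R]_n -> R) : Prop :=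
  exists2 g : 'rV[R]_n -> R,
    measurable_fun [set: 'rV[R]_n] g /\
    (forall K, compact K -> \int[lebesgue_rV n]_(x in K) `|g x|%:E < +oo) &
    \forall x \ae lebesgue_rV n, f x = g x.

Definition density (R : realType) (n : nat) (f : 'rV[R]_n -> R)
    (A : set 'rV[R]_n) : \bar R :=
  \int[lebesgue_rV n]_(x in A) (f x)%:E.

End Integrability.

Section Measures.
Context (R : realType) (n : nat).
Local Notation X := ('rV[R]_n * 'rV[R]_n)%type.
Local Open Scope ereal_scope.

Definition radon (m : set X -> \bar R) : Prop :=
  [/\ [/\ m set0 = 0, forall A, 0 <= m A & semi_sigma_additive m],
      forall K : set X, compact K -> m K < +oo &
      forall A, measurable A ->
        m A = ereal_sup [set m K | K in [set K | compact K /\ K `<=` A]]].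

Definition finite_radon (m : set X -> \bar R) : Prop :=
  radon m /\ m [set: X] < +oo.

Definition Cb (f : X -> R) : Prop :=
  continuous f /\ exists M : R, forall x, (`|f x| <= M)%R.

Definition weak_limit (m_ : R -> set X -> \bar R) (m : set X -> \bar R) : Prop :=
  [/\ \forall beta \near +oo%R, finite_radon (m_ beta),
      finite_radon m &
      forall f, Cb f ->
        \int[m_ beta]_p (f p)%:E @[beta --> +oo%R] --> \int[m]_p (f p)%:E].

Variable ip : {dot 'rV[R]_n for idfun}.

Definition gauss_mass (beta : R) : R :=
  fine (\int[lebesgue_rV n]_xi (expR (- beta * ipnorm ip xi ^+ 2))%:E).

Definition gauss_weight (beta : R) (p : X) : R :=
  ((gauss_mass beta)^-1 * expR (- beta * ipnorm ip (p.1 - p.2) ^+ 2))%R.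

Definition thermalized (mu : set X -> \bar R) (beta : R) (A : set X) : \bar R :=
  \int[mu]_(p in A) (gauss_weight beta p)%:E.

End Measures.

(* Main.v *)
(* Write [y = xi + eta] and [z = xi + zeta] with [xi] in [E], [eta] in [E0^perp] and
   [zeta] in [E0]. By uniqueness of translation-invariant measures,
   [L^2N x H^N|E] becomes [kappa] times the product of [H^N] on [E], [E0^perp] and
   [E0], and Pythagoras gives [|y - z|^2 = |eta|^2 + |zeta|^2]. Scaling [eta] and
   [zeta] by [1/lambda], where [beta = beta0 lambda^2], turns [mu_beta(f)] into
     [G^-1 int f (xi + eta/lambda, xi + zeta/lambda)
        exp (-beta0 (|eta|^2 + |zeta|^2)) L_D (xi + eta/lambda)],
   with [G] the integral of the Gaussian over [E0^perp x E0]; the same computation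
   gives [B_beta = kappa lambda^-2N G], so [kappa] cancels. Dominated convergence
   along sequences [lambda -> +oo] concludes. *)
Require Import Defs.
From HB Require Import structures.
From mathcomp Require Import all_boot all_order all_algebra.
From mathcomp Require Import all_classical all_reals all_analysis.
From mathcomp Require Import measurable_realfun ring lra.

Set Implicit Arguments.
Unset Strict Implicit.
Unset Printing Implicit Defensive.
Import Order.TTheory GRing.Theory Num.Theory.
Import numFieldNormedType.Exports.

Local Open Scope classical_set_scope.
Local Open Scope ring_scope.

(** * Borel sets and Lebesgue measure in R^n *)

(** The overview treats $L_D$ as a Borel function, but it is only known to agree with one outside an
    $\mathcal L^{2N}$-null set, and $E$ itself is such a null set. Away from $E$ a Borel
    representative [D] can replace it: for one fixed [lambda], [null_slices] turns a Lebesgue-null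
    set into a null set of slice points [xi + eta/lambda]. The exceptional set depends on [lambda],
    so [D] inherits continuity and domination only for countably many [lambda] at once, which is why
    limits are taken along sequences. On $E$ nothing can be read off [D] pointwise; a measurable
    density [l] is rebuilt there from the limits along the normal directions.

    The other obstacle is that $\mathcal H^N$ is defined by coverings. Caratheodory's criterion for
    metric outer measures makes it a Borel measure, and bi-Lipschitz charts show that balls of
    subspaces have finite positive mass. Finiteness gives the sigma-finiteness that Tonelli
    requires; positivity makes $G$ invertible and lets statements on slices be recovered from the
    triple product. *)

Section Borel.
Context {R : realType}.

(** Second countability in usable form: for countable [I] the union is countable, so only balls have
    to be measurable. *)
Lemma open_bigcup_balls (T : pseudoMetricType R) (I : Type) (c : I -> T) :
    (forall x e, 0 < e -> exists i, ball x e (c i)) ->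
  forall O : set T, open O ->
  O = \bigcup_(p in [set p : I * nat | ball (c p.1) p.2.+1%:R^-1 `<=` O])
        ball (c p.1) p.2.+1%:R^-1.
Proof.
move=> dense O oO; apply/seteqP; split => [x Ox|x [p pO px]]; last exact: pO.
have /nbhs_ballP[e /= e0 eO] : nbhs x O by exact: open_nbhs_nbhs.
have [k ke] : exists k, k.+1%:R^-1 < e / 2 :> R.
  have e20 : 0 < e / 2 by rewrite divr_gt0.
  have [k _ /(_ k (leqnn k))] := near_infty_natSinv_lt (PosNum e20).
  by exists k.
have [i xi] := dense x k.+1%:R^-1 (ltac:(by rewrite invr_gt0)).
exists (i, k) => /=; last exact: ball_sym.
move=> y iy; apply: eO; apply: (@le_ball _ _ _ (k.+1%:R^-1 + k.+1%:R^-1)).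
  by rewrite [leRHS]splitr lerD// ltW.
exact: ball_triangle iy.
Qed.

Lemma dense_rat_rV n (x : 'rV[R]_n) e : 0 < e ->
  exists q : 'rV[rat]_n, ball x e (map_mx ratr q).
Proof.
move=> e0; have /choice[q qP] i : exists q : rat, ball (x ord0 i) e (ratr q).
  have [|q] := @rat_in_itvoo R (x ord0 i - e) (x ord0 i + e); first by lra.
  rewrite in_itv/= => /andP[q1 q2]; exists q.
  by rewrite /ball/= ltr_distlC q1.
exists (\row_i q i); split=> // i j; rewrite !mxE ord1; exact: qP.
Qed.

Lemma open_measurable_rV n (A : set 'rV[R]_n) : open A -> measurable A.
Proof. by move=> oA; exact: sub_sigma_algebra. Qed.

Lemma closed_measurable_rV n (A : set 'rV[R]_n) : closed A -> measurable A.
Proof.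
move=> cA; rewrite -(setCK A); apply: measurableC.
by apply: open_measurable_rV; rewrite openC.
Qed.

Lemma measurable_ball_rV n (x : 'rV[R]_n) e : measurable (ball x e).
Proof. by apply: open_measurable_rV; exact: ball_open. Qed.

(** A ball of the product is the product of two balls, and rational centres are dense, so open sets
    are countable unions of measurable rectangles. *)
Lemma open_measurable_pair m n (A : set ('rV[R]_m * 'rV[R]_n)) :
  open A -> measurable A.
Proof.
move=> oA; pose c (q : 'rV[rat]_m * 'rV[rat]_n) : 'rV[R]_m * 'rV[R]_n :=
  (map_mx ratr q.1, map_mx ratr q.2).
rewrite (@open_bigcup_balls _ _ c _ _ oA); last first.
  move=> x e e0; have [q1 q1P] := dense_rat_rV x.1 e0.
  by have [q2 q2P] := dense_rat_rV x.2 e0; exists (q1, q2).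
rewrite bigcup_mkcond; apply: countable_bigcupT_measurable => // p.
case: ifP => // _.
rewrite [X in measurable X](_ : _ = ball (c p.1).1 p.2.+1%:R^-1 `*`
  ball (c p.1).2 p.2.+1%:R^-1) //.
by apply: measurableX; exact: measurable_ball_rV.
Qed.

Lemma continuous_measurable_rV n (f : 'rV[R]_n -> R) :
  continuous f -> measurable_fun setT f.
Proof.
move=> cf; apply: (measurability _ (RGenOpens.measurableE R)).
move=> _ [_ [a [b ->]] <-]; rewrite setTI; apply: open_measurable_rV.
by apply: open_comp => // x _; exact: cf.
Qed.

Lemma continuous_measurable_pair m n (f : 'rV[R]_m * 'rV[R]_n -> R) :
  continuous f -> measurable_fun setT f.
Proof.
move=> cf; apply: (measurability _ (RGenOpens.measurableE R)).
move=> _ [_ [a [b ->]] <-]; rewrite setTI; apply: open_measurable_pair.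
by apply: open_comp => // x _; exact: cf.
Qed.

Lemma measurable_coord n i : measurable_fun setT (fun x : 'rV[R]_n => x ord0 i).
Proof. by apply: continuous_measurable_rV; exact: coord_continuous. Qed.

Lemma measurable_fun_rV d (T : measurableType d) n (f : T -> 'rV[R]_n) :
  (forall i, measurable_fun setT (fun x => f x ord0 i)) -> measurable_fun setT f.
Proof.
move=> mf; apply: (@measurability _ _ _ _ setT f open) => //.
move=> _ [A oA <-]; rewrite setTI.
rewrite (@open_bigcup_balls _ _ (map_mx ratr : 'rV[rat]_n -> 'rV[R]_n) (@dense_rat_rV n) _ oA).
rewrite preimage_bigcup bigcup_mkcond.
apply: countable_bigcupT_measurable => // -[q k]; case: ifP => // _.
(* A ball of the sup norm constrains each coordinate separately. *)
rewrite [X in measurable X](_ : _ = \bigcap_(i in [set: 'I_n])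
  ((fun x => f x ord0 i) @^-1` (ball (ratr (q ord0 i) : R) k.+1%:R^-1))).
  apply: fin_bigcap_measurable => // i _; rewrite -[X in measurable X]setTI.
  by apply: mf => //; apply: measurable_ball.
apply/seteqP; split => [x [_ qx] i _ /=|x qx]; first by have := qx ord0 i; rewrite mxE.
by split => [|i j]; rewrite ?invr_gt0// ord1 mxE; exact: qx.
Qed.

Lemma measurable_add_rV d (T : measurableType d) n (f g : T -> 'rV[R]_n) :
  measurable_fun setT f -> measurable_fun setT g ->
  measurable_fun setT (fun x => f x + g x).
Proof.
move=> mf mg; apply: measurable_fun_rV => i; under eq_fun do rewrite mxE.
by apply: measurable_funD; apply: measurableT_comp (measurable_coord i) _.
Qed.

Lemma measurable_scale_rV d (T : measurableType d) n (f : T -> 'rV[R]_n) (a : R) :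
  measurable_fun setT f -> measurable_fun setT (fun x => a *: f x).
Proof.
move=> mf; apply: measurable_fun_rV => i; under eq_fun do rewrite mxE.
by apply: measurable_funM => //; apply: measurableT_comp (measurable_coord i) _.
Qed.

Lemma measurable_opp_rV d (T : measurableType d) n (f : T -> 'rV[R]_n) :
  measurable_fun setT f -> measurable_fun setT (fun x => - f x).
Proof.
by move=> mf; under eq_fun do rewrite -scaleN1r; exact: measurable_scale_rV.
Qed.

Definition cons_rV n (p : measurableTypeR R * 'rV[R]_n) : 'rV[R]_n.+1 :=
  row_mx (p.1%:M : 'rV_1) p.2.

Lemma cons_rV0 n p : @cons_rV n p ord0 ord0 = p.1.
Proof.
rewrite [ord0 in X in fun_of_matrix _ _ X = _](_ : _ = @lshift 1 n ord0); last exact/val_inj.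
by rewrite /cons_rV (@row_mxEl _ 1 1 n) mxE eqxx mulr1n.
Qed.

Lemma cons_rVS n p (j : 'I_n) : @cons_rV n p ord0 (lift ord0 j) = p.2 ord0 j.
Proof.
rewrite [lift _ _](_ : _ = @rshift 1 n j); last exact/val_inj.
by rewrite /cons_rV (@row_mxEr _ 1 1 n).
Qed.

Lemma cons_rVD n x v (c : 'rV[R]_n.+1) : cons_rV (x, v) + c =
  cons_rV (x + c ord0 ord0, v + \row_j c ord0 (lift ord0 j)).
Proof.
apply/rowP => i; rewrite mxE; have [j ->|->] := unliftP ord0 i.
  by rewrite !cons_rVS !mxE.
by rewrite !cons_rV0.
Qed.

Lemma norm_rV_le n (v : 'rV[R]_n) r : 0 <= r ->
  (`|v| <= r) <-> (forall i, `|v ord0 i| <= r).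
Proof.
move=> r0; have -> : `|v| = mx_norm v by []; rewrite mx_normrE; split.
  by move=> /bigmax_leP[_ +] i => /(_ (ord0, i) isT).
by move=> vr; apply/bigmax_leP; split => // -[i j] _ /=; rewrite ord1.
Qed.

Lemma norm_cons_rV_le n x (v : 'rV[R]_n) r : 0 <= r ->
  (`|cons_rV (x, v)| <= r) <-> (`|x : R| <= r /\ `|v| <= r).
Proof.
move=> r0; rewrite !norm_rV_le//; split => [xvr|[xr vr] i].
  split=> [|i]; last by have := xvr (lift ord0 i); rewrite cons_rVS.
  by have := xvr ord0; rewrite cons_rV0.
by have [j ->|->] := unliftP ord0 i; rewrite ?cons_rVS ?cons_rV0.
Qed.

Lemma measurable_cons_rV n : measurable_fun setT (@cons_rV n).
Proof.
apply: measurable_fun_rV => i; have [j ->|->] := unliftP ord0 i.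
  under eq_fun do rewrite cons_rVS.
  by apply: measurableT_comp (measurable_coord j) _; exact: measurable_snd.
by under eq_fun do rewrite cons_rV0; exact: measurable_fst.
Qed.

End Borel.

(** * Bundled measures from bare set functions *)

Section MeasureOf.
Context d (T : measurableType d) (R : realType).
Local Open Scope ereal_scope.

(** The definitions use bare set functions. An equality with a bundled measure gives access to the
    measure theory while the original expressions can still be rewritten. *)
Lemma measure_of (f : set T -> \bar R) : f set0 = 0 -> (forall A, 0 <= f A) ->
  semi_sigma_additive f -> exists m : {measure set T -> \bar R}, (m : set T -> \bar R) = f.
Proof.
move=> f0 fge0 fadd.
by exists (HB.pack_for {measure set T -> \bar R} f (isMeasure.Build _ _ _ f f0 fge0 fadd)).
Qed.

Lemma pushforward_measure d' (T' : measurableType d') (m : {measure set T' -> \bar R})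
    (f : T' -> T) : measurable_fun setT f ->
  exists m' : {measure set T -> \bar R}, (m' : set T -> \bar R) = pushforward m f.
Proof.
move=> mf; apply: measure_of => [|A|].
- by rewrite /pushforward preimage_set0 measure0.
- exact: measure_ge0.
- exact: measure_semi_sigma_additive.
Qed.

Variables (m : {measure set T -> \bar R}) (fin : sigma_finite setT m).

(** A separate head constant, to which the sigma-finite structure can be attached. *)
Let m_copy : set T -> \bar R := m.
#[local] HB.instance Definition _ := Measure.on m_copy.
#[local] HB.instance Definition _ := Measure_isSigmaFinite.Build _ _ _ m_copy fin.

Lemma sigma_finite_measure_of :
  exists m' : {sigma_finite_measure set T -> \bar R}, (m' : set T -> \bar R) = m.
Proof. by exists m_copy. Qed.

End MeasureOf.

Section LebesgueTranslation.
Context {R : realType}.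
Local Open Scope ereal_scope.
Local Notation mu := (@lebesgue_measure R).

(** The image under the translation has the right value on half-open intervals, and these determine
    Lebesgue measure. *)
Lemma lebesgue_measureD (c : R) (A : set R) : measurable A ->
  mu ((fun x => x + c)%R @^-1` A) = mu A.
Proof.
move=> mA; have mc : measurable_fun setT (fun x : measurableTypeR R => x + c : measurableTypeR R)%R.
  exact: measurable_funD.
pose cmx := isMeasurableFun.Build _ _ _ _ _ mc.
pose phi : {mfun _ >-> _} := HB.pack (fun x : measurableTypeR R => x + c : measurableTypeR R)%R cmx.
rewrite -[LHS]/(pushforward mu phi A).
apply/esym; apply: lebesgue_measure_unique => // _ [[a b]] _ <-.
transitivity (mu `](a - c)%R, (b - c)%R]%classic); last first.
  congr (mu _); apply/seteqP.
  by split => x /=; rewrite !in_itv/= ltrBlDr lerBrDr.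
rewrite !lebesgue_measure_itv/= !lte_fin ltrD2r.
by case: ifP => // _; rewrite -!EFinD; congr EFin; ring.
Qed.

Lemma ge0_lebesgue_integralD (c : R) (f : R -> \bar R) :
  measurable_fun setT f -> (forall x, 0 <= f x) ->
  \int[mu]_x f (x + c)%R = \int[mu]_x f x.
Proof.
move=> mf f0; have mc : measurable_fun setT (fun x : measurableTypeR R => x + c : measurableTypeR R)%R.
  exact: measurable_funD.
rewrite -[LHS](@ge0_integral_pushforward _ _ _ _ _ _ mc mu setT f)//.
by apply: eq_measure_integral => A mA _; exact: lebesgue_measureD.
Qed.

End LebesgueTranslation.

Section LebesgueRV.
Context {R : realType}.
Local Open Scope ereal_scope.
Local Notation mu := (@lebesgue_measure R).

Lemma lebesgue_rV0 n : lebesgue_rV n set0 = 0 :> \bar R.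
Proof.
elim: n => [|n ih] /=; first by rewrite dirac0.
by rewrite (eq_integral (cst 0)) ?integral0// => x _; exact: ih.
Qed.

(** The ball of the sup norm is a cube: its slice over [x] is the cube of one dimension less if [x]
    lies in [[-r, r]], and empty otherwise. *)
Lemma lebesgue_rV_ball n (r : R) : (0 <= r)%R ->
  lebesgue_rV n [set v : 'rV[R]_n | `|v| <= r]%R = ((2 * r) ^+ n)%:E.
Proof.
move=> r0; elim: n => [|n ih].
  rewrite /= diracE mem_set//= norm_rV_le// => -[]//.
transitivity (\int[mu]_x (((2 * r) ^+ n)%:E * (\1_(`[(- r)%R, r]%classic) x)%:E)).
  apply: eq_integral => x _; rewrite indicE.
  case: (boolP (x \in _)) => [/set_mem/=|/negP xr].
    rewrite in_itv/= -ler_norml => xr; rewrite mule1 -ih; congr (lebesgue_rV n _).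
    by apply/seteqP; split => v /= => [/(norm_cons_rV_le _ _ r0)[]|vr]//; apply/norm_cons_rV_le.
  rewrite mule0 -(lebesgue_rV0 n); congr (lebesgue_rV n _).
  apply/seteqP; split => v //= /(norm_cons_rV_le _ _ r0)[+ _].
  by rewrite ler_norml => xr'; case: xr; rewrite inE/= in_itv.
rewrite ge0_integralZl//=; last 2 first.
  exact/measurable_EFinP.
  by rewrite lee_fin exprn_ge0// mulr_ge0.
rewrite (_ : \int[mu]_x _ = mu (`[(- r)%R, r]%classic : set R)); last first.
  by rewrite integral_indic// setIT.
rewrite lebesgue_measure_itv/= lte_fin.
have [rr|rr] := ltP (- r)%R r.
  by rewrite -EFinD -EFinM exprSr; congr ((_ * _)%:E); ring.
have -> : r = 0%R by apply/eqP; rewrite eq_le r0 andbT; lra.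
by rewrite mule0 mulr0 expr0n.
Qed.

(** Phrased with a bundled [m] because it serves in the induction that first shows [lebesgue_rV] to
    be a measure. *)
Let lebesgue_rVS_pushforward n (m : {sigma_finite_measure set 'rV[R]_n -> \bar R}) :
  (m : set _ -> _) = lebesgue_rV n ->
  lebesgue_rV n.+1 = pushforward (mu \x m) (@cons_rV R n).
Proof.
move=> mE; apply/funext => A; rewrite /pushforward /product_measure1 /= -mE.
apply: eq_integral => x _; congr (m _).
by apply/seteqP; split => v /=; rewrite xsectionP.
Qed.

Lemma measurable_norm_le n (r : R) : measurable [set v : 'rV[R]_n | (`|v| <= r)%R].
Proof.
apply: closed_measurable_rV.
have -> : [set v : 'rV[R]_n | `|v| <= r]%R = Num.norm @^-1` [set x | x <= r]%R by [].
by apply: closed_comp => [x _|]; [exact: norm_continuous|exact: closed_le].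
Qed.

Lemma sigma_finite_norm_le n (m : {measure set 'rV[R]_n -> \bar R}) :
  (forall r, (0 <= r)%R -> m [set v | (`|v| <= r)%R] < +oo) -> sigma_finite setT m.
Proof.
move=> mfin; exists (fun k => [set v | (`|v| <= k%:R)%R]).
  apply/seteqP; split => // v _.
  by exists (Num.bound `|v|) => //=; exact/ltW/archi_boundP.
by move=> k; split; [exact: measurable_norm_le|exact: mfin].
Qed.

Lemma lebesgue_rV_measure n :
  exists m : {sigma_finite_measure set 'rV[R]_n -> \bar R},
    (m : set _ -> _) = lebesgue_rV n.
Proof.
suff [m mE] : exists m : {measure set 'rV[R]_n -> \bar R}, (m : set _ -> _) = lebesgue_rV n.
  have fin : sigma_finite setT m.
    by apply: sigma_finite_norm_le => r r0; rewrite mE lebesgue_rV_ball// ltry.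
  by have [m' m'E] := sigma_finite_measure_of fin; exists m'; rewrite m'E.
elim: n => [|n [m mE]]; first by exists (@dirac _ 'rV[R]_0 0%R R).
have fin : sigma_finite setT m.
  by apply: sigma_finite_norm_le => r r0; rewrite mE lebesgue_rV_ball// ltry.
have [m' m'E] := sigma_finite_measure_of fin.
have -> := @lebesgue_rVS_pushforward _ m' (etrans m'E mE).
by apply: pushforward_measure; exact: measurable_cons_rV.
Qed.

Let Lm n := projT1 (cid (lebesgue_rV_measure n)).
Let LmE n : (Lm n : set _ -> _) = lebesgue_rV n := projT2 (cid (lebesgue_rV_measure n)).

Let L_ge0 n (A : set 'rV[R]_n) : 0 <= lebesgue_rV n A.
Proof. by rewrite -LmE measure_ge0. Qed.
Let L_sadd n : semi_sigma_additive (lebesgue_rV n : set 'rV[R]_n -> \bar R).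
Proof. by rewrite -LmE; exact: measure_semi_sigma_additive. Qed.
HB.instance Definition _ n := isMeasure.Build _ _ _ (lebesgue_rV n : set 'rV[R]_n -> \bar R)
  (@lebesgue_rV0 n) (@L_ge0 n) (@L_sadd n).
Let L_sfin n : sigma_finite setT (lebesgue_rV n : set 'rV[R]_n -> \bar R).
Proof. by rewrite -LmE; exact: sigma_finiteT. Qed.
HB.instance Definition _ n := Measure_isSigmaFinite.Build _ _ _
  (lebesgue_rV n : set 'rV[R]_n -> \bar R) (@L_sfin n).

Lemma lebesgue_rVS n :
  lebesgue_rV n.+1 = pushforward (mu \x lebesgue_rV n) (@cons_rV R n).
Proof. exact: lebesgue_rVS_pushforward. Qed.

Lemma ge0_integral_lebesgue_rVS n (f : 'rV[R]_n.+1 -> \bar R) :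
  measurable_fun setT f -> (forall v, 0 <= f v) ->
  \int[lebesgue_rV n.+1]_v f v = \int[mu]_x \int[lebesgue_rV n]_v f (cons_rV (x, v)).
Proof.
move=> mf f0; rewrite lebesgue_rVS ge0_integral_pushforward//; last exact: measurable_cons_rV.
rewrite preimage_setT fubini_tonelli1//; last by move=> x; exact: f0.
exact: (measurableT_comp mf (@measurable_cons_rV R n)).
Qed.

Lemma lebesgue_rVD n (c : 'rV[R]_n) (A : set 'rV[R]_n) : measurable A ->
  lebesgue_rV n [set v | A (v + c)%R] = lebesgue_rV n A.
Proof.
elim: n => [|n ih] in c A *; move=> mA.
  by congr (lebesgue_rV 0 _); apply/seteqP; split => v /=; rewrite (_ : v + c = v)%R//; apply/rowP => -[].
rewrite lebesgue_rVS /pushforward /product_measure1.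
set B := @cons_rV R n @^-1` A.
have mB : measurable B.
  by rewrite -[B]setTI; apply: (@measurable_cons_rV R n).
pose c' := \row_j c ord0 (lift ord0 j) : 'rV[R]_n.
transitivity (\int[mu]_x (lebesgue_rV n \o xsection B) (x + c ord0 ord0)%R).
  apply: eq_integral => x _ /=.
  rewrite -[RHS](ih c'); last exact: measurable_xsection.
  congr (lebesgue_rV n _).
  by apply/seteqP; split => v /=; rewrite !xsectionP /B /preimage/= cons_rVD.
apply: (@ge0_lebesgue_integralD _ (c ord0 ord0) (lebesgue_rV n \o xsection B)) => //.
exact: measurable_fun_xsection.
Qed.

End LebesgueRV.

(** * Metric outer measures and Hausdorff measures *)

Section Far.
Context {R : realType} {V : normedModType R}.
Implicit Type F : set V.

(** The points at distance at least [1/(n+1)] from [F], without an infimum; for empty [F] this is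
    the whole space. *)
Definition far F n := [set x : V | forall y, F y -> n.+1%:R^-1 <= `|x - y|].

Lemma le_far F m n : (m <= n)%N -> far F m `<=` far F n.
Proof.
move=> mn x Fx y Fy; apply: le_trans (Fx y Fy).
by rewrite lef_pV2 ?posrE// ler_nat.
Qed.

Lemma setC_bigcup_far F : closed F -> ~` F = \bigcup_n far F n.
Proof.
move=> cF; apply/seteqP; split => [x Fx|x [n _ Fx] Fx']; last first.
  by have := Fx x Fx'; rewrite subrr normr0 leNgt invr_gt0 ltr0Sn.
have oF : open (~` F) by rewrite openC.
have /nbhs_ballP[e /= e0 eF] : nbhs x (~` F) by exact: open_nbhs_nbhs.
have [n _ /(_ n (leqnn n)) ne] := near_infty_natSinv_lt (PosNum e0).
exists n => // y Fy; rewrite leNgt; apply/negP => xy; apply: (eF y) => //.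
by rewrite -ball_normE /ball_/=; exact: lt_trans xy ne.
Qed.

End Far.

Section MetricOuterMeasure.
Context {R : realType} {V : normedModType R}.
Variable mu : {outer_measure set V -> \bar R}.
Hypothesis mu_metric : forall (A B : set V) (e : R), 0 < e ->
  (forall x y, A x -> B y -> e <= `|x - y|) -> (mu A + mu B <= mu (A `|` B))%E.

(* The telescoping bound sum_(n < K) mu (shell n) <= mu S_K + mu S_(K+1) makes
   the tail of the shells negligible. *)
Lemma closed_caratheodory (F : set V) : closed F -> mu.-caratheodory F.
Proof.
move=> cF; apply: le_caratheodory_measurable => X.
have [->|muX] := eqVneq (mu X) +oo%E; first exact: leey.
pose S n := X `&` far F n.
pose D n := S n.+1 `\` far F n.
have SX n : (mu (S n) <= mu X)%E by apply: le_outer_measure => x [].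
have mufin n : mu (S n) \is a fin_num.
  rewrite ge0_fin_numE ?outer_measure_ge0//; apply: le_lt_trans (SX n) _.
  by rewrite ltey.
(* A point of [D n.+1] is closer than [1/(n+2)] to some point of [F], a point of [S n] is at least
   [1/(n+1)] away from it; the difference of the two radii separates the sets. *)
have step n : (mu (S n) + mu (D n.+1) <= mu (S n.+2))%E.
  apply: (@le_trans _ _ (mu (S n `|` D n.+1))); last first.
    apply: le_outer_measure => x [[Xx Fx]|[[Xx Fx] _]]; split => //.
    by apply: le_far Fx; rewrite ltnW.
  apply: (@mu_metric _ _ (n.+1%:R^-1 - n.+2%:R^-1)).
    by rewrite subr_gt0 ltf_pV2 ?posrE// ltr_nat.
  move=> x z [_ Fx] [_] /existsNP[y /not_implyP[Fy /negP]]; rewrite -ltNge => zy.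
  have := Fx y Fy; rewrite lerBlDr => xy; apply: (le_trans xy).
  by rewrite -(subrKA z x (- y)) (le_trans (ler_normD _ _))// lerD// ltW.
have sumD K : (\sum_(0 <= n < K) mu (D n.+1) <= mu (S K) + mu (S K.+1))%E.
  elim: K => [|K ih]; first by rewrite big_nil adde_ge0// outer_measure_ge0.
  rewrite big_nat_recr//= addeC.
  apply: (@le_trans _ _ (mu (D K.+1) + (mu (S K) + mu (S K.+1)))%E).
    by rewrite leeD2l.
  by rewrite addeA addeC [(mu (D _) + _)%E]addeC leeD2l.
have sumDoo : (\sum_(0 <= n <oo) mu (D n.+1) < +oo)%E.
  apply: (@le_lt_trans _ _ (mu X + mu X)%E); last first.
    by rewrite lte_add_pinfty// ltey.
  apply: lime_le; first by apply: is_cvg_nneseries => n _ _; exact: outer_measure_ge0.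
  by apply: nearW => K; apply: (le_trans (sumD K)); rewrite leeD.
have tail0 := nneseries_tail_cvg sumDoo (fun n _ => outer_measure_ge0 mu (D n.+1)).
(* A point outside [F] but not in [S n.+1] lies in the shell at the first index where it becomes far
   from [F]. *)
have tail n : (mu (X `&` ~` F) <= mu (S n.+1) + \sum_(n <= k <oo) mu (D k.+1))%E.
  rewrite setC_bigcup_far//.
  have -> : X `&` \bigcup_k far F k = S n.+1 `|` \bigcup_(k in ~` `I_n) D k.+1.
    apply/seteqP; split => [x [Xx [k _ Fx]]|x [[Xx Fx]|[k _ [[Xx Fx] _]]]]; last 2 first.
    - by split => //; exists n.+1.
    - by split => //; exists k.+2.
    elim: k Fx => [|k ih] Fx; first by left; split => //; exact: le_far Fx.
    have [Fkx|nFkx] := pselect (far F k x); first exact: ih.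
    have [kn|kn] := leqP k n; first by left; split => //; exact: le_far Fx.
    right; case: k => // k in ih Fx nFkx kn *.
    exists k => //=; first by apply/negP; rewrite -leqNgt -ltnS.
  apply: (le_trans (outer_measureU2 _ _ _)); rewrite leeD2l//.
  exact: (outer_measure_sigma_subadditive_tail mu n (fun k => D k.+1)).
(* [F] and [S n.+1] are at distance at least [1/(n+2)], so [mu] adds up on them; the error is the
   tail of a convergent series. *)
have main n : (mu (X `&` F) + mu (X `&` ~` F) <= mu X + \sum_(n <= k <oo) mu (D k.+1))%E.
  apply: (@le_trans _ _ (mu (X `&` F) + (mu (S n.+1) + \sum_(n <= k <oo) mu (D k.+1)))%E).
    by rewrite leeD2l.
  rewrite addeA leeD2r//.
  apply: (@le_trans _ _ (mu ((X `&` F) `|` S n.+1))); last first.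
    by apply: le_outer_measure => x [[]|[]].
  apply: (@mu_metric _ _ n.+2%:R^-1) => // x y [_ Fx] [_ Fy].
  by rewrite distrC; exact: Fy.
have : (mu X + \sum_(n <= k <oo) mu (D k.+1) @[n --> \oo] --> mu X)%E.
  rewrite -[X in _ --> X]adde0; apply: cvgeD => //; last exact: cvg_cst.
  by rewrite fin_num_adde_defl.
move/cvg_lim => <- //; apply: lime_ge; last exact: nearW.
by apply/cvg_ex; exists (mu X + 0)%E; apply: cvgeD => //; rewrite ?fin_num_adde_defl//; exact: cvg_cst.
Qed.

End MetricOuterMeasure.

Section CoverOuterMeasure.
Context {R : realType} {T : Type}.
Local Open Scope ereal_scope.
Variables (w : set T -> \bar R) (P : set T -> Prop).
Hypotheses (w0 : w set0 = 0) (w_ge0 : forall A, 0 <= w A) (P0 : P set0).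

(** Caratheodory's outer measure from a weight [w] on the sets satisfying [P]; the [delta]-contents
    behind $\mathcal H^d$ are instances. *)
Definition cover_content (A : set T) : \bar R :=
  ereal_inf [set \sum_(0 <= k <oo) w (U k) | U in [set U : nat -> set T |
    A `<=` \bigcup_k U k /\ forall k, P (U k)]].

Lemma cover_content_ge0 A : 0 <= cover_content A.
Proof.
by apply: le_ereal_inf_tmp => _ [U _ <-]; exact: nneseries_ge0.
Qed.

Lemma cover_content0 : cover_content set0 = 0.
Proof.
apply/eqP; rewrite eq_le cover_content_ge0 andbT.
apply: ereal_inf_lbound; exists (fun=> set0); first by split.
by rewrite eseries0.
Qed.

Lemma le_cover_content A B : A `<=` B -> cover_content A <= cover_content B.
Proof.
move=> AB; apply: ereal_inf_le_tmp => x [U [BU PU] <-]; exists U => //.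
by split => //; exact: subset_trans BU.
Qed.

Lemma cover_content_sigma_subadditive : sigma_subadditive cover_content.
Proof.
move=> A; have [[i ioo]|] := pselect (exists i, cover_content (A i) = +oo).
  rewrite (eseries_pinfty _ _ ioo) ?leey// => n _.
  by rewrite -ltNye (lt_le_trans _ (cover_content_ge0 _)).
rewrite -forallNE => Aoo.
suff add2e (e : {posnum R}) :
    cover_content (\bigcup_n A n) <= \sum_(i <oo) cover_content (A i) + e%:num%:E.
  by apply/lee_addgt0Pr => _/posnumP[].
rewrite (le_trans _ (epsilon_trick _ _ _))//; last first.
  by move=> n; exact: cover_content_ge0.
have /choice[G GP] n : exists U : nat -> set T, [/\ A n `<=` \bigcup_k U k,
    forall k, P (U k) & \sum_(0 <= k <oo) w (U k) <=
      cover_content (A n) + (e%:num / (2 ^ n.+1)%:R)%:E].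
  have en : (0 < e%:num / (2 ^ n.+1)%:R)%R by [].
  have fin : cover_content (A n) \is a fin_num.
    by rewrite ge0_fin_numE ?cover_content_ge0// ltey; apply/eqP.
  have [_ [U [AU PU] <-] wU] := lb_ereal_inf_adherent en fin.
  by exists U; split => //; exact: ltW.
(* The nearly optimal covers of all [A n] form a doubly indexed family, which a bijection with pairs
   of naturals lists as one cover. *)
have /card_esym/ppcard_eqP[f] := card_nat2.
apply: (@le_trans _ _ (\sum_(0 <= k <oo) w (uncurry G (f k)))).
  apply: ereal_inf_lbound; exists (uncurry G \o f) => //; split; last first.
    by move=> k /=; case: (f k) => n m /=; have [_ + _] := GP n; apply.
  move=> x [n _ Anx]; have [/(_ x Anx)[m _ Gx] _ _] := GP n.
  by exists (f^-1%FUN (n, m)) => //=; rewrite invK ?inE.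
rewrite nneseries_esumT//.
rewrite -(@reindex_esum _ _ _ [set: nat] [set: nat * nat] f (w \o uncurry G)); last first.
  exact: bij.
rewrite (_ : setT = setT `*`` (fun=> setT)); last by apply/seteqP; split => // -[].
rewrite (eq_esum (b := fun k => w (G k.1 k.2))); last by move=> [].
rewrite -(@esum_esum _ _ _ setT (fun=> setT) (fun n m => w (G n m)))//.
rewrite nneseries_esumT//; last first.
  by move=> n; rewrite adde_ge0 ?cover_content_ge0// lee_fin.
apply: le_esum => n _; have [_ _] := GP n.
by rewrite nneseries_esumT.
Qed.

End CoverOuterMeasure.

(** [E] only enters as a test set in the Caratheodory condition, so it can be arbitrary. *)
Lemma caratheodory_restrict_measure (R : realType) d (T : measurableType d)
    (mu : {outer_measure set T -> \bar R}) (E : set T) :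
  (forall A, measurable A -> mu.-caratheodory A) ->
  exists m : {measure set T -> \bar R}, (m : set T -> \bar R) = fun A => mu (A `&` E).
Proof.
move=> cara; apply: measure_of => [|A|F mF tF mUF].
- by rewrite set0I outer_measure0.
- exact: outer_measure_ge0.
- have -> : (mu (\bigcup_n F n `&` E) = \sum_(k <oo) mu (F k `&` E))%E.
    apply/eqP; rewrite eq_le setIC; apply/andP; split.
      under eq_eseriesr do rewrite setIC.
      exact: outer_measure_bigcup_lim.
    have := @caratheodory_lime_le _ _ mu F (fun n => cara _ (mF n)) tF
      (E `&` \bigcup_n F n).
    rewrite -setIA setICr setI0 outer_measure0 adde0; apply: le_trans.
    apply: lee_nneseries => [n _ _|n _]; first exact: outer_measure_ge0.
    by apply: le_outer_measure => x [Fx Ex]; do 2 split => //; exists n.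
  by apply: is_cvg_nneseries => n _ _; exact: outer_measure_ge0.
Qed.

Section HausdorffOuter.
Context {R : realType} {T : Type} (dist : T -> T -> R) (d : nat).
Local Open Scope ereal_scope.
Local Notation diam := (diam dist).
Local Notation H := (hausdorff dist d).

Lemma diam_ge0 A : 0 <= diam A.
Proof. by apply: ereal_sup_ubound; left. Qed.

Lemma diam_leP (A : set T) (r : R) : (0 <= r)%R ->
  (diam A <= r%:E) <-> (forall x y, A x -> A y -> (dist x y <= r)%R).
Proof.
move=> r0; split=> [Ar x y Ax Ay|Ar].
  rewrite -lee_fin; apply: le_trans Ar; apply: ereal_sup_ubound.
  by right; exists (x, y).
apply: ge_ereal_sup => _ [->|[[x y] [/= Ax Ay] <-]]; rewrite lee_fin//.
exact: Ar.
Qed.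

Lemma diam0 : diam set0 = 0.
Proof.
by apply/eqP; rewrite eq_le diam_ge0 andbT; apply/diam_leP.
Qed.

Lemma unit_ball_volume_ge0 : 0 <= unit_ball_volume R d.
Proof. exact: measure_ge0. Qed.

Let w (A : set T) := unit_ball_volume R d * (diam A * 2^-1%:E) ^+ d.
Let w_ge0 A : 0 <= w A.
Proof.
rewrite /w mule_ge0 ?unit_ball_volume_ge0// expe_ge0// mule_ge0 ?diam_ge0//.
Qed.

Hypothesis d_gt0 : (0 < d)%N.
Let w0 : w set0 = 0.
Proof. by rewrite /w diam0 mul0e; case: d d_gt0 => // n _; rewrite expeS mul0e mule0. Qed.

Let P0 (delta : R) : (0 <= delta)%R -> diam set0 <= delta%:E.
Proof. by rewrite diam0 lee_fin. Qed.

Let contentE delta : hausdorff_content dist d delta =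
  cover_content w (fun A => diam A <= delta%:E).
Proof. by []. Qed.

Let content_ge0 delta A : 0 <= hausdorff_content dist d delta A.
Proof. by rewrite contentE cover_content_ge0. Qed.

Lemma le_hausdorff_content delta A : (0 < delta)%R -> hausdorff_content dist d delta A <= H A.
Proof. by move=> delta0; apply: ereal_sup_ubound; exists delta. Qed.

Lemma hausdorff_content_anti A (d1 d2 : R) : (d1 <= d2)%R ->
  hausdorff_content dist d d2 A <= hausdorff_content dist d d1 A.
Proof.
move=> d12; apply: ereal_inf_le_tmp => x [U [AU dU] <-]; exists U => //; split => // k.
by apply: le_trans (dU k) _; rewrite lee_fin.
Qed.

Lemma hausdorff_ge0 A : 0 <= H A.
Proof.
by apply: le_trans (@le_hausdorff_content 1%R A ltr01).
Qed.

Lemma hausdorff0 : H set0 = 0.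
Proof.
apply/eqP; rewrite eq_le hausdorff_ge0 andbT; apply: ge_ereal_sup => _ [e e0 <-].
by rewrite contentE cover_content0//; apply: P0; exact: ltW.
Qed.

Lemma le_hausdorff : {homo H : A B / A `<=` B >-> A <= B}.
Proof.
move=> A B AB; apply: ge_ereal_sup => _ [e e0 <-].
by apply: le_trans (@le_hausdorff_content e B e0); by rewrite !contentE le_cover_content.
Qed.

Lemma hausdorff_sigma_subadditive : sigma_subadditive H.
Proof.
move=> F; apply: ge_ereal_sup => _ [e e0 <-].
apply: (@le_trans _ _ (\sum_(i <oo) hausdorff_content dist d e (F i))).
  by rewrite contentE; apply: cover_content_sigma_subadditive => //; apply: P0; exact: ltW.
apply: lee_nneseries => [//|i _].
exact: le_hausdorff_content.
Qed.

Lemma hausdorff_outer : exists mu : {outer_measure set T -> \bar R},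
  (mu : set T -> \bar R) = H.
Proof.
by exists (HB.pack_for {outer_measure set T -> \bar R} H
  (isOuterMeasure.Build R T H hausdorff0 hausdorff_ge0 le_hausdorff
    hausdorff_sigma_subadditive)).
Qed.

(** A set of diameter less than [e] cannot meet both [A] and [B], so every fine cover of the union
    splits into a cover of [A] and a cover of [B]. *)
Lemma hausdorff_separated A B (e : R) : (0 < e)%R ->
  (forall x y, A x -> B y -> (e <= dist x y)%R) -> H A + H B <= H (A `|` B).
Proof.
move=> e0 AB; have [->|HABoo] := eqVneq (H (A `|` B)) +oo; first exact: leey.
have HABfin : H (A `|` B) \is a fin_num by rewrite ge0_fin_numE ?hausdorff_ge0// ltey.
have HA : H A <= H (A `|` B) by apply: le_hausdorff; exact: subsetUl.
have HB : H B <= H (A `|` B) by apply: le_hausdorff; exact: subsetUr.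
have contentD r : (0 < r)%R -> (r < e)%R ->
    hausdorff_content dist d r A + hausdorff_content dist d r B <=
    hausdorff_content dist d r (A `|` B).
  move=> r0 re; apply: le_ereal_inf_tmp => _ [U [ABU dU] <-].
  (* The subcover of sets meeting [C]; the others become empty and have weight 0. *)
  pose V C k := if `[< U k `&` C !=set0 >] then U k else set0.
  have VP C : C `<=` A `|` B -> hausdorff_content dist d r C <= \sum_(0 <= k <oo) w (V C k).
    move=> CAB; apply: ereal_inf_lbound; exists (V C) => //; split => [x Cx|k].
      have [k _ Ukx] := ABU x (CAB x Cx); exists k => //; rewrite /V.
      by case: asboolP => // -[]; exists x.
    by rewrite /V; case: ifP => // _; apply: P0; exact: ltW.
  apply: (@le_trans _ _ (\sum_(0 <= k <oo) w (V A k) + \sum_(0 <= k <oo) w (V B k))).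
    by rewrite leeD// VP.
  rewrite -nneseriesD//; apply: lee_nneseries => [k _ _|k _]; first by rewrite adde_ge0.
  rewrite /V; case: asboolP => [[x [Ux Ax]]|_]; last first.
    by rewrite w0 add0e; case: ifP => // _; rewrite w0; exact: w_ge0.
  case: asboolP => [[y [Uy By]]|_]; last by rewrite w0 adde0.
  have := (diam_leP (U k) (ltW r0)).1 (dU k) x y Ux Uy.
  by rewrite leNgt (lt_le_trans re)// AB.
(* Independent scales [r1] and [r2] allow the two suprema to be taken one after the other; contents
   only grow when passing to the smaller common scale [r]. *)
have key r1 r2 : (0 < r1)%R -> (0 < r2)%R ->
    hausdorff_content dist d r1 A + hausdorff_content dist d r2 B <= H (A `|` B).
  move=> r10 r20; pose r := (Num.min (e / 2) (Num.min r1 r2))%R.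
  have r0 : (0 < r)%R by rewrite !lt_min r10 r20 divr_gt0.
  have re : (r < e)%R by rewrite gt_min; apply/orP; left; lra.
  apply: le_trans (@le_hausdorff_content r _ r0).
  apply: le_trans (contentD r r0 re); apply: leeD; apply: hausdorff_content_anti.
    by rewrite !ge_min lexx orbT.
  by rewrite !ge_min lexx !orbT.
have HBfin : H B \is a fin_num.
  by rewrite ge0_fin_numE ?hausdorff_ge0// (le_lt_trans HB)// ltey.
rewrite -leeBrDr//; apply: ge_ereal_sup => _ [r1 r10 <-].
have Afin : hausdorff_content dist d r1 A \is a fin_num.
  rewrite ge0_fin_numE //.
  by rewrite (le_lt_trans (@le_hausdorff_content r1 A r10))// (le_lt_trans HA)// ltey.
rewrite leeBrDr// addeC -leeBrDr//; apply: ge_ereal_sup => _ [r2 r20 <-].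
by rewrite leeBrDr// addeC key.
Qed.

(** The image of a cover at scale [e / s] is a cover at scale [e], with diameters multiplied by at
    most [s]. *)
Lemma hausdorff_image_le (f : T -> T) (s : R) A : (0 < s)%R ->
  (forall x y, (dist (f x) (f y) <= s * dist x y)%R) ->
  H (f @` A) <= (s ^+ d)%:E * H A.
Proof.
move=> s0 fs; have sd0 : (0 < s ^+ d)%R by rewrite exprn_gt0.
apply: ge_ereal_sup => _ [e e0 <-]; have es0 : (0 < e / s)%R by rewrite divr_gt0.
apply: (@le_trans _ _ ((s ^+ d)%:E * hausdorff_content dist d (e / s) A)); last first.
  by rewrite lee_pmul2l// le_hausdorff_content.
rewrite -lee_pdivrMl//; apply: le_ereal_inf_tmp => _ [U [AU dU] <-].
rewrite lee_pdivrMl// -nneseriesZl//; last by move=> i _; exact: w_ge0.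
have dfU B r : (0 <= r)%R -> diam B <= r%:E -> diam (f @` B) <= (s * r)%:E.
  move=> r0 /(diam_leP _ r0) Br; apply/diam_leP; first by rewrite mulr_ge0// ltW.
  move=> _ _ [x Bx <-] [y By <-]; apply: (le_trans (fs x y)).
  by rewrite ler_pM2l// Br.
apply: (@le_trans _ _ (\sum_(0 <= k <oo) w (f @` U k))).
  apply: ereal_inf_lbound; exists (fun k => f @` U k) => //; split.
    by move=> _ [x Ax <-]; have [k _ Ukx] := AU x Ax; exists k => //; exists x.
  by move=> k; have := dfU _ _ (ltW es0) (dU k); rewrite mulrCA divff ?mulr1// gt_eqF.
apply: lee_nneseries => [//|k _].
have dE B r : diam B <= r%:E -> exists2 b : R, (0 <= b)%R & diam B = b%:E.
  move=> Br; have fin : diam B \is a fin_num.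
    by rewrite ge0_fin_numE ?diam_ge0// (le_lt_trans Br)// ltry.
  by exists (fine (diam B)); rewrite ?fineK// fine_ge0// diam_ge0.
have [b b0 Ub] := dE _ _ (dU k).
have fUb : diam (f @` U k) <= (s * b)%:E by rewrite dfU// Ub.
have [c c0 fUc] := dE _ _ fUb.
rewrite /w Ub fUc -!EFinM -!EFin_expe muleCA lee_wpmul2l ?unit_ball_volume_ge0//.
rewrite -EFinM lee_fin -exprMn lerXn2r ?nnegrE ?mulr_ge0 ?invr_ge0 ?(ltW s0)//.
by rewrite mulrA ler_pM2r ?invr_gt0// -lee_fin -fUc.
Qed.

End HausdorffOuter.

(** Covers are sequences, so a finite family is padded with empty sets, which cost nothing as
    [w set0 = 0]. *)
Lemma sum_ord_const_oo (R : realType) (T : Type) m (w : set T -> \bar R) (F : 'I_m -> set T) (b : R) :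
  w set0 = 0%E -> (forall i, w (F i) <= b%:E)%E -> (forall A, 0 <= w A)%E ->
  exists2 U : nat -> set T, (forall k, U k = set0 \/ exists i, U k = F i) /\
     \bigcup_i F i `<=` \bigcup_k U k &
     (\sum_(0 <= k <oo) w (U k) <= (m%:R * b)%:E)%E.
Proof.
move=> w0 wF wge0; pose U k := if insub k is Some i then F i else set0.
exists U; first split.
- by move=> k; rewrite /U; case: insubP => [i _ _|_]; [right; exists i|left].
- move=> x [i _ Fx]; exists (i : nat) => //; rewrite /U; case: insubP => [j _ /val_inj->//|].
  by rewrite ltn_ord.
rewrite (nneseries_split 0 m)// add0n [X in (_ + X)%E]eseries0 ?adde0; last first.
  by move=> k mk _; rewrite /U insubF// ltnNge mk.
rewrite big_mkord (@le_trans _ _ (\sum_(i < m) b%:E)%E)//.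
  apply: lee_sum => i _.
  by rewrite /U; case: insubP => [j _ _|]; rewrite ?wF// ltn_ord.
by rewrite sumEFin sumr_const card_ord mulr_natl.
Qed.

(** The Euclidean unit ball lies between the cubes of half-side [1/(d+1)] and [1]. *)
Lemma unit_ball_volume_fin_gt0 (R : realType) d :
  exists2 b : R, 0 < b & unit_ball_volume R d = b%:E.
Proof.
set B := [set x : 'rV[R]_d | \sum_i x ord0 i ^+ 2 <= 1].
have mB : measurable B.
  have mf : measurable_fun setT (fun x : 'rV[R]_d => \sum_i x ord0 i ^+ 2).
    by apply: measurable_sum => i; apply: measurable_funX; exact: measurable_coord.
  have -> : B = (fun x : 'rV[R]_d => \sum_i x ord0 i ^+ 2) @^-1` `]-oo, 1].
    by apply/seteqP; split => x /=; rewrite in_itv.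
  by rewrite -[X in measurable X]setTI; exact: mf.
have B1 : B `<=` [set v | `|v| <= 1].
  move=> x Bx; apply/norm_rV_le => // i.
  rewrite -(@ler_pXn2r _ 2)// ?nnegrE// expr1n real_normK ?num_real//.
  apply: le_trans Bx; rewrite (bigD1 i)//= lerDl sumr_ge0// => j _; exact: sqr_ge0.
have B2 : [set v | `|v| <= d.+1%:R^-1] `<=` B.
  have d0 : 0 <= d.+1%:R^-1 :> R by rewrite invr_ge0.
  move=> x /(norm_rV_le _ d0) xd; apply: (@le_trans _ _ (\sum_(i < d) d.+1%:R^-1)).
    apply: ler_sum => i _; rewrite -real_normK ?num_real//.
    apply: (@le_trans _ _ (d.+1%:R^-1 ^+ 2)); first by rewrite lerXn2r ?nnegrE.
    by rewrite expr2 ler_piMr// invf_le1// ler1n.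
  by rewrite sumr_const card_ord -[leLHS]mulr_natl ler_pdivrMr// mul1r ler_nat.
have LB : (lebesgue_rV d B <= ((2 * 1) ^+ d)%:E)%E.
  rewrite -lebesgue_rV_ball//; apply: le_measure; rewrite ?inE//; exact: measurable_norm_le.
have LB' : (((2 * d.+1%:R^-1) ^+ d)%:E <= lebesgue_rV d B)%E.
  rewrite -lebesgue_rV_ball//; apply: le_measure; rewrite ?inE//; exact: measurable_norm_le.
have fin : lebesgue_rV d B \is a fin_num.
  by rewrite ge0_fin_numE//; apply: le_lt_trans LB _; rewrite ltry.
exists (fine (lebesgue_rV d B)); last by rewrite fineK.
rewrite -lte_fin fineK//; apply: lt_le_trans LB'.
by rewrite lte_fin exprn_gt0// mulr_gt0// invr_gt0.
Qed.

(** * Hausdorff measure of bi-Lipschitz images of balls *)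

Section BiLipschitz.
Context {R : realType} {T : Type} (dist : T -> T -> R) (d : nat).
Variables (phi : 'rV[R]_d -> T) (c C : R).
Hypotheses (d_gt0 : (0 < d)%N) (c_gt0 : 0 < c) (C_gt0 : 0 < C).
Hypothesis phi_lower : forall u v, c * `|u - v| <= dist (phi u) (phi v).
Hypothesis phi_upper : forall u v, dist (phi u) (phi v) <= C * `|u - v|.
Local Open Scope ereal_scope.
Local Notation H := (hausdorff dist d).
Local Notation ball r := [set u : 'rV[R]_d | (`|u| <= r)%R].

(** Volume comparison: a covering set of diameter [t] pulls back into a cube of half-side [t/c], of
    volume [(2t/c)^d]. The factor [(c/4)^d] converts this into [(t/2)^d], the term in the content.
    The content at scale 1 already suffices; the scale only makes the diameters finite. *)
Lemma hausdorff_biLipschitz_gt0 r : (0 < r)%R -> 0 < H (phi @` ball r).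
Proof.
move=> r0; have [b b0 bE] := unit_ball_volume_fin_gt0 R d.
apply: (@lt_le_trans _ _ (b * (2 * r) ^+ d * (c / 4) ^+ d)%:E).
  by rewrite lte_fin !mulr_gt0// exprn_gt0 ?mulr_gt0// divr_gt0.
apply: le_trans (@le_hausdorff_content _ _ _ _ 1%R _ ltr01).
apply: le_ereal_inf_tmp => _ [U [AU dU] <-].
have dE n : exists2 t : R, (0 <= t)%R & diam dist (U n) = t%:E.
  have fin : diam dist (U n) \is a fin_num.
    by rewrite ge0_fin_numE ?diam_ge0// (le_lt_trans (dU n))// ltry.
  by exists (fine (diam dist (U n))); rewrite ?fineK// fine_ge0// diam_ge0.
have /choice[B BP] n : exists B, [/\ measurable B, phi @^-1` U n `<=` B &
   lebesgue_rV d B * ((c / 4) ^+ d)%:E <= (diam dist (U n) * 2^-1%:E) ^+ d].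
  have [t t0 tE] := dE n; rewrite tE -EFinM -EFin_expe.
  have [[u0 Uu0]|Un0] := pselect (exists u0, U n (phi u0)); last first.
    exists set0; split => //; first by move=> u Uu; apply: Un0; exists u.
    by rewrite measure0 mul0e lee_fin exprn_ge0// divr_ge0.
  have mball := @measurable_norm_le R d (t / c).
  have tc0 : (0 <= t / c)%R by rewrite divr_ge0// ltW.
  exists [set u | (`|u - u0| <= t / c)%R]; split.
  - rewrite [X in measurable X](_ : _ = (fun u => u - u0)%R @^-1` [set u | (`|u| <= t / c)%R])//.
    rewrite -[X in measurable X]setTI.
    by apply: (@measurable_add_rV _ _ _ _ id (cst (- u0)%R)).
  - move=> u Uu /=; rewrite ler_pdivlMr// mulrC; apply: (le_trans (phi_lower _ _)).
    by apply: (diam_leP dist (U n) t0).1; rewrite ?tE.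
  - rewrite [X in lebesgue_rV d X](_ : _ = [set u | [set v | (`|v| <= t / c)%R] (u + - u0)%R])//.
    rewrite lebesgue_rVD// lebesgue_rV_ball// -EFinM lee_fin -exprMn.
    rewrite le_eqVlt; apply/orP; left; apply/eqP; congr ((_ ^+ _)%R).
    by field; rewrite gt_eqF.
rewrite bE nneseriesZl; last first.
  by move=> n _; rewrite expe_ge0// mule_ge0 ?diam_ge0// lee_fin invr_ge0.
rewrite -mulrA EFinM lee_pmul2l// EFinM.
apply: (@le_trans _ _ ((\sum_(0 <= n <oo) lebesgue_rV d (B n)) * ((c / 4) ^+ d)%:E)).
  rewrite lee_pmul2r ?lte_fin ?exprn_gt0 ?divr_gt0//.
  rewrite -lebesgue_rV_ball ?(ltW r0)//; apply: (measure_sigma_subadditive (lebesgue_rV d)).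
  - by move=> n; have [] := BP n.
  - exact: measurable_norm_le.
  - move=> u ur; have [n _ Uphi] := AU (phi u) (imageP _ ur).
    by exists n => //; have [_ + _] := BP n; apply.
rewrite muleC -nneseriesZl//.
by apply: lee_nneseries => [n _ _|n _]; [rewrite mule_ge0// lee_fin exprn_ge0// divr_ge0// ltW|rewrite muleC; have [] := BP n].
Qed.

(** Cut the cube into [(M+1)^d] cells of side [s = 2r/(M+1)]. Their images have diameter at most
    [C * s], and the total weight is at most [b * (C * r)^d] whatever [M] is. *)
Lemma hausdorff_biLipschitz_lty r : (0 < r)%R -> H (phi @` ball r) < +oo.
Proof.
move=> r0; have [b b0 bE] := unit_ball_volume_fin_gt0 R d.
apply: (@le_lt_trans _ _ (b * (C * r) ^+ d)%:E); last by rewrite ltry.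
apply: ge_ereal_sup => _ [e e0 <-].
have [M Me] : exists M, (C * (2 * r / M.+1%:R) <= e)%R.
  have x0 : (0 < e / (C * (2 * r)))%R by rewrite divr_gt0// !mulr_gt0.
  have [M _ /(_ M (leqnn M)) Mx] := near_infty_natSinv_lt (PosNum x0).
  exists M; rewrite mulrA -ler_pdivlMl; last by rewrite !mulr_gt0.
  by rewrite mulrC; exact: ltW.
pose s : R := (2 * r / M.+1%:R)%R.
have s0 : (0 < s)%R by rewrite divr_gt0// mulr_gt0.
pose cell (f : {ffun 'I_d -> 'I_M.+1}) : set 'rV[R]_d :=
  [set u | forall i, (- r + s * (f i)%:R <= u ord0 i <= - r + s * (f i).+1%:R)%R].
have cell_norm f u v : cell f u -> cell f v -> (`|u - v| <= s)%R.
  move=> fu fv; apply/norm_rV_le; first exact: ltW.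
  move=> i; rewrite !mxE ler_norml; have := fu i; have := fv i; rewrite -natr1; lra.
have cover : ball r `<=` \bigcup_f cell f.
  move=> u /(norm_rV_le _ (ltW r0)) ur.
  (* The minimum with [M] puts the face [u_i = r], where the quotient equals [M+1], into the last
     cell. *)
  pose f := [ffun i => inord (minn (Num.truncn ((u ord0 i + r) / s)) M) : 'I_M.+1].
  exists f => // i; rewrite ffunE inordK; last by rewrite ltnS geq_minr.
  have := ur i; rewrite ler_norml => /andP[u1 u2].
  have x0 : (0 <= (u ord0 i + r) / s)%R by rewrite divr_ge0 ?(ltW s0)//; lra.
  have /andP[t1 t2] := truncn_itv x0.
  have sM : (s * M.+1%:R = 2 * r)%R by rewrite /s divfK.
  move: t1 t2; rewrite ler_pdivlMr// ltr_pdivrMr// => t1 t2.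
  set k := Num.truncn _ in t1 t2 *; case: (leqP k M) => kM.
    by apply/andP; split; nra.
  apply/andP; split; last by rewrite sM; lra.
  have kMR : (M%:R <= k%:R :> R)%R by rewrite ler_nat ltnW.
  by nra.
pose w A := b%:E * (diam dist A * 2^-1%:E) ^+ d.
have dcell f : diam dist (phi @` cell f) <= (C * s)%:E.
  apply/diam_leP; first by rewrite ltW ?mulr_gt0.
  move=> _ _ [u fu <-] [v fv <-]; apply: (le_trans (phi_upper _ _)).
  by rewrite ler_pM2l//; exact: cell_norm.
have w_ge0 A : 0 <= w A.
  by rewrite mule_ge0 ?lee_fin ?(ltW b0)// expe_ge0// mule_ge0 ?diam_ge0// lee_fin invr_ge0.
have w0 : w set0 = 0 by rewrite /w diam0 mul0e; case: d d_gt0 => // n _; rewrite expeS mul0e mule0.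
have wcell f : w (phi @` cell f) <= (b * (C * s / 2) ^+ d)%:E.
  have fin : diam dist (phi @` cell f) \is a fin_num.
    by rewrite ge0_fin_numE ?diam_ge0// (le_lt_trans (dcell f))// ltry.
  have t0 : (0 <= fine (diam dist (phi @` cell f)))%R by rewrite fine_ge0// diam_ge0.
  have := dcell f; rewrite /w -(fineK fin) lee_fin => dC.
  rewrite -EFinM -EFin_expe -EFinM lee_fin ler_pM2l//.
  have Cs0 : (0 <= C * s)%R by rewrite ltW// mulr_gt0.
  by apply: lerXn2r; rewrite ?nnegrE ?divr_ge0// ler_pM2r// invr_gt0.
have [U [UF Ucov] Usum] := @sum_ord_const_oo R T #|{ffun 'I_d -> 'I_M.+1}| w
  (fun i => phi @` cell (enum_val i)) _ w0 (fun i => wcell _) w_ge0.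
apply: (@le_trans _ _ (\sum_(0 <= k <oo) w (U k))).
  apply: ereal_inf_lbound; exists U; last by rewrite /w bE.
  split.
    move=> _ [u ur <-]; apply: Ucov; have [f _ fu] := cover u ur.
    by exists (enum_rank f) => //; rewrite enum_rankK; exists u.
  move=> k; have [->|[i ->]] := UF k; first by rewrite diam0 lee_fin ltW.
  by apply: le_trans (dcell _) _; rewrite lee_fin.
apply: (le_trans Usum); rewrite card_ffun !card_ord lee_fin natrX mulrCA -exprMn.
rewrite ler_pM2l// le_eqVlt; apply/orP; left; apply/eqP; congr ((_ ^+ _)%R).
by rewrite /s; field; rewrite nat1r pnatr_eq0.
Qed.

End BiLipschitz.

(** * Equivalence of norms and scalar products *)

Section NormComparison.
Context {R : realType}.

(** The constants are the minimum and maximum of [q] on the compact unit sphere. It applies to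
    [ipnorm] and to [ipnorm] composed with an injective linear map. *)
Lemma homogeneous_norm_equiv n (q : 'rV[R]_n -> R) : continuous q ->
  (forall a v, q (a *: v) = `|a| * q v) -> (forall v, v != 0 -> 0 < q v) ->
  exists c C, [/\ 0 < c, 0 < C, forall v, c * `|v| <= q v & forall v, q v <= C * `|v|].
Proof.
move=> cq qZ q0; pose S := [set v : 'rV[R]_n | `|v| = 1].
have q00 : q 0 = 0 by rewrite -(scale0r 0) qZ normr0 mul0r.
have cS : compact S.
  apply: bounded_closed_compact.
    by exists 1; split; rewrite ?num_real// => x x1 v; rewrite /S/= => ->; exact: ltW.
  have -> : S = Num.norm @^-1` [set x | x = 1] by [].
  by apply: closed_comp => [x _|]; [exact: norm_continuous|exact: closed_eq].
have norml v : v != 0 -> S (`|v|^-1 *: v).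
  by move=> v0; rewrite /S/= normrZ normfV normr_id mulVf// normr_eq0.
have qE v : v != 0 -> q v = `|v| * q (`|v|^-1 *: v).
  by move=> v0; rewrite qZ normfV normr_id mulrA divff ?mul1r// normr_eq0.
(* For [n = 0] the sphere is empty and every vector is 0, so any constants work. *)
have [[u Su]|S0] := pselect (S !=set0); last first.
  exists 1, 1; split => // v; have [->|v0] := eqVneq v 0; rewrite ?normr0 ?q00 ?mulr0//;
  by exfalso; apply: S0; exists (`|v|^-1 *: v); exact: norml.
have cqS : {within S, continuous q} by exact: continuous_subspaceT.
have [x Sx qx] := compact_EVT_min (ex_intro _ _ Su) cS cqS.
have [y Sy qy] := compact_EVT_max (ex_intro _ _ Su) cS cqS.
have S_neq0 z : S z -> z != 0 by move=> Sz; rewrite -normr_eq0 Sz oner_eq0.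
exists (q x), (q y); split.
- by apply: q0; exact/S_neq0/set_mem.
- by apply: q0; exact/S_neq0/set_mem.
- move=> v; have [->|v0] := eqVneq v 0; first by rewrite normr0 q00 mulr0.
  by rewrite (qE v)// mulrC ler_pM2l ?normr_gt0// qx// inE; exact: norml.
- move=> v; have [->|v0] := eqVneq v 0; first by rewrite normr0 q00 mulr0.
  by rewrite (qE v)// mulrC ler_pM2r ?normr_gt0// qy// inE; exact: norml.
Qed.

Lemma continuous_sumr (T : topologicalType) (W : normedModType R) (I : Type)
    (r : seq I) (f : I -> T -> W) : (forall i, continuous (f i)) ->
  continuous (fun x => \sum_(i <- r) f i x).
Proof. by move=> fc; apply: continuous_big => //; exact: add_continuous. Qed.

Lemma continuous_linear_rV m n (f : {linear 'rV[R]_m -> 'rV[R]_n}) : continuous f.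
Proof.
have fE : f = (fun v => \sum_i v ord0 i *: f (delta_mx ord0 i)) :> (_ -> _).
  apply/funext => v; rewrite {1}(row_sum_delta v) linear_sum.
  by apply: eq_bigr => i _; rewrite linearZ.
rewrite fE; apply: continuous_sumr => i v.
exact: (cvgZr_tmp (@coord_continuous R 1 m ord0 i v)).
Qed.

End NormComparison.

Section ScalarProductNorm.
Context {R : realType} (n : nat) (ip : {dot 'rV[R]_n for idfun}).
Implicit Types u v : 'rV[R]_n.

Lemma ipC u v : ip u v = ip v u.
Proof. by rewrite (hermC ip) expr0 mul1r. Qed.

Lemma ip_ge0 u : 0 <= ip u u.
Proof.
by have [->|u0] := eqVneq u 0; [rewrite linear0r|exact/ltW/neq0_dnorm_gt0].
Qed.

Lemma ipnorm_ge0 u : 0 <= ipnorm ip u. Proof. exact: sqrtr_ge0. Qed.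

Lemma ipnorm_sqr u : ipnorm ip u ^+ 2 = ip u u.
Proof. by rewrite sqr_sqrtr// ip_ge0. Qed.

Lemma ipnorm_gt0 u : u != 0 -> 0 < ipnorm ip u.
Proof. by move=> u0; rewrite sqrtr_gt0 neq0_dnorm_gt0. Qed.

Lemma ipnormZ a u : ipnorm ip (a *: u) = `|a| * ipnorm ip u.
Proof.
rewrite /ipnorm linearZl_LR linearZr_LR/= mulrA -expr2 sqrtrM ?sqr_ge0//.
by rewrite sqrtr_sqr.
Qed.

Lemma ipnormN u : ipnorm ip (- u) = ipnorm ip u.
Proof. by rewrite -scaleN1r ipnormZ normrN1 mul1r. Qed.

Lemma ipnorm_continuous : continuous (ipnorm ip).
Proof.
have ipE u : ip u u = \sum_i \sum_j u ord0 i * u ord0 j *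
    ip (delta_mx ord0 i) (delta_mx ord0 j).
  rewrite {1}(row_sum_delta u) linear_sumlz; apply: eq_bigr => i _.
  rewrite {2}(row_sum_delta u) linear_sum; apply: eq_bigr => j _.
  by rewrite linearZ/= linearZl_LR/=; ring.
move=> u; rewrite /ipnorm; apply: continuous_comp; last exact: sqrt_continuous.
rewrite (funext ipE : (fun u => ip u u) = _); move: u.
apply: continuous_sumr => i; apply: continuous_sumr => j u.
have h l := @coord_continuous R 1 n ord0 l u.
exact: (cvgMr_tmp (cvgM (h i) (h j))).
Qed.

Lemma ipnorm_pythagoras u v : ip u v = 0 ->
  ipnorm ip (u - v) ^+ 2 = ipnorm ip u ^+ 2 + ipnorm ip v ^+ 2.
Proof.
move=> uv; rewrite !ipnorm_sqr.
have -> : ip (u - v) (u - v) = ip u u - ip u v - (ip v u - ip v v).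
  by rewrite linearBl !linearB.
by rewrite [ip v u]ipC uv; ring.
Qed.

End ScalarProductNorm.

Section SubspaceHausdorff.
Context {R : realType} (n : nat) (ip : {dot 'rV[R]_n for idfun}).
Variable E0 : {vspace 'rV[R]_n}.
Local Notation k := (\dim E0).
Local Notation H := (hausdorff (ipdist ip) k).

(** Coordinates in an arbitrary basis: a bi-Lipschitz chart of [E0] is enough for finiteness and
    positivity, so the basis is not made orthonormal. *)
Let phi (u : 'rV[R]_k) : 'rV[R]_n := \sum_i u ord0 i *: (vbasis E0)`_i.

Let phi_is_linear : linear phi.
Proof.
move=> a u v; rewrite /phi scaler_sumr -big_split/=; apply: eq_bigr => i _.
by rewrite !mxE scalerDl scalerA.
Qed.
HB.instance Definition _ := GRing.isLinear.Build _ _ _ _ phi phi_is_linear.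

Let phi_neq0 u : u != 0 -> phi u != 0.
Proof.
apply: contra => /eqP phiu0; apply/eqP/rowP => i; rewrite mxE.
have /freeP := basis_free (vbasisP E0).
by move=> /(_ (fun i => u ord0 i) phiu0).
Qed.

Let phi_image : range phi = [set` E0].
Proof.
apply/seteqP; split => [_ [u _ <-]|v /= vE].
  by apply: memv_suml => i _; rewrite memvZ// vbasis_mem// mem_nth// size_tuple.
exists (\row_i coord (vbasis E0) i v) => //.
by rewrite {2}(coord_vbasis vE); apply: eq_bigr => i _; rewrite mxE.
Qed.

Lemma hausdorff_subspace_ball r : (0 < k)%N -> 0 < r ->
  (0 < H ([set v | (`|v| <= r)%R] `&` [set` E0]) < +oo)%E.
Proof.
move=> k0 r0.
have [c1 [C1 [c10 C10 lo1 up1]]] : exists c C, [/\ 0 < c, 0 < C,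
    forall u, c * `|u| <= ipnorm ip (phi u) & forall u, ipnorm ip (phi u) <= C * `|u|].
  apply: homogeneous_norm_equiv.
  - move=> u; apply: continuous_comp; last exact: ipnorm_continuous.
    exact: continuous_linear_rV.
  - by move=> a u; rewrite linearZ ipnormZ.
  - by move=> u u0; rewrite ipnorm_gt0// phi_neq0.
have [c2 [C2 [c20 C20 lo2 up2]]] := homogeneous_norm_equiv
  (@ipnorm_continuous _ _ ip) (ipnormZ ip) (ipnorm_gt0 ip).
have lo u v : c1 * `|u - v| <= ipdist ip (phi u) (phi v).
  by rewrite /ipdist -linearB.
have up u v : ipdist ip (phi u) (phi v) <= C1 * `|u - v|.
  by rewrite /ipdist -linearB.
apply/andP; split.
  (* The radius makes [c2 * |phi u| <= ipnorm ip (phi u) <= C1 * |u| <= c2 * r]. *)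
  apply: (@lt_le_trans _ _ (H (phi @` [set u | `|u| <= r * c2 / C1]))).
    by apply: (hausdorff_biLipschitz_gt0 c10 lo); rewrite divr_gt0// mulr_gt0.
  apply: le_hausdorff => _ [u ur <-]; split; last by rewrite -phi_image; exists u.
  rewrite /= -(ler_pM2l c20) (le_trans (lo2 _))// (le_trans (up1 _))//.
  by rewrite mulrC -ler_pdivlMr// [c2 * r]mulrC.
(* Conversely [c1 * |u| <= ipnorm ip (phi u) <= C2 * r] when [phi u] lies in the ball. *)
apply: (@le_lt_trans _ _ (H (phi @` [set u | `|u| <= C2 * r / c1]))); last first.
  by apply: (hausdorff_biLipschitz_lty k0 C10 up); rewrite divr_gt0// mulr_gt0.
apply: le_hausdorff => v [vr]; rewrite -phi_image => -[u _ uv].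
exists u => //=; rewrite ler_pdivlMr// mulrC (le_trans (lo1 _))// uv.
by rewrite (le_trans (up2 _))// ler_pM2l.
Qed.

End SubspaceHausdorff.

(** * Densities, translation-invariant measures and Gaussian integrals *)

Section AeIntegral.
Context d (T : measurableType d) (R : realType) (mu : {measure set T -> \bar R}).
Local Open Scope ereal_scope.
Import HBNNSimple.

Lemma integral_nnsfunT (h : {nnsfun T >-> R}) : \int[mu]_x (h x)%:E = sintegral mu h.
Proof. by rewrite integral_nnsfun// patch_setT. Qed.

Let nnint (f : T -> \bar R) := ereal_sup [set sintegral mu h |
  h in [set h : {nnsfun T >-> R} | forall x, (h x)%:E <= f x]].

(* Cutting a simple function off on a null set does not change its integral,
   so no measurability of f and g is needed. *)
Let nnint_ae_le f g : (forall x, 0 <= g x) -> (\forall x \ae mu, f x = g x) ->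
  nnint f <= nnint g.
Proof.
move=> g0 [N [mN N0 fgN]]; apply: ge_ereal_sup => _ [h /= hf <-].
pose h' := proj_nnsfun h (measurableC mN).
have h'E x : h' x = (h x * \1_(~` N) x)%R by rewrite /h' /proj_nnsfun/= mindicE.
have -> : sintegral mu h = sintegral mu h'.
  rewrite -!integral_nnsfunT; apply: ge0_ae_eq_integral => //.
  - exact/measurable_EFinP.
  - exact/measurable_EFinP.
  - by move=> x _; rewrite lee_fin.
  - by move=> x _; rewrite lee_fin.
  - exists N; split => // x /=; apply: contra_notP => Nx _.
    by rewrite /= mindicE mem_set// mulr1.
apply: ereal_sup_ubound; exists h' => //= x.
rewrite /= mindicE; case: (boolP (x \in ~` N)) => [/set_mem Nx|_]; last by rewrite mulr0.
rewrite mulr1; have /contrapT <- : ~ ~ (f x = g x) by move=> fgx; apply: Nx; exact: fgN.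
exact: hf.
Qed.

(** This is what allows [LD], measurable only up to a null set, to be exchanged for Borel functions
    under the integral. *)
Lemma ae_eq_integral_nonmeasurable f g : (\forall x \ae mu, f x = g x) ->
  \int[mu]_x f x = \int[mu]_x g x.
Proof.
move=> fg; rewrite /integral; congr (_ - _); apply/eqP; rewrite eq_le; apply/andP; split;
  apply: nnint_ae_le => //; apply: filterS fg => x;
  by rewrite !(funeposE, funenegE) !patch_setT => ->.
Qed.

End AeIntegral.

Section Density.
Context d (T : measurableType d) (R : realType) (mu : {measure set T -> \bar R}).
Variable w : T -> R.
Hypotheses (mw : measurable_fun setT w) (w0 : forall x, 0 <= w x).
Local Open Scope ereal_scope.

Lemma density_measure : exists m : {measure set T -> \bar R},
  (m : set T -> \bar R) = fun A => \int[mu]_(x in A) (w x)%:E.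
Proof.
apply: measure_of => [|A|F mF tF mUF].
- by rewrite integral_set0.
- by apply: integral_ge0 => x _; rewrite lee_fin.
- rewrite ge0_integral_bigcup//.
  + by apply: is_cvg_nneseries => n _ _; apply: integral_ge0 => x _; rewrite lee_fin.
  + by apply/measurable_EFinP; exact: measurable_funTS.
  + by move=> x _; rewrite lee_fin.
Qed.

Import HBNNSimple.

(** By definition on indicators, then for simple functions by linearity, and in general by monotone
    convergence. Any [nu] with the right values on measurable sets is allowed, since [mu] in the
    theorem is only known there. *)
Lemma ge0_integral_density (nu : {measure set T -> \bar R}) (f : T -> \bar R) :
  (forall A, measurable A -> nu A = \int[mu]_(x in A) (w x)%:E) ->
  measurable_fun setT f -> (forall x, 0 <= f x) ->
  \int[nu]_x f x = \int[mu]_x (f x * (w x)%:E).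
Proof.
move=> nuE mf f0; pose h := nnsfun_approx measurableT mf.
have mh n r : measurable (h n @^-1` [set r]) by [].
have sE n : \int[nu]_x (h n x)%:E = \int[mu]_x ((h n x)%:E * (w x)%:E).
  rewrite integral_nnsfunT sintegralE.
  transitivity (\int[mu]_x (\sum_(y \in range (h n))
      (y * \1_(h n @^-1` [set y]) x)%:E * (w x)%:E)).
    rewrite ge0_integral_fsum//; last 2 first.
    - move=> y; apply: emeasurable_funM; apply/measurable_EFinP => //.
      by apply: measurable_funM.
    - move=> y x _; apply: mule_ge0; last by rewrite lee_fin.
      exact: nnfun_muleindic_ge0.
    apply: eq_fsbigr => r /set_mem[x _ <-].
    under eq_integral do rewrite EFinM -muleA.
    rewrite ge0_integralZl//; last 3 first.
    - by apply: emeasurable_funM; apply/measurable_EFinP.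
    - by move=> y _; rewrite mule_ge0 ?lee_fin.
    - by rewrite lee_fin.
    congr (_ * _); rewrite nuE// [LHS]integral_mkcond.
    apply: eq_integral => y _; rewrite patchE indicE.
    by case: ifP => _; rewrite ?mul1e ?mul0e.
  apply: eq_integral => x _; rewrite -ge0_mule_fsuml; last first.
    by move=> y; exact: nnfun_muleindic_ge0.
  by rewrite fsumEFin// -(fimfunE (h n) x).
have hf x : (h n x)%:E @[n --> \oo] --> f x by exact: cvg_nnsfun_approx.
have hnd x : {homo (fun n => h n x) : a b / (a <= b)%N >-> (a <= b)%R}.
  by move=> a b ab; exact/lefP/nd_nnsfun_approx.
transitivity (limn (fun n => \int[nu]_x (h n x)%:E)).
  rewrite -monotone_convergence//.
  - by apply: eq_integral => x _; apply/esym/cvg_lim => //; exact: hf.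
  - by move=> n; apply/measurable_EFinP.
  - by move=> n x _; rewrite lee_fin.
  - by move=> x _ a b ab; rewrite lee_fin hnd.
under eq_fun do rewrite sE.
rewrite -monotone_convergence//.
- apply: eq_integral => x _; apply/cvg_lim => //.
  by apply: cvgeZr => //; exact: hf.
- by move=> n; apply: emeasurable_funM; apply/measurable_EFinP.
- by move=> n x _; rewrite mule_ge0 ?lee_fin.
- by move=> x _ a b ab; rewrite lee_wpmul2r ?lee_fin// hnd.
Qed.

End Density.

(** * Uniqueness of translation-invariant measures *)

Section TranslationInvariant.
Context {R : realType} (n : nat).
Local Open Scope ereal_scope.
Local Notation V := 'rV[R]_n.

Lemma ge0_integral_shift (nu : {measure set V -> \bar R}) (c : V) :
  (forall A : set V, measurable A -> nu [set v | A (v + c)%R] = nu A) ->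
  forall f, measurable_fun setT f -> (forall x, 0 <= f x) ->
  \int[nu]_x f (x + c)%R = \int[nu]_x f x.
Proof.
move=> nuc f mf f0; have mc : measurable_fun setT (fun x : V => x + c)%R.
  by apply: measurable_add_rV => //; exact: measurable_id.
rewrite -[LHS](@ge0_integral_pushforward _ _ _ _ _ _ mc nu setT f)//.
by apply: eq_measure_integral => A mA _; exact: nuc.
Qed.

(** Evaluate the double integral of $1_Q(y)1_A(x+y)$ twice. Invariance of [nu2] in [x] gives the
    left side. Shifting [y] by [-x] turns the integrand into $1_Q(y-x)1_A(y)$, and invariance in [x]
    then gives the mass of $-Q$ times that of $A$. *)
Lemma translation_invariant_proportional
    (nu1 nu2 : {sigma_finite_measure set V -> \bar R}) (Q : set V) :
  (forall (c : V) (A : set V), measurable A -> nu1 [set v | A (v + c)%R] = nu1 A) ->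
  (forall (c : V) (A : set V), measurable A -> nu2 [set v | A (v + c)%R] = nu2 A) ->
  measurable Q -> forall A, measurable A ->
  nu1 Q * nu2 A = nu2 [set v | Q (- v)%R] * nu1 A.
Proof.
move=> inv1 inv2 mQ A mA.
have mopp : measurable_fun setT (fun x : V => - x)%R.
  by apply: measurable_opp_rV; exact: measurable_id.
have mind (B : set V) d (T : measurableType d) (f : T -> V) : measurable B ->
    measurable_fun setT f -> measurable_fun setT (fun x => (\1_B (f x))%:E : \bar R).
  move=> mB mf; apply/measurable_EFinP.
  by apply: (@measurableT_comp _ _ _ _ _ _ (\1_B : V -> R)).
pose F (p : V * V) := (\1_Q p.2)%:E * (\1_A (p.1 + p.2)%R)%:E : \bar R.
pose G (p : V * V) := (\1_Q (p.2 - p.1)%R)%:E * (\1_A p.2)%:E : \bar R.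
have mF : measurable_fun setT F.
  apply: emeasurable_funM; apply: mind => //.
  by apply: measurable_add_rV.
have mG : measurable_fun setT G.
  apply: emeasurable_funM; apply: mind => //.
  by apply: measurable_add_rV => //; apply: measurable_opp_rV.
have F0 p : 0 <= F p by rewrite mule_ge0 ?lee_fin.
have G0 p : 0 <= G p by rewrite mule_ge0 ?lee_fin.
have mN : measurable [set v | Q (- v)%R].
  by rewrite -[X in measurable X]setTI; exact: mopp.
have mshift (B : set V) (c : V) : measurable B -> measurable [set v | B (v + c)%R].
  move=> mB; rewrite -[X in measurable X]setTI.
  have : measurable_fun setT (fun v : V => v + c)%R.
    by apply: measurable_add_rV => //; exact: measurable_id.
  exact.
transitivity (\int[nu1]_y \int[nu2]_x F (x, y)).
  transitivity (\int[nu1]_y ((\1_Q y)%:E * nu2 A)).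
    rewrite ge0_integralZr//; last by apply: mind => //; exact: measurable_id.
    by rewrite integral_indic// setIT.
  apply: eq_integral => y _; rewrite /F/= ge0_integralZl//; last first.
    by apply: mind => //; apply: measurable_add_rV => //; exact: measurable_id.
  congr (_ * _); rewrite -(inv2 y)//.
  transitivity (\int[nu2]_x (\1_[set v | A (v + y)%R] x)%:E).
    by rewrite integral_indic ?setIT//; exact: mshift.
  by apply: eq_integral => x _; rewrite !indicE; congr (_%:R%:E); congr (nat_of_bool _);
    apply/idP/idP; rewrite !inE.
rewrite -(fubini_tonelli F)//.
transitivity (\int[nu2]_x \int[nu1]_y G (x, y)).
  apply: eq_integral => x _.
  rewrite -[RHS](@ge0_integral_shift nu1 x)//; last first.
    by apply: measurableT_comp mG _; exact: measurable_fun_pair.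
    by move=> B mB; exact: inv1.
  by apply: eq_integral => y _; rewrite /G /F/= addrK [(x + y)%R]addrC.
rewrite (fubini_tonelli G)//.
transitivity (\int[nu1]_y (nu2 [set v | Q (- v)%R] * (\1_A y)%:E)).
  apply: eq_integral => y _; rewrite /G/= ge0_integralZr//; last first.
    by apply: mind => //; apply: measurable_add_rV => //; apply: measurable_opp_rV.
  congr (_ * _); rewrite -(inv2 (- y)%R)//.
  transitivity (\int[nu2]_x (\1_[set v | Q (- (v - y))%R] x)%:E).
    by apply: eq_integral => x _; rewrite !indicE; congr (_%:R%:E); congr (nat_of_bool _);
      apply/idP/idP; rewrite !inE/= opprB.
  by rewrite integral_indic ?setIT//; exact: (mshift [set v | Q (- v)%R]).
rewrite ge0_integralZl//; first by rewrite integral_indic// setIT.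
by apply: mind => //; exact: measurable_id.
Qed.

End TranslationInvariant.

(** * Finiteness of Gaussian integrals *)

Section Gaussian.
Context {R : realType}.
Local Open Scope ereal_scope.

Lemma integral_gauss1_lty (c : R) : (0 < c)%R ->
  \int[lebesgue_measure]_x (expR (- c * x ^+ 2))%:E < +oo.
Proof.
(* The standard deviation for which the normal density is a multiple of [expR (- c * x ^+ 2)]; its
   total mass 1 excludes an infinite integral. *)
move=> c0; pose s := Num.sqrt ((2 * c)^-1).
have s2 : (s ^+ 2 = (2 * c)^-1)%R by rewrite sqr_sqrtr// invr_ge0 mulr_ge0// ltW.
have s0 : (s != 0)%R by rewrite gt_eqF// sqrtr_gt0 invr_gt0 mulr_gt0.
have := integral_normal_pdf 0 s; rewrite normal_pdfE//.
under eq_integral do rewrite EFinM.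
rewrite ge0_integralZl//; last 3 first.
- by apply/measurable_EFinP; exact: measurable_normal_fun.
- by move=> x _; rewrite lee_fin expR_ge0.
- by rewrite lee_fin normal_peak_ge0.
move=> int1; have peak0 := normal_peak_gt0 s0.
have -> : \int[lebesgue_measure]_x (expR (- c * x ^+ 2))%:E =
    \int[lebesgue_measure]_x (normal_fun 0 s x)%:E.
  apply: eq_integral => x _; rewrite /normal_fun s2 subr0; congr ((expR _)%:E).
  by field; rewrite gt_eqF.
rewrite ltNge leye_eq; apply/negP => /eqP intoo; move: int1.
by rewrite intoo mulry gtr0_sg// mul1e.
Qed.

Lemma integral_gauss_lty m (c : R) : (0 < c)%R ->
  \int[lebesgue_rV m]_x (expR (- c * \sum_i (x : 'rV[R]_m) ord0 i ^+ 2))%:E < +oo.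
Proof.
move=> c0; elim: m => [|m ih].
  under eq_integral do rewrite big_ord0 mulr0 expR0.
  by rewrite integral_cst// mul1e/= diracE ltry.
have mE k : measurable_fun setT
    (fun x : 'rV[R]_k => (expR (- c * \sum_i x ord0 i ^+ 2))%:E).
  apply/measurable_EFinP; apply: measurableT_comp => //; apply: measurable_funM => //.
  by apply: measurable_sum => i; apply: measurable_funX; exact: measurable_coord.
rewrite ge0_integral_lebesgue_rVS//.
have inner x : \int[lebesgue_rV m]_v
    (expR (- c * \sum_i cons_rV (x, v : 'rV[R]_m) ord0 i ^+ 2))%:E = (expR (- c * x ^+ 2))%:E *
    \int[lebesgue_rV m]_v (expR (- c * \sum_i (v : 'rV[R]_m) ord0 i ^+ 2))%:E.
  rewrite -ge0_integralZl//.
  apply: eq_integral => v _; rewrite big_ord_recl cons_rV0 mulrDr expRD EFinM.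
  by under eq_bigr do rewrite cons_rVS.
under eq_integral do rewrite inner.
have I_ge0 : 0 <= \int[lebesgue_rV m]_v (expR (- c * \sum_i (v : 'rV[R]_m) ord0 i ^+ 2))%:E.
  by apply: integral_ge0 => v _; rewrite lee_fin expR_ge0.
rewrite ge0_integralZr//; last first.
  by apply/measurable_EFinP; apply: measurableT_comp => //; apply: measurable_funM => //; exact: measurable_funX.
apply: lte_mul_pinfty => //.
  by apply: integral_ge0 => v _; rewrite lee_fin expR_ge0.
rewrite ge0_fin_numE ?integral_gauss1_lty//.
by apply: integral_ge0 => v _; rewrite lee_fin expR_ge0.
Qed.

End Gaussian.

(** * Radon regularity of finite Borel measures *)

Section ClosedApproximation.
Context {R : realType} {V : normedModType R}.

Lemma closed_far (F : set V) n : closed (far F n).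
Proof.
have -> : far F n = \bigcap_(y in F) [set x | n.+1%:R^-1 <= `|x - y|].
  by apply/seteqP; split => x Fx y; exact: Fx.
apply: closed_bigI => y _.
have -> : [set x | n.+1%:R^-1 <= `|x - y|] = (fun x => `|x - y|) @^-1` [set r | n.+1%:R^-1 <= r] by [].
apply: closed_comp => [x _|]; last exact: closed_ge.
apply: (@continuous_comp _ _ _ (fun x : V => x - y) Num.norm); last exact: norm_continuous.
by apply: cvgB; [exact: cvg_id|exact: cvg_cst].
Qed.

End ClosedApproximation.

Section Regularity.
Context {R : realType} (n : nat).
Local Notation X := ('rV[R]_n * 'rV[R]_n)%type.
Local Open Scope ereal_scope.
Variable m : {measure set X -> \bar R}.
Hypothesis m_fin : m setT < +oo.

Let mfin A : measurable A -> m A \is a fin_num.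
Proof.
move=> mA; rewrite ge0_fin_numE//; apply: le_lt_trans m_fin.
by apply: le_measure; rewrite ?inE.
Qed.

Let mDsub A B : measurable A -> measurable B -> B `<=` A -> m (A `\` B) = m A - m B.
Proof.
move=> mA mB BA; rewrite measureD//; last by rewrite -ge0_fin_numE// mfin.
by congr (_ - m _); apply/seteqP; split => [x []|x Bx] //; split => //; exact: BA.
Qed.

Let measurable_closed (F : set X) : closed F -> measurable F.
Proof.
by move=> cF; rewrite -(setCK F); apply: measurableC; apply: open_measurable_pair; exact: closed_openC.
Qed.

(** Two-sided approximation is symmetric under complements, so these sets form a sigma-algebra;
    inner approximation alone would not show this. *)
Let regular (A : set X) := measurable A /\ forall e : R, (0 < e)%R ->
  exists F U, [/\ closed F, open U, F `<=` A, A `<=` U & m (U `\` F) < e%:E].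

(** An open set is the increasing union of the closed sets of points far from its complement. *)
Let regular_open O : open O -> regular O.
Proof.
move=> oO; have mO := open_measurable_pair oO; split => // e e0.
pose F k := far (~` O) k.
have OE : O = \bigcup_k F k by rewrite -setC_bigcup_far ?setCK// closedC.
have ndF : nondecreasing_seq F.
  by move=> i j ij; apply/subsetPset; exact: le_far.
have cv : m (F k) @[k --> \oo] --> m O.
  rewrite [in X in _ --> X]OE; apply: nondecreasing_cvg_mu => //.
  - by move=> k; apply: measurable_closed; exact: closed_far.
  - by rewrite -OE.
have [k mk] : exists k, m O - e%:E < m (F k).
  have : m O - e%:E < m O by rewrite lteBlDr// lteDl// ?lte_fin// mfin.
  by move=> /open_ereal_gt'/cv[k _ /(_ k (leqnn k))]; exists k.
have FO : F k `<=` O by rewrite OE => x Fx; exists k.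
exists (F k), O; split => //; first exact: closed_far.
have mF : measurable (F k) by apply: measurable_closed; exact: closed_far.
by rewrite mDsub// lteBlDr ?mfin// addeC -lteBlDr.
Qed.

Let regularC A : regular A -> regular (~` A).
Proof.
move=> [mA Ae]; split; first exact: measurableC.
move=> e /Ae[F [U [cF oU FA AU UF]]]; exists (~` U), (~` F); split.
- by rewrite closedC.
- by rewrite openC.
- exact: subsetC.
- exact: subsetC.
- by rewrite setDE setCK setIC -setDE.
Qed.

Let regular_bigcup (A : (set X)^nat) : (forall k, regular (A k)) -> regular (\bigcup_k A k).
Proof.
move=> rA; have mUA : measurable (\bigcup_k A k).
  by apply: bigcupT_measurable => k; have [] := rA k.
split => // e e0.
have ek k : (0 < e / 2 / (2 ^ k.+1)%:R)%R by rewrite !divr_gt0// ltr0n expn_gt0.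
have /choice[F FP] k : exists F, exists U, [/\ closed F, open U, F `<=` A k, A k `<=` U &
    m (U `\` F) < (e / 2 / (2 ^ k.+1)%:R)%:E] by have [_ /(_ _ (ek k))] := rA k.
have /choice[U UP] := FP.
have mF k : measurable (F k) by apply: measurable_closed; have [] := UP k.
have mU k : measurable (U k) by apply: open_measurable_pair; have [] := UP k.
(* The union of all [F i] need not be closed; a finite partial union is, and it loses less than
   [e / 2]. The other half of [e] is shared among the sets [U k] minus [F k]. *)
pose G k := \big[setU/set0]_(i < k.+1) F i.
have mG k : measurable (G k) by apply: bigsetU_measurable => i _.
have mUF : measurable (\bigcup_k F k) by exact: bigcupT_measurable.
have cv : m (G k) @[k --> \oo] --> m (\bigcup_k F k).
  have -> : \bigcup_k F k = \bigcup_k G k by rewrite bigcup_bigsetU_bigcup.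
  apply: nondecreasing_cvg_mu => //; first exact: bigcupT_measurable.
  by move=> i j ij; apply/subsetPset; exact: subset_bigsetU.
have [k mk] : exists k, m (\bigcup_k F k) - (e / 2)%:E < m (G k).
  have : m (\bigcup_k F k) - (e / 2)%:E < m (\bigcup_k F k).
    by rewrite lteBlDr// lteDl// ?lte_fin ?divr_gt0// mfin.
  by move=> /open_ereal_gt'/cv[k _ /(_ k (leqnn k))]; exists k.
have GF : G k `<=` \bigcup_k F k by exact: bigsetU_bigcup.
exists (G k), (\bigcup_k U k); split.
- rewrite /G -bigcup_mkord; apply: closed_bigcup => // i _; by have [] := UP i.
- by apply: bigcup_open => i _; have [] := UP i.
- apply: subset_trans GF _; apply: subset_bigcup => i _; by have [] := UP i.
- by apply: subset_bigcup => i _; have [] := UP i.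
have mUU : measurable (\bigcup_k U k) by exact: bigcupT_measurable.
have sub : \bigcup_k U k `\` G k `<=`
    (\bigcup_k (U k `\` F k)) `|` ((\bigcup_k F k) `\` G k).
  move=> x [[i _ Ux] nGx]; have [Fx|nFx] := pselect ((\bigcup_k F k) x); first by right.
  by left; exists i => //; split => // Fx; apply: nFx; exists i.
have mD : measurable (\bigcup_k (U k `\` F k)).
  by apply: bigcupT_measurable => i; exact: measurableD.
apply: (@le_lt_trans _ _ (m (\bigcup_k (U k `\` F k)) + m ((\bigcup_k F k) `\` G k))).
  apply: (le_trans _ (measureU2 _ mD (measurableD mUF (mG k)))).
  by apply: le_measure; rewrite ?inE//; [exact: measurableD|apply: measurableU => //; exact: measurableD].
rewrite [X in _ < X%:E]splitr EFinD; apply: lee_ltD.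
- by rewrite mfin.
- apply: (@le_trans _ _ (\sum_(0 <= i <oo) m (U i `\` F i))).
    by apply: measure_sigma_subadditive => // i; exact: measurableD.
  apply: (@le_trans _ _ (\sum_(0 <= i <oo) (0 + (e / 2 / (2 ^ i.+1)%:R)%:E))).
    by apply: lee_nneseries => // i _; rewrite add0e ltW//; have [] := UP i.
  rewrite (le_trans (epsilon_trick _ _ _))//; first by rewrite ltW// divr_gt0.
  by rewrite eseries0// add0e.
- by rewrite mDsub// lteBlDr ?mfin// addeC -lteBlDr.
Qed.

Lemma finite_measure_regular A : measurable A -> regular A.
Proof.
have sig : sigma_algebra setT regular.
  split.
  - exact: (regular_open open0).
  - by move=> B /regularC; rewrite setTD.
  - exact: regular_bigcup.
(* The product sigma-algebra is generated by preimages under the two projections, so regularity is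
   first transported along each of them. *)
have cyl (p : X -> 'rV[R]_n) : continuous p ->
    preimage_set_system setT p measurable `<=` regular.
  move=> cp _ [B mB <-]; rewrite setTI.
  suff : measurable `<=` [set C | regular (p @^-1` C)] by exact.
  apply: smallest_sub.
    split => /=.
    - by rewrite preimage_set0; exact: (regular_open open0).
    - by move=> C; rewrite setTD preimage_setC; exact: regularC.
    - by move=> C rC; rewrite preimage_bigcup; exact: regular_bigcup.
  by move=> O oO; apply: regular_open; apply: open_comp => // x _; exact: cp.
move: A; apply: smallest_sub => //.
by rewrite subUset; split; apply: cyl => x; [exact: cvg_fst|exact: cvg_snd].
Qed.

Lemma finite_measure_radon : finite_radon m.
Proof.
split => //; split.
- split => //; exact: measure_semi_sigma_additive.
- move=> K cK; apply: le_lt_trans m_fin; apply: le_measure; rewrite ?inE//.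
  by apply: measurable_closed; exact: compact_closed.
move=> A mA; have [_ rA] := finite_measure_regular mA.
have mcpt (K : set X) : compact K -> measurable K.
  by move=> cK; apply: measurable_closed; exact: compact_closed.
apply/eqP; rewrite eq_le; apply/andP; split; last first.
  apply: ge_ereal_sup => _ [K [cK KA] <-]; apply: le_measure; rewrite ?inE//; exact: mcpt.
apply/lee_addgt0Pr => e e0; have [F [U [cF oU FA AU UF]]] := rA _ e0.
have mF := measurable_closed cF; have mU := open_measurable_pair oU.
have AF : m A <= m F + e%:E.
  rewrite -leeBlDl ?mfin// -mDsub//.
  apply: (le_trans _ (ltW UF)); apply: le_measure; rewrite ?inE; try exact: measurableD.
  exact: setSD.
apply: (le_trans AF); rewrite leeD2r//.
(* Truncation by balls turns the closed inner approximation into a compact one. *)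
pose K k := F `&` [set x : X | (`|x| <= k%:R)%R].
have cball k : closed [set x : X | (`|x| <= k%:R)%R].
  have -> : [set x : X | (`|x| <= k%:R)%R] = Num.norm @^-1` [set r : R | (r <= k%:R)%R] by [].
  by apply: closed_comp => [x _|]; [exact: norm_continuous|exact: closed_le].
have cK k : compact (K k).
  have c1 : compact [set v : 'rV[R]_n | (`|v| <= k%:R)%R].
    apply: bounded_closed_compact.
      by exists k%:R; split; rewrite ?num_real// => x kx v /= vk; exact: le_trans vk (ltW kx).
    have -> : [set v : 'rV[R]_n | `|v| <= k%:R]%R = Num.norm @^-1` [set x : R | x <= k%:R]%R by [].
    by apply: closed_comp => [x _|]; [exact: norm_continuous|exact: closed_le].
  apply: (subclosed_compact _ (compact_setX c1 c1)); first exact: closedI.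
  by move=> x [_ /=]; rewrite prod_normE ge_max => /andP[].
have cv : m (K k) @[k --> \oo] --> m F.
  rewrite [in X in _ --> X](_ : F = \bigcup_k K k); last first.
    rewrite -setI_bigcupr (_ : \bigcup_i _ = setT) ?setIT//.
    by apply/seteqP; split => // x _; exists (Num.bound `|x|) => //=; exact/ltW/archi_boundP.
  apply: nondecreasing_cvg_mu => //.
  - by move=> k; exact: mcpt.
  - by apply: bigcupT_measurable => k; exact: mcpt.
  - move=> i j ij; apply/subsetPset => x [Fx /= xi]; split => //=.
    by apply: le_trans xi _; rewrite ler_nat.
rewrite -(cvg_lim _ cv)//; apply: lime_le; first by apply/cvg_ex; exists (m F).
apply: nearW => k; apply: ereal_sup_ubound; exists (K k) => //; split => //.
by move=> x [Fx _]; exact: FA.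
Qed.

End Regularity.

(** * Hausdorff measures on subspaces and orthogonal slicing *)

Section HausdorffOn.
Context {R : realType} (n : nat) (ip : {dot 'rV[R]_n for idfun}) (d : nat).
Hypothesis d_gt0 : (0 < d)%N.
Local Open Scope ereal_scope.
Local Notation V := 'rV[R]_n.
Local Notation H := (hausdorff (ipdist ip) d).
Local Notation Hon := (hausdorff_on (ipdist ip) d).

Lemma hausdorff_on_measure S :
  exists m : {measure set V -> \bar R}, (m : set V -> \bar R) = Hon S.
Proof.
have [mu muE] := hausdorff_outer (ipdist ip) d_gt0.
have [c [C [c0 _ lo _]]] := homogeneous_norm_equiv
  (@ipnorm_continuous _ _ ip) (ipnormZ ip) (ipnorm_gt0 ip).
(* Separation is measured in the sup norm, $\mathcal H^d$ in [ipdist]; the constant [c] translates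
   between them. *)
have metric A B (e : R) : (0 < e)%R -> (forall x y : V, A x -> B y -> (e <= `|x - y|)%R) ->
    mu A + mu B <= mu (A `|` B).
  move=> e0 AB; rewrite muE; apply: (hausdorff_separated d_gt0 (e := (c * e)%R)).
    by rewrite mulr_gt0.
  move=> x y Ax By; apply: le_trans (lo _).
  by rewrite ler_pM2l// AB.
have [|m mE] := @caratheodory_restrict_measure _ _ _ mu S.
  apply: smallest_sub.
    split; [exact: caratheodory_measurable_set0| |exact: caratheodory_measurable_bigcup].
    by move=> A mA; rewrite setTD; exact: caratheodory_measurable_setC.
  move=> O oO; rewrite -(setCK O); apply: caratheodory_measurable_setC.
  by apply: closed_caratheodory => //; exact: open_closedC.
by exists m; rewrite mE muE.
Qed.

Lemma hausdorff_translate (p : V) X : H ((fun v => v + p)%R @` X) = H X.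
Proof.
have iso (q : V) Y : H ((fun v => v + q)%R @` Y) <= H Y.
  rewrite -[leRHS]mul1e -(expr1n R d).
  by apply: hausdorff_image_le => // x y; rewrite mul1r /ipdist opprD addrACA subrr addr0.
apply/eqP; rewrite eq_le iso /=.
rewrite [X in H X <= _](_ : X = (fun v => v + - p)%R @` ((fun v => v + p)%R @` X)) ?iso//.
apply/seteqP; split => [v Xv|_ [_ [v Xv <-] <-]]; last by rewrite addrK.
by exists (v + p)%R; [exists v|rewrite addrK].
Qed.

Lemma hausdorff_scale (t : R) X : (0 < t)%R ->
  H ((fun v => t *: v)%R @` X) = (t ^+ d)%:E * H X.
Proof.
move=> t0; have dil (s : R) Y : (0 < s)%R ->
    H ((fun v => s *: v)%R @` Y) <= (s ^+ d)%:E * H Y.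
  move=> s0; apply: hausdorff_image_le => // x y.
  by rewrite /ipdist -scalerBr ipnormZ gtr0_norm.
apply/eqP; rewrite eq_le dil//= -lee_pdivlMl ?exprn_gt0//.
have -> : (t ^- d = t^-1 ^+ d)%R by rewrite exprVn.
rewrite [X in H X <= _](_ : X = (fun v => t^-1 *: v)%R @` ((fun v => t *: v)%R @` X)).
  by rewrite dil// invr_gt0.
apply/seteqP; split => [v Xv|_ [_ [v Xv <-] <-]]; last by rewrite scalerK// gt_eqF.
by exists (t *: v)%R; [exists v|rewrite scalerK// gt_eqF].
Qed.

Lemma hausdorff_on_translate S (p : V) A :
  Hon [set (v + p)%R | v in S] A = Hon S [set v | A (v + p)%R].
Proof.
rewrite /hausdorff_on -[RHS](hausdorff_translate p); congr H.
apply/seteqP; split => [x [Ax [v Sv vx]]|_ [v [Av Sv] <-]].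
  by exists v => //; split => //=; rewrite vx.
by split => //; exists v.
Qed.

Lemma hausdorff_on_scale S (t : R) A : (0 < t)%R ->
  (forall v, S (t *: v)%R <-> S v) ->
  Hon S A = (t ^+ d)%:E * Hon S [set v | A (t *: v)%R].
Proof.
move=> t0 St; rewrite /hausdorff_on -hausdorff_scale//; congr H.
apply/seteqP; split => [v [Av Sv]|_ [v [Av Sv] <-]]; last by split => //; exact/St.
exists (t^-1 *: v)%R; last by rewrite scalerKV// gt_eqF.
by split; rewrite /= ?scalerKV ?gt_eqF//; apply/St; rewrite scalerKV// gt_eqF.
Qed.

End HausdorffOn.

Lemma closed_vspace {R : realType} n (U : {vspace 'rV[R]_n}) : closed [set` U].
Proof.
have -> : [set` U] = (fun v => `|v - projv U v|) @^-1` [set r : R | r <= 0].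
  apply/seteqP; split => v /=; first by move=> vU; rewrite projv_id// subrr normr0.
  by rewrite normr_le0 subr_eq0 => /eqP ->; exact: memv_proj.
apply: closed_comp => [v _|]; last exact: closed_le.
apply: (@continuous_comp _ _ _ (fun v : 'rV[R]_n => v - projv U v) Num.norm); last exact: norm_continuous.
by apply: (@continuousB _ _ _ id (projv U)); [exact: cvg_id|exact: continuous_linear_rV].
Qed.

(** * Orthogonal complements and Hausdorff measure on subspaces *)

Section Subspace.
Context {R : realType} (n : nat) (ip : {dot 'rV[R]_n for idfun}).
Local Notation V := 'rV[R]_n.
Implicit Type U : {vspace V}.

Lemma capv_orthov U : (U :&: orthov ip U = 0)%VS.
Proof.
apply/eqP; rewrite -subv0; apply/subvP => v; rewrite memv_cap memv0 => /andP[vU].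
move=> /mem_orthovP/(_ v vU) vv0; apply: contraT => /(neq0_dnorm_gt0 (s := ip)).
by rewrite vv0 ltxx.
Qed.

(** The complement is the kernel of the map to the [\dim U] scalar products with a basis, so
    rank-nullity gives it at least the complementary dimension. *)
Lemma addv_orthov U : (U + orthov ip U = fullv)%VS.
Proof.
pose k := \dim U.
pose f (v : V) : 'rV[R]_k := \row_i ip v (vbasis U)`_i.
have f_lin : linear f.
  by move=> a u v; apply/rowP => i; rewrite !mxE linearPl.
pose fl : {linear V -> 'rV[R]_k} := HB.pack f (GRing.isLinear.Build _ _ _ _ f f_lin).
have kerE : lker (linfun fl) = orthov ip U.
  apply/vspaceP => v; rewrite memv_ker lfunE/=; apply/eqP/mem_orthovP => [fv0 u uU|vU].
    rewrite (coord_vbasis uU) linear_sum big1// => i _; rewrite linearZ/=.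
    by have := congr1 (fun w : 'rV[R]_k => w ord0 i) fv0; rewrite !mxE => ->; rewrite mulr0.
  by apply/rowP => i; rewrite !mxE vU// vbasis_mem// mem_nth// size_tuple.
have := limg_ker_dim (linfun fl) fullv; rewrite capfv kerE dimvf => dimE.
have img : (\dim (linfun fl @: fullv) <= k)%N.
  have := dimvS (subvf (linfun fl @: fullv)%VS); rewrite dimvf/= /dim/= mul1n; exact.
apply/eqP; rewrite eqEdim subvf/= dimv_disjoint_sum ?capv_orthov// dimvf.
by rewrite -dimE addnC leq_add2r.
Qed.

Lemma dim_orthov U : (\dim U + \dim (orthov ip U) = n)%N.
Proof.
by rewrite -dimv_disjoint_sum ?capv_orthov// addv_orthov dimvf /dim/= mul1n.
Qed.

End Subspace.

Section SubspaceMeasure.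
Context {R : realType} (n : nat) (ip : {dot 'rV[R]_n for idfun}) (d : nat).
Local Open Scope ereal_scope.
Local Notation V := 'rV[R]_n.
Local Notation Hon := (hausdorff_on (ipdist ip) d).
Hypothesis d_gt0 : (0 < d)%N.
Variables (U : {vspace V}).
Hypothesis dimU : \dim U = d.

Lemma hausdorff_subspace_norm_le r : (0 < r)%R ->
  0 < Hon [set` U] [set v | (`|v| <= r)%R] < +oo.
Proof.
move=> r0; rewrite /hausdorff_on -dimU.
by apply: hausdorff_subspace_ball => //; rewrite dimU.
Qed.

Lemma hausdorff_subspace_setC : Hon [set` U] (~` [set` U]) = 0.
Proof. by rewrite /hausdorff_on setICl hausdorff0. Qed.

Lemma hausdorff_subspaceD u A : u \in U -> Hon [set` U] [set v | A (v + u)%R] = Hon [set` U] A.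
Proof.
move=> uU; rewrite -hausdorff_on_translate//; congr (Hon _ A).
apply/seteqP; split => [_ [v vU <-]|v vU] /=; first by rewrite memvD.
by exists (v - u)%R; rewrite ?subrK//= memvB.
Qed.

Lemma hausdorff_subspaceZ (t : R) A : (0 < t)%R ->
  Hon [set` U] A = (t ^+ d)%:E * Hon [set` U] [set v | A (t *: v)%R].
Proof.
move=> t0; apply: hausdorff_on_scale => // v /=; split=> [tvU|]; last exact: memvZ.
by rewrite -[v](@scalerK _ _ t) ?gt_eqF// memvZ.
Qed.

Lemma hausdorff_subspace_measure :
  exists m : {sigma_finite_measure set V -> \bar R}, (m : set V -> \bar R) = Hon [set` U].
Proof.
have [m mE] := hausdorff_on_measure ip d_gt0 [set` U].
have [|m' m'E] := @sigma_finite_measure_of _ _ _ m.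
  apply: sigma_finite_norm_le => r r0; rewrite mE.
  have /hausdorff_subspace_norm_le/andP[_] : (0 < r + 1)%R by rewrite ltr_wpDl.
  apply: le_lt_trans; apply: le_hausdorff => // v [vr vU]; split => //=.
  by rewrite (le_trans vr)// lerDl.
by exists m'; rewrite m'E.
Qed.

End SubspaceMeasure.

Section OrthogonalSum.
Context {R : realType} (n : nat) (ip : {dot 'rV[R]_n for idfun}) (d : nat).
Local Open Scope ereal_scope.
Local Notation V := 'rV[R]_n.
Local Notation Hon := (hausdorff_on (ipdist ip) d).
Hypothesis d_gt0 : (0 < d)%N.
Variables (U : {vspace V}).
Hypotheses (dimU : \dim U = d) (dimU' : \dim (orthov ip U) = d).
Variables (a b : {sigma_finite_measure set V -> \bar R}).
Hypothesis aE : (a : set V -> \bar R) = Hon [set` U].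
Hypothesis bE : (b : set V -> \bar R) = Hon [set` orthov ip U].
Local Notation ball r := [set v : V | (`|v| <= r)%R].

Let madd : measurable_fun setT (fun p : V * V => p.1 + p.2)%R.
Proof. exact: measurable_add_rV. Qed.

(** The image of the product under addition: the translation-invariant candidate to compare with
    Lebesgue measure. *)
Let ab (A : set V) : \bar R := (a \x b) [set p : V * V | A (p.1 + p.2)%R].

Let abE A : ab A = \int[a]_x b [set y | A (x + y)%R].
Proof.
rewrite /ab /product_measure1; apply: eq_integral => x _; congr (b _).
by apply/seteqP; split => y /=; rewrite xsectionP.
Qed.

(** By Pythagoras each orthogonal summand is no longer than the sum; [C / c] accounts for the change
    of norm. *)
Let sum_ball : exists2 s : R, (0 < s)%R & forall r x y, (0 < r)%R -> x \in U -> y \in orthov ip U ->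
  (`|x + y| <= r)%R -> (`|x| <= s * r)%R /\ (`|y| <= s * r)%R.
Proof.
have [c [C [c0 C0 lo up]]] := homogeneous_norm_equiv
  (@ipnorm_continuous _ _ ip) (ipnormZ ip) (ipnorm_gt0 ip).
exists (C / c)%R; first by rewrite divr_gt0.
move=> r x y r0 xU /mem_orthovP/(_ x xU) yx xyr.
have xNy : ip x (- y)%R = 0%R by rewrite linearN/= ipC yx oppr0.
have := ipnorm_pythagoras xNy; rewrite opprK ipnormN => pyth.
have xyC : (ipnorm ip (x + y) <= C * r)%R by apply: le_trans (up _) _; rewrite ler_pM2l.
have key z : (ipnorm ip z ^+ 2 <= ipnorm ip (x + y) ^+ 2)%R -> (`|z| <= C / c * r)%R.
  move=> zxy; rewrite mulrAC ler_pdivlMr// mulrC; apply: (le_trans (lo z)).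
  apply: le_trans xyC; rewrite -(@ler_pXn2r _ 2)// nnegrE; exact: ipnorm_ge0.
by split; apply: key; rewrite pyth ?lerDl ?lerDr sqr_ge0.
Qed.

Let ab_ball_lty r : (0 < r)%R -> ab (ball r) < +oo.
Proof.
move=> r0; have [s s0 sP] := sum_ball; rewrite /ab.
have sr0 : (0 < s * r)%R by rewrite mulr_gt0.
have mU := closed_measurable_rV (@closed_vspace R n U).
have mU' := closed_measurable_rV (@closed_vspace R n (orthov ip U)).
have mball q : measurable (ball q) by exact: measurable_norm_le.
pose B1 := ball (s * r)%R `*` ball (s * r)%R.
(* [a] and [b] live on all of [V] but are concentrated on the two subspaces, so [B2] and [B3] are
   null and [sum_ball] handles the rest. *)
pose B2 := ~` [set` U] `*` [set: V].
pose B3 := [set: V] `*` ~` [set` orthov ip U].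
have mB1 : measurable B1 by exact: measurableX.
have mB2 : measurable B2 by apply: measurableX => //; exact: measurableC.
have mB3 : measurable B3 by apply: measurableX => //; exact: measurableC.
have B1E : (a \x b) B1 = a (ball (s * r)%R) * b (ball (s * r)%R) by rewrite product_measure1E.
have a0 : a (~` [set` U]) = 0 by rewrite aE hausdorff_subspace_setC.
have b0 : b (~` [set` orthov ip U]) = 0 by rewrite bE hausdorff_subspace_setC.
have B2E : (a \x b) B2 = 0.
  transitivity (a (~` [set` U]) * b setT); last by rewrite a0 mul0e.
  by rewrite product_measure1E//; exact: measurableC.
have B3E : (a \x b) B3 = 0.
  transitivity (a setT * b (~` [set` orthov ip U])); last by rewrite b0 mule0.
  by rewrite product_measure1E//; exact: measurableC.
have sub : [set p : V * V | ball r (p.1 + p.2)%R] `<=` B1 `|` (B2 `|` B3).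
  move=> [x y] /= xyr; have [xU|/negP xU] := boolP (x \in U); last by right; left.
  have [yU|/negP yU] := boolP (y \in orthov ip U); last by right; right.
  by left; have [] := sP r x y r0 xU yU xyr.
have mS : measurable [set p : V * V | ball r (p.1 + p.2)%R].
  rewrite -[X in measurable X]setTI; exact: (madd measurableT (mball r)).
apply: (@le_lt_trans _ _ ((a \x b) (B1 `|` (B2 `|` B3)))).
  by apply: le_measure; rewrite ?inE//; do 2 apply: measurableU => //.
apply: (le_lt_trans (measureU2 _ mB1 (measurableU _ _ mB2 mB3))).
apply: (@le_lt_trans _ _ ((a \x b) B1 + 0)).
  apply: leeD => //; apply: le_trans (measureU2 _ mB2 mB3) _.
  by rewrite -[leRHS](adde0 0) -{1}B2E -B3E.
rewrite adde0 B1E; apply: lte_mul_pinfty => //.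
  have := hausdorff_subspace_norm_le ip d_gt0 dimU sr0; rewrite -aE => /andP[_ aoo].
  by rewrite ge0_fin_numE.
by have := hausdorff_subspace_norm_le ip d_gt0 dimU' sr0; rewrite -bE => /andP[].
Qed.

Let ab_ball_gt0 : 0 < ab (ball 2).
Proof.
have mball q : measurable (ball q) by exact: measurable_norm_le.
apply: (@lt_le_trans _ _ ((a \x b) (ball 1 `*` ball 1))).
  rewrite product_measure1E// mule_gt0//.
    by have := hausdorff_subspace_norm_le ip d_gt0 dimU ltr01; rewrite -aE => /andP[].
  by have := hausdorff_subspace_norm_le ip d_gt0 dimU' ltr01; rewrite -bE => /andP[].
apply: le_measure; rewrite ?inE.
- exact: measurableX.
- rewrite -[X in measurable X]setTI; exact: (madd measurableT (mball 2%R)).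
- by move=> [x y] [/= x1 y1]; apply: le_trans (ler_normD _ _) _; rewrite (_ : 2 = 1 + 1)%R// lerD.
Qed.

Let mshift c (A : set V) : measurable A -> measurable [set v | A (v + c)%R].
Proof.
move=> mA; rewrite -[X in measurable X]setTI.
have : measurable_fun setT (fun v : V => v + c)%R.
  by apply: measurable_add_rV => //; exact: measurable_id.
exact.
Qed.

(** Split [c] along the orthogonal sum; [a] absorbs one component and [b] the other. *)
Let abD (c : V) (A : set V) : measurable A -> ab [set v | A (v + c)%R] = ab A.
Proof.
move=> mA; have : c \in (U + orthov ip U)%VS by rewrite addv_orthov memvf.
move=> /memv_addP[c1 c1U [c2 c2U ->]]; rewrite !abE.
pose g x := b [set y | A (x + y)%R].
have mg : measurable_fun setT g.
  rewrite [g](_ : _ = b \o xsection [set p : V * V | A (p.1 + p.2)%R]).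
    apply: measurable_fun_xsection; rewrite -[X in measurable X]setTI.
    exact: (madd measurableT mA).
  apply/funext => x /=; congr (b _).
  by apply/seteqP; split => y /=; rewrite xsectionP.
have ac1 (B : set V) : a [set v | B (v + c1)%R] = a B by rewrite aE hausdorff_subspaceD.
rewrite -[RHS](@ge0_integral_shift _ _ a c1 _ g)//; last by move=> B _; exact: ac1.
apply: eq_integral => x _; rewrite /g.
transitivity (b [set y | [set z | A (x + c1 + z)%R] (y + c2)%R]).
  by congr (b _); apply/funext => y /=; rewrite addrACA.
by rewrite bE hausdorff_subspaceD.
Qed.

(* Both sides are translation invariant, hence proportional. The constant is not
   computed: it cancels against the one in [gauss_mass]. *)
Lemma lebesgue_orthogonal_sum : exists2 kappa : R, (0 < kappa)%R &
  forall f : V -> \bar R, measurable_fun setT f -> (forall x, 0 <= f x) ->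
  \int[lebesgue_rV n]_x f x = kappa%:E * \int[a]_x \int[b]_y f (x + y)%R.
Proof.
have [nu0 nu0E] := pushforward_measure (a \x b) madd.
have {}nu0E A : nu0 A = ab A by rewrite nu0E.
have [|nu nuE] := @sigma_finite_measure_of _ _ _ nu0.
  apply: sigma_finite_norm_le => r r0; rewrite nu0E.
  have /ab_ball_lty : (0 < r + 1)%R by rewrite ltr_wpDl.
  apply: le_lt_trans; rewrite -!nu0E; apply: le_measure; rewrite ?inE; try exact: measurable_norm_le.
  by move=> v /= vr; rewrite (le_trans vr)// lerDl.
have {}nuE A : nu A = ab A by rewrite nuE nu0E.
have mball q : measurable (ball q) by exact: measurable_norm_le.
have fin2 : nu (ball 2) \is a fin_num by rewrite ge0_fin_numE// nuE ab_ball_lty.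
have fine0 : (0 < fine (nu (ball 2)))%R by rewrite -lte_fin fineK// nuE ab_ball_gt0.
(* The ratio of the masses of the cube [ball 2], which is symmetric, so the reflection in the
   uniqueness lemma disappears. *)
pose kappa := ((2 * 2) ^+ n / fine (nu (ball 2)))%R.
have k0 : (0 < kappa)%R by rewrite divr_gt0// exprn_gt0.
have LE A : measurable A -> lebesgue_rV n A = kappa%:E * nu A.
  move=> mA; have := @translation_invariant_proportional R n nu (lebesgue_rV n) (ball 2)
    (fun c A mA => etrans (nuE _) (etrans (abD c mA) (esym (nuE _)))) (@lebesgue_rVD R n) (mball 2%R) A mA.
  rewrite [X in lebesgue_rV n X * _](_ : _ = ball 2); last first.
    by apply/seteqP; split => v /=; rewrite normrN.
  rewrite lebesgue_rV_ball// => h; rewrite /kappa mulrC EFinM -muleA -h.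
  by rewrite muleA -[X in _ * X * _](fineK fin2) -EFinM mulVf ?mul1e// gt_eqF.
exists kappa => // f mf f0.
have k0' : (0 <= kappa)%R by exact: ltW.
rewrite (eq_measure_integral (mscale (NngNum k0') nu)); last by move=> A mA _; exact: LE.
rewrite ge0_integral_mscale//=; congr (_ * _).
rewrite (eq_measure_integral nu0); last by move=> A mA _; exact: etrans (nuE A) (esym (nu0E A)).
transitivity (\int[pushforward (a \x b) (fun p : V * V => p.1 + p.2)%R]_x f x).
  congr (integral _ _ _); apply/funext => A; exact: nu0E.
rewrite ge0_integral_pushforward//= preimage_setT fubini_tonelli1//.
  exact: (measurableT_comp mf madd).
Qed.

End OrthogonalSum.

Lemma measurable_integral_snd d d' (T : measurableType d) (T' : measurableType d')
    (R : realType) (m : {sigma_finite_measure set T' -> \bar R}) (H : T * T' -> \bar R) :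
  measurable_fun setT H -> (forall w, 0 <= H w)%E ->
  measurable_fun setT (fun x => \int[m]_y H (x, y))%E.
Proof. by move=> mH H0; exact: measurable_fun_fubini_tonelli_F. Qed.

Section TripleProduct.
Context d1 d2 d3 (T1 : measurableType d1) (T2 : measurableType d2) (T3 : measurableType d3).
Context (R : realType) (m1 : {sigma_finite_measure set T1 -> \bar R})
  (m2 : {sigma_finite_measure set T2 -> \bar R}) (m3 : {sigma_finite_measure set T3 -> \bar R}).
Local Open Scope ereal_scope.

Lemma sigma_finite_product : sigma_finite setT (m1 \x m2).
Proof.
have /sigma_finiteP[F [TF ndF Foo]] := sigma_finiteT m1.
have /sigma_finiteP[G [TG ndG Goo]] := sigma_finiteT m2.
exists (fun n => F n `*` G n) => [|k].
  apply/seteqP; split => // -[x y] _.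
  have [i _ Fx] : (\bigcup_i F i) x by rewrite -TF.
  have [j _ Gy] : (\bigcup_i G i) y by rewrite -TG.
  exists (maxn i j) => //; split => /=.
    by move: Fx; exact/subsetPset/ndF/leq_maxl.
  by move: Gy; exact/subsetPset/ndG/leq_maxr.
have [mF Fk] := Foo k; have [mG Gk] := Goo k.
split; first exact: measurableX.
by rewrite product_measure1E// lte_mul_pinfty// ge0_fin_numE.
Qed.

(** Tonelli twice; the first product has to be bundled as a sigma-finite measure before it can be a
    factor. *)
Lemma triple_product_measure : exists2 m : {measure set (T1 * T2 * T3) -> \bar R},
  (m : set _ -> \bar R) = ((m1 \x m2) \x m3) &
  forall f : T1 * T2 * T3 -> \bar R, measurable_fun setT f -> (forall w, 0 <= f w) ->
  \int[m]_w f w = \int[m1]_x \int[m2]_y \int[m3]_z f (x, y, z).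
Proof.
have [m12 m12E] := sigma_finite_measure_of sigma_finite_product.
exists (m12 \x m3) => [|f mf f0]; first exact: (congr1 (fun f => f \x m3) m12E).
pose F w := \int[m3]_z f (w, z).
have mF : measurable_fun setT F by exact: measurable_fun_fubini_tonelli_F.
have F0 w : 0 <= F w by exact: integral_ge0.
rewrite (fubini_tonelli1 (m1 := m12) f mf f0).
transitivity (\int[(m1 \x m2)]_w F w); first by rewrite -m12E.
by rewrite (fubini_tonelli1 (m1 := m1) F mF F0).
Qed.

End TripleProduct.

(** * Slicing Lebesgue measure times Hausdorff measure on an affine subspace *)

Section AffineSlices.
Context {R : realType} (n : nat) (ip : {dot 'rV[R]_n for idfun}) (d : nat).
Local Open Scope ereal_scope.
Local Notation V := 'rV[R]_n.
Local Notation Hon := (hausdorff_on (ipdist ip) d).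
Hypothesis d_gt0 : (0 < d)%N.
Variables (U : {vspace V}) (p : V).
Variables (a b e : {sigma_finite_measure set V -> \bar R}).
Hypothesis aE : (a : set V -> \bar R) = Hon [set` U].
Hypothesis bE : (b : set V -> \bar R) = Hon [set` orthov ip U].
Hypothesis eE : (e : set V -> \bar R) = Hon [set (p + v)%R | v in [set` U]].
Variable kappa : R.
Hypothesis slices : forall f : V -> \bar R, measurable_fun setT f -> (forall x, 0 <= f x) ->
  \int[lebesgue_rV n]_x f x = kappa%:E * \int[a]_x \int[b]_y f (x + y)%R.

Lemma affine_shift A : e A = a [set v | A (v + p)%R].
Proof.
rewrite eE aE -hausdorff_on_translate; congr (Hon _ A).
by apply/eq_imagel => v _; rewrite addrC.
Qed.

Lemma ge0_integral_affine (f : V -> \bar R) : measurable_fun setT f -> (forall x, 0 <= f x) ->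
  \int[e]_x f x = \int[a]_x f (x + p)%R.
Proof.
move=> mf f0; have mp : measurable_fun setT (fun x : V => x + p)%R.
  by apply: measurable_add_rV => //; exact: measurable_id.
rewrite -[RHS](@ge0_integral_pushforward _ _ _ _ _ _ mp a setT f)//.
by apply: eq_measure_integral => A mA _; exact: affine_shift.
Qed.

(** Any point [x + p] of the affine subspace can serve as origin. Taking the foot point of [y] makes
    [z] relative to the same [xi]. *)
Lemma ge0_integral_affine_base (f : V -> \bar R) (x : V) : x \in U ->
  measurable_fun setT f -> (forall x, 0 <= f x) ->
  \int[e]_z f z = \int[a]_z f (x + p + z)%R.
Proof.
move=> xU mf f0; rewrite ge0_integral_affine//.
have ax A : a [set v | A (v + x)%R] = a A by rewrite aE hausdorff_subspaceD.
have mp : measurable_fun setT (fun z : V => z + p)%R.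
  by apply: measurable_add_rV => //; exact: measurable_id.
rewrite -(@ge0_integral_shift _ _ a x _ (fun z => f (z + p)%R))//.
- by apply: eq_integral => z _; rewrite [(z + x)%R]addrC addrAC.
- by move=> A mA; exact: ax.
- exact: measurableT_comp mf mp.
Qed.

Lemma subspace_ae : \forall x \ae a, x \in U.
Proof.
exists (~` [set` U]); split => //.
  by apply: measurableC; apply: closed_measurable_rV; exact: closed_vspace.
by have := hausdorff_subspace_setC ip d_gt0 U; rewrite -aE.
Qed.

Lemma orthov_ae : \forall x \ae b, x \in orthov ip U.
Proof.
exists (~` [set` orthov ip U]); split => //.
  by apply: measurableC; apply: closed_measurable_rV; exact: closed_vspace.
by have := hausdorff_subspace_setC ip d_gt0 (orthov ip U); rewrite -bE.
Qed.

Let mcomb (t : R) dT (T : measurableType dT) (f g : T -> V) :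
  measurable_fun setT f -> measurable_fun setT g -> measurable_fun setT (fun x => f x + t *: g x)%R.
Proof. by move=> mf mg; apply: measurable_add_rV => //; exact: measurable_scale_rV. Qed.

(** Shift the Lebesgue variable by [p] and split it as [x + y] along the two subspaces; with [x + p]
    as base point for the second variable, the integral over [x] in [U] becomes one over the affine
    subspace. *)
Lemma lebesgue_affine_slices (Phi : V * V -> \bar R) :
  measurable_fun setT Phi -> (forall q, 0 <= Phi q) ->
  \int[(lebesgue_rV n \x e)]_q Phi q =
  kappa%:E * \int[e]_x \int[b]_y \int[a]_z Phi (x + y, x + z)%R.
Proof.
move=> mPhi Phi0; rewrite fubini_tonelli1//.
pose F y := \int[e]_z Phi (y, z).
have mF : measurable_fun setT F by exact: measurable_fun_fubini_tonelli_F.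
have F0 y : 0 <= F y by exact: integral_ge0.
have mp : measurable_fun setT (fun y : V => y + p)%R.
  by apply: measurable_add_rV => //; exact: measurable_id.
transitivity (\int[lebesgue_rV n]_y F (y + p)%R).
  by rewrite ge0_integral_shift// => A mA; exact: lebesgue_rVD.
rewrite slices//; last exact: measurableT_comp mF mp.
congr (_ * _).
pose H (w : V * V * V) := Phi (w.1.1 + w.1.2, w.1.1 + w.2)%R.
have mH : measurable_fun setT H.
  apply: measurableT_comp => //; apply: measurable_fun_pair; apply: measurable_add_rV => //.
  - exact: measurableT_comp measurable_fst measurable_fst.
  - exact: measurableT_comp measurable_snd measurable_fst.
  - exact: measurableT_comp measurable_fst measurable_fst.
have H0 w : 0 <= H w by exact: Phi0.
have aH0 w : 0 <= \int[a]_z H (w, z) by exact: integral_ge0.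
have mH2 := measurable_integral_snd b (measurable_integral_snd a mH H0) aH0.
rewrite (ge0_integral_affine mH2); last first.
  by move=> x; apply: integral_ge0 => y _; exact: integral_ge0.
apply: ae_eq_integral_nonmeasurable; apply: filterS subspace_ae => x xU.
apply: eq_integral => y _; rewrite /F (ge0_integral_affine_base xU)//; last first.
  by apply: measurableT_comp mPhi _; exact: measurable_fun_pair.
by apply: eq_integral => z _; rewrite addrAC.
Qed.

Lemma ge0_integral_scale (m : {sigma_finite_measure set V -> \bar R}) (W : {vspace V}) (t : R)
    (f : V -> \bar R) : (m : set V -> \bar R) = Hon [set` W] -> (0 < t)%R ->
  measurable_fun setT f -> (forall x, 0 <= f x) ->
  \int[m]_x f x = (t ^+ d)%:E * \int[m]_x f (t *: x)%R.
Proof.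
move=> mE t0 mf f0; have mt : measurable_fun setT (fun x : V => t *: x)%R.
  by apply: measurable_scale_rV; exact: measurable_id.
rewrite -[X in _ * X](@ge0_integral_pushforward _ _ _ _ _ _ mt m setT f)//.
have td0 : (0 <= t ^+ d)%R by rewrite exprn_ge0 ?(ltW t0).
have [m' m'E] := pushforward_measure m mt.
rewrite (_ : integral (pushforward _ _) _ _ = \int[m']_x f x); last by rewrite m'E.
rewrite [LHS](eq_measure_integral (mscale (NngNum td0) m')).
  by rewrite ge0_integral_mscale.
move=> A mA _; transitivity ((t ^+ d)%:E * m [set v : V | A (t *: v)%R] : \bar R).
  have mB (B : set V) : m B = Hon [set` W] B := congr1 (fun f => f B) mE.
  exact: etrans (mB A) (etrans (hausdorff_subspaceZ ip d W A t0) (congr1 _ (esym (mB _)))).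
by congr (_ * _); exact: (esym (congr1 (fun f => f A) m'E)).
Qed.

(** One factor [t ^+ d] comes from each of [eta] and [zeta]; the foot point [xi] is not rescaled. *)
Lemma lebesgue_scaled_slices (t : R) (Phi : V * V -> \bar R) : (0 < t)%R ->
  measurable_fun setT Phi -> (forall q, 0 <= Phi q) ->
  \int[(lebesgue_rV n \x e)]_q Phi q = (kappa * t ^+ d * t ^+ d)%:E *
    \int[e]_x \int[b]_y \int[a]_z Phi (x + t *: y, x + t *: z)%R.
Proof.
move=> t0 mPhi Phi0.
rewrite (lebesgue_affine_slices mPhi Phi0).
rewrite (EFinM (kappa * t ^+ d)) (EFinM kappa) -(muleA (kappa%:E * _)) -(muleA kappa%:E).
congr (_ * _).
have td0 : (0 <= t ^+ d)%R by rewrite exprn_ge0 ?(ltW t0).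
pose H (w : V * V * V) := Phi (w.1.1 + t *: w.1.2, w.1.1 + t *: w.2)%R.
have mH : measurable_fun setT H.
  apply: measurableT_comp => //; apply: measurable_fun_pair; apply: mcomb => //.
  - exact: measurableT_comp measurable_fst measurable_fst.
  - exact: measurableT_comp measurable_snd measurable_fst.
  - exact: measurableT_comp measurable_fst measurable_fst.
have H0 w : 0 <= H w by exact: Phi0.
have aH0 w : 0 <= \int[a]_z H (w, z) by exact: integral_ge0.
have mH1 := measurable_integral_snd a mH H0.
have mH2 := measurable_integral_snd b mH1 aH0.
have inner x : \int[b]_y \int[a]_z Phi (x + y, x + z)%R =
    (t ^+ d)%:E * ((t ^+ d)%:E * \int[b]_y \int[a]_z H (x, y, z)).
  pose Hx (q : V * V) := Phi (x + q.1, x + q.2)%R.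
  have mHx : measurable_fun setT Hx.
    by apply: measurableT_comp => //; apply: measurable_fun_pair; apply: measurable_add_rV.
  rewrite (ge0_integral_scale bE t0 (measurable_integral_snd a mHx (fun q => Phi0 _))); last first.
    by move=> y; apply: integral_ge0 => z _; exact: Phi0.
  congr (_ * _); rewrite -ge0_integralZl//; last first.
    exact: (measurableT_comp mH1 (measurable_pair1 x)).
  apply: eq_integral => y _.
  by rewrite (ge0_integral_scale aE t0 (measurableT_comp mHx (measurable_pair1 (t *: y)%R))) => [|z]; last exact: Phi0.
rewrite (eq_integral _ _ (fun x _ => inner x)).
have bH0 x : 0 <= \int[b]_y \int[a]_z H (x, y, z) by exact: integral_ge0.
have td0' : 0 <= (t ^+ d)%:E by rewrite lee_fin.
rewrite (ge0_integralZl e measurableT (measurable_funeM _ mH2) (fun x _ => mule_ge0 td0' (bH0 x)) td0').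
by rewrite (ge0_integralZl e measurableT mH2 (fun x _ => bH0 x) td0').
Qed.

End AffineSlices.

Section PositiveIntegral.
Context d (T : measurableType d) (R : realType) (mu : {measure set T -> \bar R}).
Local Open Scope ereal_scope.

Lemma integral_gt0 (f : T -> R) : measurable_fun setT f -> (forall x, (0 < f x)%R) ->
  mu setT != 0 -> 0 < \int[mu]_x (f x)%:E.
Proof.
move=> mf f0 muT; rewrite lt0e integral_ge0 ?andbT; last first.
  by move=> x _; rewrite lee_fin ltW.
apply: contraNN muT => /eqP f_int0.
have : \int[mu]_x `|(f x)%:E| = 0.
  by rewrite -f_int0; apply: eq_integral => x _; rewrite gee0_abs// lee_fin ltW.
move/(ae_eq_integral_abs mu measurableT ((measurable_EFinP _ _).2 mf)).1.
case=> N [mN N0 Nf]; rewrite -measure_le0 -N0 le_measure ?inE// => x _.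
by apply: Nf => /= /(_ I)[] fx0; have := f0 x; rewrite fx0 ltxx.
Qed.

End PositiveIntegral.

(** * Gaussian masses on the slices *)

Section GaussianSlices.
Context {R : realType} (n : nat) (ip : {dot 'rV[R]_n for idfun}) (d : nat).
Local Open Scope ereal_scope.
Local Notation V := 'rV[R]_n.
Local Notation Hon := (hausdorff_on (ipdist ip) d).
Hypothesis d_gt0 : (0 < d)%N.
Variables (U : {vspace V}).
Hypotheses (dimU : \dim U = d) (dimU' : \dim (orthov ip U) = d).
Variables (a b : {sigma_finite_measure set V -> \bar R}).
Hypothesis aE : (a : set V -> \bar R) = Hon [set` U].
Hypothesis bE : (b : set V -> \bar R) = Hon [set` orthov ip U].
Variable kappa : R.
Hypothesis kappa_gt0 : (0 < kappa)%R.
Hypothesis slices : forall f : V -> \bar R, measurable_fun setT f -> (forall x, 0 <= f x) ->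
  \int[lebesgue_rV n]_x f x = kappa%:E * \int[a]_x \int[b]_y f (x + y)%R.

Local Notation gauss beta x := (expR (- beta * ipnorm ip x ^+ 2)).

Lemma measurable_ipnorm : measurable_fun setT (ipnorm ip).
Proof. by apply: continuous_measurable_rV; exact: ipnorm_continuous. Qed.

Lemma measurable_gauss beta : measurable_fun setT (fun x => gauss beta x).
Proof.
apply: measurableT_comp => //; apply: measurable_funM => //.
by apply: measurable_funX; exact: measurable_ipnorm.
Qed.

Lemma integral_ipnorm_gauss_lty beta : (0 < beta)%R ->
  \int[lebesgue_rV n]_x (gauss beta x)%:E < +oo.
Proof.
move=> beta0; have [c [C [c0 _ lo _]]] := homogeneous_norm_equiv
  (@ipnorm_continuous _ _ ip) (ipnormZ ip) (ipnorm_gt0 ip).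
(* From [\sum_i x_i^2 <= n.+1 * |x|^2] and [c * |x| <= ipnorm ip x]; the successor keeps the
   denominator nonzero for [n = 0]. *)
have q0 : (0 < beta * c ^+ 2 / n.+1%:R)%R by rewrite divr_gt0// mulr_gt0// exprn_gt0.
apply: le_lt_trans (@integral_gauss_lty R n _ q0).
apply: ge0_le_integral => //.
- by apply/measurable_EFinP; exact: measurable_gauss.
- apply/measurable_EFinP; apply: measurableT_comp => //; apply: measurable_funM => //.
  by apply: measurable_sum => i; apply: measurable_funX; exact: measurable_coord.
- move=> x _; rewrite lee_fin ler_expR !mulNr lerN2.
  have : (\sum_i x ord0 i ^+ 2 <= n.+1%:R * `|x| ^+ 2)%R.
    apply: (@le_trans _ _ (\sum_(i < n) `|x| ^+ 2)%R).
      apply: ler_sum => i _; rewrite -real_normK ?num_real// lerXn2r ?nnegrE//.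
      by have /norm_rV_le-> := lexx `|x|%R.
    by rewrite sumr_const card_ord -[leLHS]mulr_natl ler_wpM2r ?sqr_ge0// ler_nat.
  move=> le1; rewrite -(mulrA (beta * _)%R) -(mulrA beta) ler_pM2l//.
  apply: (@le_trans _ _ (c ^+ 2 * `|x| ^+ 2)%R).
    by rewrite ler_pM2l ?exprn_gt0// ler_pdivrMl.
  by rewrite -exprMn lerXn2r ?nnegrE ?mulr_ge0 ?ipnorm_ge0 ?(ltW c0).
Qed.

Lemma integral_gauss_slices beta t : (0 < t)%R ->
  \int[lebesgue_rV n]_x (gauss (beta / t ^+ 2) x)%:E = (kappa * t ^+ d * t ^+ d)%:E *
    (\int[a]_x (gauss beta x)%:E * \int[b]_x (gauss beta x)%:E).
Proof.
move=> t0; set beta' := (beta / t ^+ 2)%R.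
have mg := measurable_gauss.
have g0 (q : R) (x : V) : 0 <= (gauss q x)%:E by rewrite lee_fin expR_ge0.
have scale (m : {sigma_finite_measure set V -> \bar R}) (W : {vspace V}) : (m : set V -> \bar R) = Hon [set` W] ->
    \int[m]_x (gauss beta' x)%:E = (t ^+ d)%:E * \int[m]_x (gauss beta x)%:E.
  move=> mE; rewrite (ge0_integral_scale mE t0 ((measurable_EFinP _ _).2 (mg beta')) (fun x => g0 _ _)).
  congr (_ * _); apply: eq_integral => x _; congr ((expR _)%:E).
  rewrite ipnormZ gtr0_norm// exprMn /beta' mulrA -mulNr.
  by rewrite divfK// gt_eqF// exprn_gt0.
rewrite (slices ((measurable_EFinP _ _).2 (mg beta')) (fun x => g0 _ _)).
transitivity (kappa%:E * \int[a]_x ((gauss beta' x)%:E * \int[b]_y (gauss beta' y)%:E)).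
  congr (_ * _); apply: ae_eq_integral_nonmeasurable.
  apply: filterS (subspace_ae d_gt0 aE) => x xU.
  rewrite -ge0_integralZl//; last exact/measurable_EFinP.
  apply: ae_eq_integral_nonmeasurable.
  apply: filterS (orthov_ae d_gt0 bE) => y /mem_orthovP/(_ x xU) yx.
  rewrite -EFinM -expRD -mulrDr; congr ((expR (_ * _))%:E).
  have : ip x (- y)%R = 0%R by rewrite linearN/= ipC yx oppr0.
  by move/ipnorm_pythagoras; rewrite opprK ipnormN.
have b0 : 0 <= \int[b]_y (gauss beta' y)%:E by apply: integral_ge0 => y _.
rewrite (ge0_integralZr a measurableT ((measurable_EFinP _ _).2 (mg beta')) (fun x _ => g0 _ _) b0).
rewrite (scale a _ aE) (scale b _ bE) (EFinM (kappa * t ^+ d)) (EFinM kappa).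
rewrite -(muleA kappa%:E (t ^+ d)%:E) -(muleA kappa%:E); congr (_ * _).
by rewrite -muleA -muleA; congr (_ * _); rewrite muleCA.
Qed.

(** Both masses are positive and their product is finite, as slicing at [t = 1] shows, so neither
    can be infinite. *)
Lemma slice_gauss_masses beta : (0 < beta)%R -> exists ga gb : R,
  [/\ (0 < ga)%R, (0 < gb)%R, \int[a]_x (gauss beta x)%:E = ga%:E &
      \int[b]_x (gauss beta x)%:E = gb%:E].
Proof.
move=> beta0; set Ga := integral a _ _; set Gb := integral b _ _.
have muT (m : {sigma_finite_measure set V -> \bar R}) (W : {vspace V}) : (m : set V -> \bar R) = Hon [set` W] ->
    \dim W = d -> m setT != 0.
  move=> mE dimW; apply: contraTneq isT => mT.
  have mB (B : set V) : m B = Hon [set` W] B := congr1 (fun f => f B) mE.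
  have := hausdorff_subspace_norm_le ip d_gt0 dimW ltr01; rewrite -mB => /andP[+ _].
  by rewrite ltNge -mT le_measure// ?inE//; exact: measurable_norm_le.
have Ga0 : 0 < Ga.
  by apply: integral_gt0 => [|x|]; [exact: measurable_gauss|exact: expR_gt0|exact: muT aE dimU].
have Gb0 : 0 < Gb.
  by apply: integral_gt0 => [|x|]; [exact: measurable_gauss|exact: expR_gt0|exact: muT bE dimU'].
have := integral_ipnorm_gauss_lty beta0; have := integral_gauss_slices beta (@ltr01 R).
rewrite expr1n divr1 !expr1n !mulr1 => -> fin.
have Gafin : Ga \is a fin_num.
  rewrite ge0_fin_numE ?(ltW Ga0)// ltNge leye_eq; apply: contraTN fin => /eqP; rewrite -/Ga => ->.
  by rewrite -/Gb gt0_mulye// mulry gtr0_sg// mul1e ltxx.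
have Gbfin : Gb \is a fin_num.
  rewrite ge0_fin_numE ?(ltW Gb0)// ltNge leye_eq; apply: contraTN fin => /eqP; rewrite -/Gb => ->.
  by rewrite -/Ga gt0_muley// mulry gtr0_sg// mul1e ltxx.
exists (fine Ga), (fine Gb); rewrite !fineK//; split => //.
  by rewrite -lte_fin fineK.
by rewrite -lte_fin fineK.
Qed.

Lemma gauss_mass_slices beta t ga gb : (0 < t)%R ->
  \int[a]_x (gauss beta x)%:E = ga%:E -> \int[b]_x (gauss beta x)%:E = gb%:E ->
  gauss_mass ip (beta / t ^+ 2) = (kappa * t ^+ d * t ^+ d * (ga * gb))%R.
Proof.
by move=> t0 gaE gbE; rewrite /gauss_mass integral_gauss_slices// gaE gbE -!EFinM.
Qed.

End GaussianSlices.

(** * Limit of the thermalized measures *)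

Section ThermalizedSlices.
Context {R : realType} (n : nat) (ip : {dot 'rV[R]_n for idfun}) (d : nat).
Local Open Scope ereal_scope.
Local Notation V := 'rV[R]_n.
Variables (U : {vspace V}) (a b e : {sigma_finite_measure set V -> \bar R}).
Hypotheses (aU : \forall x \ae a, x \in U) (bU : \forall y \ae b, y \in orthov ip U).
Variables (kappa beta0 ga gb : R).
Hypotheses (kappa_gt0 : (0 < kappa)%R) (ga_gt0 : (0 < ga)%R) (gb_gt0 : (0 < gb)%R).
Hypothesis scaled_slices : forall (t : R) (Phi : V * V -> \bar R), (0 < t)%R ->
  measurable_fun setT Phi -> (forall q, 0 <= Phi q) ->
  \int[(lebesgue_rV n \x e)]_q Phi q = (kappa * t ^+ d * t ^+ d)%:E *
    \int[e]_x \int[b]_y \int[a]_z Phi (x + t *: y, x + t *: z)%R.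
Hypothesis mass_slices : forall t : R, (0 < t)%R ->
  gauss_mass ip (beta0 / t ^+ 2) = (kappa * t ^+ d * t ^+ d * (ga * gb))%R.
Variable tau : {measure set (V * V * V)%type -> \bar R}.
Hypothesis tauE : forall f : V * V * V -> \bar R, measurable_fun setT f -> (forall w, 0 <= f w) ->
  \int[tau]_w f w = \int[e]_x \int[b]_y \int[a]_z f (x, y, z).
Variables (D : V -> R) (mu : {measure set (V * V)%type -> \bar R}).
Hypotheses (mD : measurable_fun setT D) (D0 : forall x, (0 <= D x)%R).
Hypothesis muE : forall A, measurable A ->
  mu A = \int[(lebesgue_rV n \x e)]_(q in A) (D q.1)%:E.

Definition slice_gauss (w : V * V * V) : R :=
  expR (- beta0 * (ipnorm ip w.1.2 ^+ 2 + ipnorm ip w.2 ^+ 2)).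

Lemma measurable_slice_gauss : measurable_fun setT slice_gauss.
Proof.
have mip := measurable_ipnorm ip.
apply: measurableT_comp => //; apply: measurable_funM => //; apply: measurable_funD;
  apply: measurable_funX; apply: measurableT_comp mip _ => //.
exact: measurableT_comp measurable_snd measurable_fst.
Qed.

Lemma measurable_gauss_weight beta : measurable_fun setT (gauss_weight ip beta).
Proof.
apply: measurable_funM => //; apply: measurableT_comp => //; apply: measurable_funM => //.
apply: measurable_funX; apply: measurableT_comp (measurable_ipnorm ip) _.
by apply: measurable_add_rV => //; exact: measurable_opp_rV.
Qed.

Lemma gauss_weight_ge0 beta q : (0 <= gauss_weight ip beta q)%R.
Proof.
rewrite mulr_ge0 ?expR_ge0// invr_ge0 fine_ge0//.
by apply: integral_ge0 => x _; rewrite lee_fin expR_ge0.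
Qed.

Lemma thermalized_measure beta : exists m : {measure set (V * V)%type -> \bar R},
  (m : set _ -> \bar R) = thermalized ip mu beta.
Proof.
exact: (density_measure mu (measurable_gauss_weight beta) (gauss_weight_ge0 beta)).
Qed.

Lemma measurable_slice1 (t : R) : measurable_fun setT (fun w : V * V * V => w.1.1 + t *: w.1.2)%R.
Proof.
apply: measurable_add_rV; first exact: measurableT_comp measurable_fst measurable_fst.
by apply: measurable_scale_rV; exact: measurableT_comp measurable_snd measurable_fst.
Qed.

Lemma measurable_slice2 (t : R) : measurable_fun setT (fun w : V * V * V => w.1.1 + t *: w.2)%R.
Proof.
apply: measurable_add_rV; first exact: measurableT_comp measurable_fst measurable_fst.
exact: measurable_scale_rV.
Qed.

Definition slice_integrand (f : V * V -> R) (t : R) (w : V * V * V) : R :=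
  f (w.1.1 + t *: w.1.2, w.1.1 + t *: w.2)%R * slice_gauss w * D (w.1.1 + t *: w.1.2).

Lemma measurable_slice_integrand f t : measurable_fun setT f ->
  measurable_fun setT (slice_integrand f t).
Proof.
move=> mf; apply: measurable_funM; last exact: measurableT_comp mD (measurable_slice1 t).
apply: measurable_funM measurable_slice_gauss.
apply: measurableT_comp mf _; apply: measurable_fun_pair.
  exact: measurable_slice1.
exact: measurable_slice2.
Qed.

Lemma slice_integrand_ge0 f t w : (forall q, (0 <= f q)%R) -> (0 <= slice_integrand f t w)%R.
Proof. by move=> f0; rewrite !mulr_ge0 ?expR_ge0. Qed.

(** Here [t] is $1/\lambda$ and $G$ is [ga * gb]. Orthogonality of [y] and [z] holds only almost
    everywhere, because [a] and [b] are measures on the whole space. *)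
Lemma integral_thermalized t (f : V * V -> R) : (0 < t)%R ->
  measurable_fun setT f -> (forall q, (0 <= f q)%R) ->
  \int[thermalized ip mu (beta0 / t ^+ 2)]_q (f q)%:E =
  ((ga * gb)^-1)%:E * \int[tau]_w (slice_integrand f t w)%:E.
Proof.
move=> t0 mf f0; set beta := (beta0 / t ^+ 2)%R.
have [m mE] := thermalized_measure beta; rewrite -mE.
have mw := measurable_gauss_weight beta; have w0 := gauss_weight_ge0 beta.
have fE := (measurable_EFinP _ _).2 mf.
rewrite (@ge0_integral_density _ _ _ mu _ mw w0 m (EFin \o f))//; last first.
  by move=> A _; rewrite mE.
(* The reciprocal of [gauss_mass]; multiplied by the Jacobian factor of [scaled_slices] it leaves
   [(ga * gb)^-1]. *)
pose c := (kappa * t ^+ d * t ^+ d * (ga * gb))^-1%R.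
pose Phi (q : V * V) := (f q * gauss_weight ip beta q)%:E * (D q.1)%:E.
have mfw : measurable_fun setT (fun q : V * V => (f q * gauss_weight ip beta q)%R).
  exact: measurable_funM.
have mD1 : measurable_fun setT (fun q : V * V => D q.1) by exact: measurableT_comp.
have mPhi : measurable_fun setT Phi.
  by apply: emeasurable_funM; apply/measurable_EFinP.
have Phi0 q : 0 <= Phi q by rewrite mule_ge0 ?lee_fin// mulr_ge0.
transitivity (\int[(lebesgue_rV n \x e)]_q Phi q).
  rewrite -(@ge0_integral_density _ _ _ (lebesgue_rV n \x e)%E (fun q => D q.1) mD1
     (fun q => D0 _) mu (fun q => (f q * gauss_weight ip beta q)%:E) muE)//.
  - exact/measurable_EFinP.
  - by move=> q; rewrite lee_fin mulr_ge0.
rewrite (scaled_slices t0 mPhi Phi0).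
have mH := (measurable_EFinP _ _).2 (measurable_slice_integrand t mf).
have H0 w : 0 <= (slice_integrand f t w)%:E by rewrite lee_fin slice_integrand_ge0.
have c0 : (0 < c)%R by rewrite invr_gt0 !mulr_gt0 ?exprn_gt0.
transitivity ((kappa * t ^+ d * t ^+ d)%:E *
    \int[tau]_w (c%:E * (slice_integrand f t w)%:E)).
  have cH0 w : 0 <= c%:E * (slice_integrand f t w)%:E by rewrite mule_ge0// lee_fin ltW.
  rewrite (tauE (measurable_funeM c%:E mH) cH0).
  apply: (congr1 (mule (kappa * t ^+ d * t ^+ d)%:E)); apply: eq_integral => x _.
  apply: ae_eq_integral_nonmeasurable; apply: filterS bU => y yU.
  apply: ae_eq_integral_nonmeasurable; apply: filterS aU => z zU.
  rewrite /Phi -!EFinM; congr (_%:E).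
  have yz : ip y z = 0%R by have /mem_orthovP/(_ z zU) := yU.
  rewrite /gauss_weight/= mass_slices// -/c /slice_integrand/=.
  rewrite opprD addrACA subrr add0r -scalerBr ipnormZ gtr0_norm// exprMn.
  rewrite (ipnorm_pythagoras yz) /slice_gauss/=.
  have -> : (- beta * (t ^+ 2 * (ipnorm ip y ^+ 2 + ipnorm ip z ^+ 2)) =
      - beta0 * (ipnorm ip y ^+ 2 + ipnorm ip z ^+ 2))%R.
    by rewrite /beta mulrA; congr (_ * _)%R; rewrite mulNr divfK// gt_eqF// exprn_gt0.
  ring.
rewrite (ge0_integralZl tau measurableT mH (fun w _ => H0 w)) ?lee_fin ?(ltW c0)//.
rewrite muleA -EFinM; congr (_%:E * _).
rewrite /c (invfM (kappa * t ^+ d * t ^+ d)%R) mulrA divff ?mul1r// gt_eqF//.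
by rewrite !mulr_gt0 ?exprn_gt0.
Qed.

End ThermalizedSlices.

(** * Almost everywhere statements on products and on slices *)

Section IteratedAe.
Context d1 d2 d3 (T1 : measurableType d1) (T2 : measurableType d2) (T3 : measurableType d3).
Context (R : realType) (m1 : {sigma_finite_measure set T1 -> \bar R})
  (m2 : {sigma_finite_measure set T2 -> \bar R}) (m3 : {sigma_finite_measure set T3 -> \bar R}).
Local Open Scope ereal_scope.
Variable tau : {measure set (T1 * T2 * T3)%type -> \bar R}.
Hypothesis tauE : forall f : T1 * T2 * T3 -> \bar R, measurable_fun setT f -> (forall w, 0 <= f w) ->
  \int[tau]_w f w = \int[m1]_x \int[m2]_y \int[m3]_z f (x, y, z).

Lemma ge0_integral_eq0 d (T : measurableType d) (m : {measure set T -> \bar R}) (f : T -> \bar R) :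
  measurable_fun setT f -> (forall x, 0 <= f x) ->
  \int[m]_x f x = 0 <-> \forall x \ae m, f x = 0.
Proof.
move=> mf f0; split => [f_int0|f_ae0].
  have : \int[m]_x `|f x| = 0 by rewrite -f_int0; apply: eq_integral => x _; rewrite gee0_abs.
  by move/(ae_eq_integral_abs m measurableT mf).1; apply: filterS => x; exact.
rewrite -[RHS](integral0 m setT); exact: ae_eq_integral_nonmeasurable.
Qed.

Let integral_tau (q : T1 * T2 -> \bar R) : measurable_fun setT q -> (forall p, 0 <= q p) ->
  \int[tau]_w q w.1 = \int[m1]_x \int[m2]_y \int[m3]_z q (x, y).
Proof.
move=> mq q0; rewrite (tauE (f := fun w => q w.1))//.
exact: measurableT_comp mq measurable_fst.
Qed.

(** Iterated statements pass to the product only for measurable properties; encoding one as the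
    vanishing of a measurable [q] makes Tonelli applicable. *)
Lemma iterated_ae (q : T1 * T2 -> \bar R) : measurable_fun setT q -> (forall p, 0 <= q p) ->
  (\forall x \ae m1, \forall y \ae m2, q (x, y) = 0) -> \forall w \ae tau, q w.1 = 0.
Proof.
move=> mq q0 q_ae0; apply/(ge0_integral_eq0 tau) => //.
  exact: measurableT_comp mq measurable_fst.
rewrite integral_tau// -[RHS](integral0 m1 setT).
apply: ae_eq_integral_nonmeasurable; apply: filterS q_ae0 => x qx_ae0.
rewrite -[RHS](integral0 m2 setT).
apply: ae_eq_integral_nonmeasurable; apply: filterS qx_ae0 => y ->.
by rewrite integral0.
Qed.

Hypothesis m3_neq0 : m3 setT != 0.

(** As [q] ignores the third variable, its innermost integral is [q p * m3 setT], from which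
    [q p = 0] follows because [m3] is not zero. *)
Lemma ae_iterated (q : T1 * T2 -> \bar R) : measurable_fun setT q -> (forall p, 0 <= q p) ->
  (\forall w \ae tau, q w.1 = 0) -> \forall x \ae m1, \forall y \ae m2, q (x, y) = 0.
Proof.
move=> mq q0 q_ae0.
have mq1 : measurable_fun setT (fun w : T1 * T2 * T3 => q w.1).
  exact: measurableT_comp mq measurable_fst.
have mq2 : measurable_fun setT (fun p : T1 * T2 => \int[m3]_z q p).
  exact: measurable_integral_snd mq1 _.
have q20 p : 0 <= \int[m3]_z q p by exact: integral_ge0.
have mq3 : measurable_fun setT (fun x : T1 => \int[m2]_y \int[m3]_z q (x, y)).
  exact: measurable_integral_snd mq2 q20.
have q30 x : 0 <= \int[m2]_y \int[m3]_z q (x, y) by exact: integral_ge0.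
have : \int[tau]_w q w.1 = 0 by apply/(ge0_integral_eq0 tau).
rewrite integral_tau// => /(ge0_integral_eq0 m1 mq3 q30).
apply: filterS => x /(ge0_integral_eq0 m2 (measurableT_comp mq2 (measurable_pair1 x)) (fun y => q20 _)).
have q_int p : \int[m3]_z q p = q p * m3 setT by exact: integral_cst.
apply: filterS => y /=; rewrite q_int => /eqP.
by rewrite mule_eq0 (negbTE m3_neq0) orbF => /eqP.
Qed.

End IteratedAe.

(** * Dominated convergence on the slices *)

Section SliceLimit.
Context {R : realType} (n : nat) (ip : {dot 'rV[R]_n for idfun}).
Local Open Scope ereal_scope.
Local Notation V := 'rV[R]_n.
Variables (a b e : {sigma_finite_measure set V -> \bar R}).
Variables (beta0 ga gb : R).
Hypotheses (ga_gt0 : (0 < ga)%R) (gb_gt0 : (0 < gb)%R).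
Local Notation gauss x := (expR (- beta0 * ipnorm ip x ^+ 2)).
Hypothesis gaE : \int[a]_x (gauss x)%:E = ga%:E.
Hypothesis gbE : \int[b]_x (gauss x)%:E = gb%:E.
Variable tau : {measure set (V * V * V)%type -> \bar R}.
Hypothesis tauE : forall f : V * V * V -> \bar R, measurable_fun setT f -> (forall w, 0 <= f w) ->
  \int[tau]_w f w = \int[e]_x \int[b]_y \int[a]_z f (x, y, z).
Variables (D LD : V -> R).
Hypotheses (mD : measurable_fun setT D) (D0 : forall x, (0 <= D x)%R).
Hypothesis LD0 : forall x, (0 <= LD x)%R.
Hypothesis LD_D : forall t : R, (0 < t)%R ->
  \forall x \ae e, \forall y \ae b, D (x + t *: y)%R = LD (x + t *: y)%R.
Hypothesis LD_cvg : \forall x \ae e, \forall y \ae b,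
  LD (x + lambda^-1 *: y)%R @[lambda --> +oo%R] --> LD x.

Let measurable_slice (t : R) : measurable_fun setT (fun p : V * V => p.1 + t *: p.2)%R.
Proof. by apply: measurable_add_rV => //; exact: measurable_scale_rV. Qed.

(** [D] and [LD] agree on slices outside a null set depending on the scale; along a sequence these
    null sets have a null union. *)
Let D_cvg (lambda : R^nat) : (forall k, (0 < lambda k)%R) -> lambda k @[k --> \oo] --> +oo%R ->
  \forall x \ae e, \forall y \ae b,
    D (x + (lambda k)^-1 *: y)%R @[k --> \oo] --> LD x.
Proof.
move=> lambda0 lambdaoo.
have DL : \forall x \ae e, forall k, \forall y \ae b,
    D (x + (lambda k)^-1 *: y)%R = LD (x + (lambda k)^-1 *: y)%R.
  by apply: ae_foralln => k; apply: LD_D; rewrite invr_gt0.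
apply: filterS2 DL LD_cvg => x /ae_foralln DLx cvgx.
apply: filterS2 DLx cvgx => y DLxy cvgxy.
have -> : (fun k => D (x + (lambda k)^-1 *: y)%R) = (fun k => LD (x + (lambda k)^-1 *: y)%R).
  by apply/funext => k.
exact: (@cvg_comp _ _ _ lambda (fun l : R => LD (x + l^-1 *: y)%R) _ _ _ lambdaoo cvgxy).
Qed.

(* [LD] is only assumed to be measurable up to an [L^n]-null set, which may contain
   [E]. On [E] it agrees almost everywhere with the Gaussian average over the
   normal directions of the upper limit of the Borel function [D]. *)
Lemma slice_density : exists l : V -> R, [/\ measurable_fun setT l, (forall x, (0 <= l x)%R) &
  \forall x \ae e, LD x = l x].
Proof.
(* The upper limit is measurable everywhere, whereas the limit exists only almost everywhere. *)
pose h (p : V * V) := limn_esup (fun k => (D (p.1 + (k.+1%:R)^-1 *: p.2)%R)%:E).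
have mh : measurable_fun setT h.
  apply: measurable_fun_limn_esup => k; apply/measurable_EFinP.
  exact: measurableT_comp mD (measurable_slice _).
have h0 p : 0 <= h p.
  rewrite /h limn_esup_lim; apply: lime_ge; first exact: is_cvg_esups.
  apply: nearW => k; apply: le_trans (ereal_sup_ubound (_ : _ (D (p.1 + (k.+1%:R)^-1 *: p.2)%R)%:E)).
    by rewrite lee_fin.
  by exists k => /=.
have gE : measurable_fun setT (fun x : V => (gauss x)%:E).
  by apply/measurable_EFinP; exact: measurable_gauss.
have mhg : measurable_fun setT (fun p : V * V => h p * (gauss p.2)%:E).
  by apply: emeasurable_funM => //; exact: measurableT_comp gE measurable_snd.
have hg0 p : 0 <= h p * (gauss p.2)%:E by rewrite mule_ge0// lee_fin expR_ge0.
pose L x := (gb^-1)%:E * \int[b]_y (h (x, y) * (gauss y)%:E).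
have mL : measurable_fun setT L.
  apply: measurable_funeM; exact: measurable_integral_snd mhg hg0.
(* [L] may be infinite, where [fine] returns 0; almost everywhere [L x] equals the finite [LD x]. *)
exists (fine \o L); split.
- exact: measurableT_comp (fine_measurable measurableT) mL.
- move=> x /=; rewrite fine_ge0// mule_ge0 ?lee_fin ?invr_ge0 ?(ltW gb_gt0)//.
  by apply: integral_ge0 => y _; exact: hg0 (x, y).
- apply: filterS (D_cvg (lambda := fun k => k.+1%:R) _ _) => // [x Dx|]; last first.
    by apply/cvgryPge => A; apply: filterS (nbhs_infty_ger A) => k /le_trans; apply; rewrite ler_nat.
  rewrite /= /L.
  have -> : \int[b]_y (h (x, y) * (gauss y)%:E) = \int[b]_y ((LD x)%:E * (gauss y)%:E).
    apply: ae_eq_integral_nonmeasurable; apply: filterS Dx => y cvgD'.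
    have cvgD : (D (x + k.+1%:R^-1 *: y)%R)%:E @[k --> \oo] --> (LD x)%:E.
      by apply: cvg_EFin; [exact: nearW|exact: cvgD'].
    congr (_ * _); rewrite /h is_cvg_limn_esupE; last by apply/cvg_ex; exists (LD x)%:E; exact: cvgD.
    by apply/cvg_lim => //; exact: cvgD.
  have gE0 y : setT y -> 0 <= (gauss y)%:E by rewrite lee_fin expR_ge0.
  rewrite (ge0_integralZl b measurableT gE gE0) ?lee_fin//.
  by rewrite gbE muleCA -(EFinM gb^-1 gb) mulVf ?gt_eqF// mule1.
Qed.

Hypothesis LD_Dtau : forall t : R, (0 < t)%R ->
  \forall w \ae tau, D (w.1.1 + t *: w.1.2)%R = LD (w.1.1 + t *: w.1.2)%R.
Variables (g : V * V * V -> R) (lambda0 : R).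
Hypotheses (lambda0_gt0 : (0 < lambda0)%R) (g_int : tau.-integrable setT (EFin \o g)).
Hypothesis Lslice_dominated : \forall w \ae tau, forall lambda, (lambda0 <= lambda)%R ->
  (slice_gauss ip beta0 w * LD (w.1.1 + lambda^-1 *: w.1.2) <= g w)%R.
Variable l : V -> R.
Hypotheses (ml : measurable_fun setT l) (l0 : forall x, (0 <= l x)%R).
Hypothesis LD_l : \forall x \ae e, LD x = l x.

Definition limit_integrand (f : V * V -> R) (w : V * V * V) : R :=
  (f (w.1.1, w.1.1) * slice_gauss ip beta0 w * l w.1.1)%R.

Lemma slice_dominated (lambda : R^nat) : (forall k, (lambda0 <= lambda k)%R) ->
  \forall w \ae tau, forall k,
    (slice_gauss ip beta0 w * D (w.1.1 + (lambda k)^-1 *: w.1.2) <= g w)%R.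
Proof.
move=> lambdaP.
have DL : \forall w \ae tau, forall k,
    D (w.1.1 + (lambda k)^-1 *: w.1.2)%R = LD (w.1.1 + (lambda k)^-1 *: w.1.2)%R.
  apply: ae_foralln => k; apply: LD_Dtau.
  by rewrite invr_gt0 (lt_le_trans lambda0_gt0).
by apply: filterS2 DL Lslice_dominated => w DLw domw k; rewrite DLw domw.
Qed.

(** Convergence is expressed as vanishing of the upper limit [q] of the distances to the limit. With
    the Borel [l] in place of [LD], [q] is measurable and [iterated_ae] applies. *)
Lemma slice_cvg_ae (lambda : R^nat) : (forall k, (0 < lambda k)%R) -> lambda k @[k --> \oo] --> +oo%R ->
  \forall w \ae tau, D (w.1.1 + (lambda k)^-1 *: w.1.2)%R @[k --> \oo] --> l w.1.1.
Proof.
move=> lambdaP lambdaoo.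
pose u (p : V * V) k := `|(D (p.1 + (lambda k)^-1 *: p.2)%R)%:E - (l p.1)%:E|.
pose q p := limn_esup (u p).
have mq : measurable_fun setT q.
  apply: measurable_fun_limn_esup => k; apply: measurableT_comp => //.
  apply: emeasurable_funB; apply/measurable_EFinP.
    exact: measurableT_comp mD (measurable_slice _).
  exact: measurableT_comp ml measurable_fst.
have q0 p : 0 <= q p.
  rewrite /q limn_esup_lim; apply: lime_ge; first exact: is_cvg_esups.
  apply: nearW => k; apply: le_trans (ereal_sup_ubound (_ : _ (u p k))); first exact: abse_ge0.
  by exists k => /=.
have : \forall w \ae tau, q w.1 = 0.
  apply: (iterated_ae tauE mq q0).
  apply: filterS2 LD_l (D_cvg lambdaP lambdaoo) => x LDx; apply: filterS => y.
  rewrite LDx => Dxy.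
  suff h : u (x, y) k @[k --> \oo] --> 0.
    by rewrite /q is_cvg_limn_esupE; [exact/cvg_lim|apply/cvg_ex; exists 0].
  rewrite -[X in _ --> X]abse0 -(subee (x := (l x)%:E))//.
  apply: cvg_abse; apply: cvgeB => //; last exact: cvg_cst.
  by apply: cvg_EFin; [exact: nearW|exact: Dxy].
apply: filterS => w qw0.
have : u w.1 k @[k --> \oo] --> 0.
  by apply: limn_esup_le_cvg => [|k]; rewrite -/(q w.1) ?qw0 /u ?abse_ge0.
by move=> /fine_cvgP[_ h]; apply/subr_cvg0/norm_cvg0P.
Qed.

Lemma slice_integral_cvg (f : V * V -> R) (M : R) (lambda : R^nat) :
  continuous f -> (forall q, (0 <= f q <= M)%R) ->
  (forall k, (lambda0 <= lambda k)%R) -> lambda k @[k --> \oo] --> +oo%R ->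
  tau.-integrable setT (EFin \o limit_integrand f) /\
  \int[tau]_w (slice_integrand ip beta0 D f (lambda k)^-1 w)%:E @[k --> \oo] -->
    \int[tau]_w (limit_integrand f w)%:E.
Proof.
move=> cf fM lambdaP lambdaoo.
have lambda_gt0 k : (0 < lambda k)%R by exact: lt_le_trans (lambdaP k).
have mf : measurable_fun setT f by exact: continuous_measurable_pair.
have mG := measurable_slice_gauss ip beta0.
have mx : measurable_fun setT (fun w : V * V * V => w.1.1).
  exact: measurableT_comp measurable_fst measurable_fst.
have mlim : measurable_fun setT (EFin \o limit_integrand f).
  apply/measurable_EFinP; apply: measurable_funM; last exact: measurableT_comp ml mx.
  apply: measurable_funM => //; apply: measurableT_comp mf _; exact: measurable_fun_pair.
have mslice k : measurable_fun setT (EFin \o slice_integrand ip beta0 D f (lambda k)^-1).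
  by apply/measurable_EFinP; exact: measurable_slice_integrand.
(* The majorant: [f] contributes at most [M], the Gaussian times [D] at most [g]. *)
have gM_int : tau.-integrable setT (fun w => M%:E * (g w)%:E) by exact: integrableZl.
have lambda_inv : (lambda k)^-1%R @[k --> \oo] --> (0 : R)%R.
  by apply/gtr0_cvgV0 => //; exact: nearW.
have [||+ _ +] := dominated_convergence measurableT mslice mlim _ gM_int; last by split.
- apply: filterS (slice_cvg_ae lambda_gt0 lambdaoo) => -[[x y] z] /= Dxy _.
  apply: cvg_EFin; first exact: nearW.
  have cvgx (v : V) : (x + (lambda k)^-1 *: v)%R @[k --> \oo] --> x.
    rewrite -[X in _ --> X]addr0 -(scale0r v); apply: cvgD; first exact: cvg_cst.
    by apply: cvgZr_tmp.
  have cvgf : f (x + (lambda k)^-1 *: y, x + (lambda k)^-1 *: z)%R @[k --> \oo] --> f (x, x).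
    apply: (continuous_cvg _ (cf (x, x))).
    exact: cvg_pair (cvgx y) (cvgx z).
  apply: cvgM => //; apply: cvgM => //; exact: cvg_cst.
- apply: filterS (slice_dominated lambdaP) => w domw k _ /=.
  have /andP[f0 f1] := fM (w.1.1 + (lambda k)^-1 *: w.1.2, w.1.1 + (lambda k)^-1 *: w.2)%R.
  rewrite ger0_norm /slice_integrand ?mulr_ge0 ?expR_ge0// lee_fin -mulrA.
  by rewrite ler_pM// mulr_ge0 ?expR_ge0.
Qed.

Lemma integral_limit_integrand (f : V * V -> R) :
  measurable_fun setT f -> (forall q, 0 <= f q)%R ->
  \int[tau]_w (limit_integrand f w)%:E = (ga * gb)%:E * \int[e]_x (f (x, x) * l x)%:E.
Proof.
move=> mf f0.
have mx : measurable_fun setT (fun w : V * V * V => w.1.1).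
  exact: measurableT_comp measurable_fst measurable_fst.
have mlim : measurable_fun setT (fun w => (limit_integrand f w)%:E).
  apply/measurable_EFinP; apply: measurable_funM; last exact: measurableT_comp ml mx.
  apply: measurable_funM; last exact: measurable_slice_gauss.
  by apply: measurableT_comp mf _; exact: measurable_fun_pair.
have lim0 w : 0 <= (limit_integrand f w)%:E by rewrite lee_fin !mulr_ge0 ?expR_ge0.
have mg : measurable_fun setT (fun x : V => (gauss x)%:E).
  by apply/measurable_EFinP; exact: measurable_gauss.
have g0 (x : V) : setT x -> 0 <= (gauss x)%:E by rewrite lee_fin expR_ge0.
have mfl : measurable_fun setT (fun x : V => (f (x, x) * l x)%:E).
  apply/measurable_EFinP; apply: measurable_funM => //.
  by apply: measurableT_comp mf _; exact: measurable_fun_pair.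
have fl0 (x : V) : setT x -> 0 <= (f (x, x) * l x)%:E by rewrite lee_fin mulr_ge0.
have ga0 : 0 <= ga%:E by rewrite lee_fin ltW.
have gab0 : 0 <= (ga * gb)%:E by rewrite lee_fin mulr_ge0 ?(ltW ga_gt0) ?(ltW gb_gt0).
rewrite (tauE mlim lim0) -(ge0_integralZl e measurableT mfl fl0 gab0).
apply: eq_integral => x _.
transitivity (\int[b]_y ((f (x, x) * l x)%:E * ga%:E * (gauss y)%:E)).
  apply: eq_integral => y _.
  transitivity (\int[a]_z ((f (x, x) * l x)%:E * (gauss y)%:E * (gauss z)%:E)).
    apply: eq_integral => z _; rewrite -!EFinM; congr (_%:E).
    by rewrite /limit_integrand /slice_gauss/= mulrDr expRD; ring.
  rewrite (ge0_integralZl a measurableT mg g0) ?mule_ge0 ?fl0 ?g0//.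
  by rewrite gaE muleAC.
rewrite (ge0_integralZl b measurableT mg g0) ?mule_ge0 ?fl0//.
by rewrite gbE -muleA -EFinM muleC.
Qed.

End SliceLimit.

(** * From sequences and nonnegative test functions to weak convergence *)

Section DiagonalWeakLimit.
Context {R : realType} (n : nat).
Local Open Scope ereal_scope.
Local Notation V := 'rV[R]_n.
Local Notation X := (V * V)%type.
Variables (m_ : R -> set X -> \bar R) (beta1 : R).
Variables (e : {sigma_finite_measure set V -> \bar R}) (l : V -> R).
Hypotheses (ml : measurable_fun setT l) (l0 : forall x, (0 <= l x)%R).
Hypothesis m_measure : forall beta, exists m : {measure set X -> \bar R}, (m : set X -> \bar R) = m_ beta.
Hypothesis m_fin : forall beta, (beta1 <= beta)%R -> m_ beta setT < +oo.
Hypothesis l_fin : \int[e]_x (l x)%:E < +oo.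
Hypothesis m_cvg : forall (f : X -> R) (M : R) (u : R^nat), continuous f ->
  (forall q, (0 <= f q <= M)%R) -> (forall k, (beta1 <= u k)%R) -> u k @[k --> \oo] --> +oo%R ->
  \int[m_ (u k)]_q (f q)%:E @[k --> \oo] --> \int[e]_x (f (x, x) * l x)%:E.

Let m_cvg_pinfty (f : X -> R) (M : R) : continuous f -> (forall q, (0 <= f q <= M)%R) ->
  \int[m_ beta]_q (f q)%:E @[beta --> +oo%R] --> \int[e]_x (f (x, x) * l x)%:E.
Proof.
move=> cf fM; apply/cvge_pinftyP => u uoo.
(* Domination is available only from [beta1] on; [v] satisfies this for all [k] and eventually
   equals [u]. *)
pose v k := Num.max beta1 (u k).
have voo : v k @[k --> \oo] --> +oo%R.
  move/cvgryPge : uoo => uoo; apply/cvgryPge => A; apply: filterS (uoo A) => k.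
  by rewrite /v le_max => ->; rewrite orbT.
apply: cvg_trans (m_cvg cf fM (u := v) _ voo); last by move=> k; rewrite /v le_max lexx.
apply: near_eq_cvg; move/cvgryPge : uoo => /(_ beta1); apply: filterS => k uk.
by rewrite /v max_r.
Qed.

Let diag_measurable : measurable_fun setT (fun x : V => (x, x)).
Proof. exact: measurable_fun_pair. Qed.

Let fl_measurable (f : X -> R) : continuous f ->
  measurable_fun setT (fun x => (f (x, x) * l x)%:E).
Proof.
move=> /continuous_measurable_pair mf; apply/measurable_EFinP; apply: measurable_funM => //.
exact: measurableT_comp mf diag_measurable.
Qed.

Let fl_integrable (f : X -> R) : Cb f -> e.-integrable setT (fun x => (f (x, x) * l x)%:E).
Proof.
move=> [cf [M fM]]; have l_int : e.-integrable setT (EFin \o l).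
  apply/integrableP; split; first exact/measurable_EFinP.
  by under eq_integral do rewrite /= ger0_norm//.
apply: le_integrable (integrableZl measurableT M l_int) => //; first exact: fl_measurable.
move=> x _ /=; rewrite lee_fin !normrM ler_wpM2r//.
by apply: le_trans (fM _) _; exact: ler_norm.
Qed.

Lemma diagonal_weak_limit : exists mu_oo : {measure set X -> \bar R},
  weak_limit m_ mu_oo /\ forall f, Cb f ->
    e.-integrable setT (fun x => (f (x, x) * l x)%:E) /\
    \int[mu_oo]_q (f q)%:E = \int[e]_x (f (x, x) * l x)%:E.
Proof.
have [el elE] := density_measure e ml l0.
(* The limit is [l] times [e], carried to the diagonal. *)
have [mu_oo mu_ooE] := pushforward_measure el diag_measurable.
have ge0_int (f : X -> R) : continuous f -> (forall q, (0 <= f q)%R) ->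
    \int[mu_oo]_q (f q)%:E = \int[e]_x (f (x, x) * l x)%:E.
  move=> cf f0; rewrite mu_ooE.
  have mf := continuous_measurable_pair cf.
  rewrite (ge0_integral_pushforward diag_measurable el measurableT
    ((measurable_EFinP _ _).2 mf) (fun q _ => f0 q))/= preimage_setT.
  rewrite (@ge0_integral_density _ _ _ e _ ml l0 el (fun x => (f (x, x))%:E))//.
    by move=> A _; rewrite elE.
    by apply/measurable_EFinP; exact: measurableT_comp mf diag_measurable.
  by move=> x; rewrite lee_fin.
(* The formulas for densities and images are for nonnegative functions, so a signed test function is
   split into its parts, which are again in [Cb]. *)
pose fp (f : X -> R) q := Num.max (f q) 0%R; pose fn (f : X -> R) q := Num.max (- f q)%R 0%R.
have cfp f : continuous f -> continuous (fp f).
  move=> cf q; apply: (continuous_max (f := f) (g := cst 0%R)); first exact: cf.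
  exact: cst_continuous.
have cfn f : continuous f -> continuous (fn f).
  move=> cf; apply: (cfp (fun q => - f q)%R) => q; apply: cvgN; exact: cf.
have fp0 f q : (0 <= fp f q)%R by rewrite le_max lexx orbT.
have fn0 f q : (0 <= fn f q)%R by rewrite le_max lexx orbT.
have splitE (m : {measure set X -> \bar R}) f :
    \int[m]_q (f q)%:E = \int[m]_q (fp f q)%:E - \int[m]_q (fn f q)%:E.
  by rewrite integralE; congr (_ - _); apply: eq_integral => q _;
    rewrite (funeposE, funenegE) /= -EFin_max.
have splitlE f : \int[e]_x (f (x, x) * l x)%:E =
    \int[e]_x (fp f (x, x) * l x)%:E - \int[e]_x (fn f (x, x) * l x)%:E.
  rewrite integralE; congr (_ - _); apply: eq_integral => x _;
    rewrite (funeposE, funenegE) /= -?EFinN -EFin_max; congr (_%:E).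
    by rewrite /fp maxr_pMl// mul0r.
  by rewrite /fn maxr_pMl// mul0r mulNr.
have Cbfp f : Cb f -> Cb (fp f).
  move=> [cf [M fM]]; split; first exact: cfp.
  by exists M => q; rewrite ger0_norm// ge_max (le_trans (ler_norm _) (fM q)) (le_trans _ (fM q)).
have Cbfn f : Cb f -> Cb (fn f).
  move=> [cf [M fM]]; split; first exact: cfn.
  exists M => q; rewrite ger0_norm// ge_max (le_trans _ (fM q)) ?(le_trans _ (fM q))//.
  by rewrite -normrN ler_norm.
have mu_ooI f : Cb f -> \int[mu_oo]_q (f q)%:E = \int[e]_x (f (x, x) * l x)%:E.
  by move=> [cf _]; rewrite splitE splitlE !ge0_int//; [exact: cfn|exact: cfp].
have mu_oo_fin : mu_oo setT < +oo.
  apply: le_lt_trans l_fin; rewrite mu_ooE /pushforward elE preimage_setT.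
  exact: lexx.
exists mu_oo; split; last by move=> f Cbf; split; [exact: fl_integrable|exact: mu_ooI].
split.
- apply: filterS (nbhs_pinfty_ge (num_real beta1)) => beta /m_fin.
  by have [m <-] := m_measure beta; exact: finite_measure_radon.
- exact: finite_measure_radon.
- move=> f Cbf; rewrite mu_ooI// splitlE.
  have -> : (fun beta => \int[m_ beta]_q (f q)%:E) = (fun beta =>
      \int[m_ beta]_q (fp f q)%:E - \int[m_ beta]_q (fn f q)%:E).
    by apply/funext => beta; have [m <-] := m_measure beta; exact: splitE.
  have bound h : Cb h -> (forall q, 0 <= h q)%R ->
      \int[m_ beta]_q (h q)%:E @[beta --> +oo%R] --> \int[e]_x (h (x, x) * l x)%:E.
    move=> [ch [M hM]] h0; apply: (m_cvg_pinfty (M := M)) => // q.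
    by rewrite h0 (le_trans (ler_norm _) (hM q)).
  have [Cbp Cbn] := (Cbfp _ Cbf, Cbfn _ Cbf).
  apply: cvgeB; [|exact: bound|exact: bound].
  apply: fin_num_adde_defr; apply: integrable_fin_num => //; exact: fl_integrable.
Qed.

End DiagonalWeakLimit.

(** * Transfer of densities and null sets to the slices *)

Section AffineRegularity.
Context {R : realType} (n : nat) (ip : {dot 'rV[R]_n for idfun}) (d : nat).
Local Open Scope ereal_scope.
Local Notation V := 'rV[R]_n.
Local Notation Hon := (hausdorff_on (ipdist ip) d).
Local Notation L := (lebesgue_rV n).

Lemma hausdorff_affine_measure (a : {sigma_finite_measure set V -> \bar R}) (U : {vspace V}) (p : V) :
  (forall r, (0 < r)%R -> a [set v | (`|v| <= r)%R] < +oo) ->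
  (a : set V -> \bar R) = Hon [set` U] ->
  exists e : {sigma_finite_measure set V -> \bar R},
    (e : set V -> \bar R) = Hon [set (p + v)%R | v in [set` U]].
Proof.
move=> afin aE.
have mp : measurable_fun setT (fun x : V => x + p)%R.
  by apply: measurable_add_rV => //; exact: measurable_id.
have [m mE] := pushforward_measure a mp.
have {}mE : (m : set V -> \bar R) = Hon [set (p + v)%R | v in [set` U]].
  rewrite mE; apply/funext => A.
  transitivity (a [set v : V | A (v + p)%R]) => //; rewrite aE -hausdorff_on_translate.
  by congr (Hon _ A); apply/eq_imagel => v _; rewrite addrC.
have [|e eE] := @sigma_finite_measure_of _ _ _ m; last by exists e; rewrite eE.
apply: sigma_finite_norm_le => r r0; rewrite mE.
have -> : [set (p + v)%R | v in [set` U]] = [set (v + p)%R | v in [set` U]].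
  by apply/eq_imagel => v _; rewrite addrC.
rewrite hausdorff_on_translate -aE.
(* The translated ball lies in the one of radius [r + |p|]; adding 1 keeps the radius positive when
   [r] and [p] vanish. *)
apply: le_lt_trans (afin (r + `|p| + 1)%R _); last by rewrite ltr_wpDl// addr_ge0.
apply: le_measure; rewrite ?inE.
- by rewrite -[X in measurable X]setTI; apply: mp => //; exact: measurable_norm_le.
- exact: measurable_norm_le.
- move=> v /= vr; rewrite -(addrK p v); apply: le_trans (ler_normB _ _) _.
  by rewrite -addrA lerD// lerDl.
Qed.

(** The two densities give the same set function, since the integral ignores null sets even for
    nonmeasurable integrands; Tonelli then applies to the Borel [D]. *)
Lemma product_density (e : {sigma_finite_measure set V -> \bar R}) (LD D : V -> R) :
  measurable_fun setT D -> (forall x, (0 <= D x)%R) -> (\forall x \ae L, LD x = D x) ->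
  forall A, measurable A ->
  (density LD \x e) A = \int[(L \x e)]_(q in A) (D q.1)%:E.
Proof.
move=> mD D0 LD_D A mA.
have -> : density LD = density D.
  apply/funext => B; rewrite /density [LHS]integral_mkcond [RHS]integral_mkcond.
  by apply: ae_eq_integral_nonmeasurable; apply: filterS LD_D => x LDx; rewrite !patchE LDx.
have [m mE] := density_measure L mD D0.
have mx := measurable_fun_xsection e mA.
have -> : (density D \x e) A = \int[m]_x (e \o xsection A) x by rewrite mE.
rewrite (@ge0_integral_density _ _ _ L _ mD D0 m (e \o xsection A))//; last first.
  by move=> B _; rewrite mE.
have mDA : measurable_fun setT (fun q : V * V => (D q.1)%:E * (\1_A q)%:E).
  apply: emeasurable_funM; apply/measurable_EFinP => //.
  exact: measurableT_comp mD measurable_fst.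
have DA0 (q : V * V) : 0 <= (D q.1)%:E * (\1_A q)%:E by rewrite mule_ge0 ?lee_fin.
transitivity (\int[(L \x e)]_q ((D q.1)%:E * (\1_A q)%:E)); last first.
  rewrite [RHS]integral_mkcond; apply: eq_integral => q _; rewrite patchE indicE.
  by case: ifP => _; rewrite ?mule1 ?mule0.
rewrite (fubini_tonelli1 (m1 := L) (m2 := e) _ mDA DA0); apply: eq_integral => x _.
rewrite /fubini_F/=.
have mAx : measurable_fun setT (fun y : V => (\1_A (x, y))%:E : \bar R).
  by apply/measurable_EFinP; exact: measurableT_comp (measurable_pair1 x).
rewrite (ge0_integralZl e measurableT mAx) ?lee_fin// muleC; congr (_ * _).
rewrite -[xsection A x]setIT -integral_indic//; last exact: measurable_xsection.
by apply: eq_integral => y _; rewrite !indicE mem_xsection.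
Qed.

Variables (a b e : {sigma_finite_measure set V -> \bar R}) (kappa : R).
Hypothesis kappa_gt0 : (0 < kappa)%R.
Hypothesis scaled_slices : forall (t : R) (Phi : V * V -> \bar R), (0 < t)%R ->
  measurable_fun setT Phi -> (forall q, 0 <= Phi q) ->
  \int[(L \x e)]_q Phi q = (kappa * t ^+ d * t ^+ d)%:E *
    \int[e]_x \int[b]_y \int[a]_z Phi (x + t *: y, x + t *: z)%R.
Variable tau : {measure set (V * V * V)%type -> \bar R}.
Hypothesis tauE : forall f : V * V * V -> \bar R, measurable_fun setT f -> (forall w, 0 <= f w) ->
  \int[tau]_w f w = \int[e]_x \int[b]_y \int[a]_z f (x, y, z).
Hypothesis a_neq0 : a setT != 0.

(** Apply the slicing formula to the indicator of a Lebesgue-null set in the first variable: the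
    left side is 0 and the factor [kappa * t ^+ d * t ^+ d] is not. *)
Lemma null_slices (P : V -> Prop) (t : R) : (\forall y \ae L, P y) -> (0 < t)%R ->
  (\forall w \ae tau, P (w.1.1 + t *: w.1.2)%R) /\
  (\forall x \ae e, \forall y \ae b, P (x + t *: y)%R).
Proof.
move=> [N [mN N0 PN]] t0.
have NP y : \1_N y = 0%R :> R -> P y.
  by rewrite indicE => h; apply: contrapT => /PN Ny; move: h; rewrite mem_set// => /eqP; rewrite oner_eq0.
pose q (p : V * V) : \bar R := (\1_N (p.1 + t *: p.2)%R)%:E.
have mindic : measurable_fun setT (fun y : V => (\1_N y)%:E : \bar R) by apply/measurable_EFinP.
have mq : measurable_fun setT q.
  apply: measurableT_comp mindic _.
  by apply: measurable_add_rV => //; exact: measurable_scale_rV.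
have q0 p : 0 <= q p by rewrite lee_fin.
have mq1 : measurable_fun setT (fun w : V * V * V => q w.1).
  exact: measurableT_comp mq measurable_fst.
have Phi0 (r : V * V) : 0 <= (\1_N r.1)%:E :> \bar R by rewrite lee_fin.
have mPhi : measurable_fun setT (fun r : V * V => (\1_N r.1)%:E : \bar R).
  exact: measurableT_comp mindic measurable_fst.
have q_int0 : \int[tau]_w q w.1 = 0.
  rewrite (tauE mq1 (fun w => q0 w.1)).
  have := scaled_slices t0 mPhi Phi0.
  rewrite (fubini_tonelli1 (m1 := L) (m2 := e) _ mPhi Phi0).
  have -> : \int[L]_x fubini_F e (fun r : V * V => (\1_N r.1)%:E) x = 0.
    rewrite -[RHS](integral0 L setT); apply: ae_eq_integral_nonmeasurable.
    exists N; split => // y; apply: contra_notP => Ny.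
    rewrite /fubini_F /= -[RHS](integral0 e setT); apply: eq_integral => z _.
    by rewrite indicE memNset.
  move=> /esym/eqP; rewrite mule_eq0 eqe => /orP[|/eqP]; last exact.
  by rewrite gt_eqF// !mulr_gt0 ?exprn_gt0.
have q_ae0 := (ge0_integral_eq0 tau mq1 (fun w => q0 w.1)).1 q_int0.
split; first by apply: filterS q_ae0 => w [/NP].
have := ae_iterated tauE a_neq0 mq q0 q_ae0.
by apply: filterS => x; apply: filterS => y [/NP].
Qed.

End AffineRegularity.

Theorem theorem4p8 (R : realType) (N : nat) (ip : {dot 'rV[R]_(2 * N) for idfun})
    (E0 : {vspace 'rV[R]_(2 * N)}) (E : set 'rV[R]_(2 * N))
    (mu : {measure set ('rV[R]_(2 * N) * 'rV[R]_(2 * N)) -> \bar R})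
    (LD : 'rV[R]_(2 * N) -> R) :
  (1 <= N)%N ->
  \dim E0 = N ->
  (exists p, E = [set p + v | v in [set` E0]]) ->
  radon mu ->
  let HN := hausdorff_on (ipdist ip) N in
  let HE := HN E in
  let HEperp := HN [set` orthov ip E0] in
  let HE0 := HN [set` E0] in
  (* regularity *)
  (forall xi, 0 <= LD xi) ->
  L1loc LD ->
  (forall A, measurable A -> mu A = (density LD \x HE)%E A) ->
  (* continuity *)
  (\forall xi \ae HE, \forall eta \ae HEperp,
    LD (xi + lambda^-1 *: eta) @[lambda --> +oo] --> LD xi) ->
  (* equi-integrability *)
  (exists (g : 'rV[R]_(2 * N) * 'rV[R]_(2 * N) * 'rV[R]_(2 * N) -> R)
      (lambda0 beta0 : R),
    [/\ L1 (HE \x HEperp \x HE0)%E g, 0 < lambda0, 0 < beta0 &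
      \forall p \ae (HE \x HEperp \x HE0)%E,
        forall lambda, lambda0 <= lambda ->
          expR (- beta0 * (ipnorm ip p.1.2 ^+ 2 + ipnorm ip p.2 ^+ 2)) *
            LD (p.1.1 + lambda^-1 *: p.1.2) <= g p]) ->
  exists mu_oo : {measure set ('rV[R]_(2 * N) * 'rV[R]_(2 * N)) -> \bar R},
    weak_limit (thermalized ip mu) mu_oo /\
    forall f, Cb f ->
      L1 HE (fun xi => f (xi, xi) * LD xi) /\
      (\int[mu_oo]_p (f p)%:E = \int[HE]_xi (f (xi, xi) * LD xi)%:E)%E.
Proof.
move=> N0 dimE [p EE] _ HN HE HEperp HE0 LD0 [D0 [mD0 _ LD_D0]] muE cont.
move=> [g0 [lambda0 [beta0 [[g g_int g0_g] lambda0_gt0 beta0_gt0 dom]]]].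
have dimE' : \dim (orthov ip E0) = N.
  by apply: (@addnI N); have := dim_orthov ip E0; rewrite dimE => ->; rewrite mul2n addnn.
have [a aE] := hausdorff_subspace_measure ip N0 dimE.
have [b bE] := hausdorff_subspace_measure ip N0 dimE'.
have aE' (B : set 'rV[R]_(2 * N)) : a B = HE0 B by rewrite aE.
have [e eE] : exists e : {sigma_finite_measure set 'rV[R]_(2 * N) -> \bar R},
    (e : set _ -> \bar R) = hausdorff_on (ipdist ip) N [set p + v | v in [set` E0]].
  apply: (hausdorff_affine_measure p _ aE) => r r0; rewrite aE'.
  by have /andP[] := hausdorff_subspace_norm_le ip N0 dimE r0.
have [kappa kappa_gt0 slices] := lebesgue_orthogonal_sum N0 dimE dimE' aE bE.
have [tau tau_prod tauE] := triple_product_measure e b a.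
have HEe : HE = e by rewrite eE -EE.
have tauH : (HE \x HEperp \x HE0)%E = tau by rewrite tau_prod /HEperp /HE0 /HN -aE -bE HEe.
rewrite tauH in g_int g0_g dom; rewrite HEe in muE cont *.
have {}cont : \forall xi \ae e, \forall eta \ae b,
    LD (xi + lambda^-1 *: eta) @[lambda --> +oo] --> LD xi by rewrite bE.
(* The Borel representative is nonnegative only almost everywhere; truncation makes it so everywhere
   without changing its class. *)
pose D x := Num.max (D0 x) 0.
have D_ge0 x : 0 <= D x by rewrite le_max lexx orbT.
have mD : measurable_fun setT D by exact: measurable_maxr.
have LD_D : \forall x \ae lebesgue_rV (2 * N), LD x = D x.
  by apply: filterS LD_D0 => x LDx; rewrite /D -LDx max_l.
have muD A : measurable A -> mu A = (\int[(lebesgue_rV (2 * N) \x e)]_(q in A) (D q.1)%:E)%E.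
  by move=> mA; rewrite muE//; exact: product_density.
have aU := subspace_ae N0 aE; have bU := orthov_ae N0 bE.
have scaled := lebesgue_scaled_slices N0 aE bE eE slices.
have [ga [gb [ga_gt0 gb_gt0 gaE gbE]]] :=
  slice_gauss_masses N0 dimE dimE' aE bE kappa_gt0 slices beta0_gt0.
have mass t (t0 : 0 < t) := gauss_mass_slices N0 aE bE slices t0 gaE gbE.
have a_neq0 : a setT != 0%E.
  apply: contraTneq ga_gt0 => aT; rewrite -lte_fin -gaE.
  suff -> : (\int[a]_x (expR (- beta0 * ipnorm ip x ^+ 2))%:E = 0)%E by rewrite ltxx.
  rewrite -[RHS](integral0 a setT).
  by apply: ae_eq_integral_nonmeasurable; exists setT; split.
have D_LD : \forall x \ae lebesgue_rV (2 * N), D x = LD x by apply: filterS LD_D.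
have null t (t0 : 0 < t) := null_slices (d := N) kappa_gt0 scaled tauE a_neq0
  (P := fun y => D y = LD y) D_LD t0.
have [l [ml l_ge0 LD_l]] := slice_density gb_gt0 gbE mD D_ge0 LD0
  (fun t t0 => (null t t0).2) cont.
have domg : \forall w \ae tau, forall lambda, lambda0 <= lambda ->
    slice_gauss ip beta0 w * LD (w.1.1 + lambda^-1 *: w.1.2) <= g w.
  by apply: filterS2 g0_g dom => w <-.
have cvg_slices f M lambda := slice_integral_cvg tauE mD D_ge0 (fun t t0 => (null t t0).2) cont
  (fun t t0 => (null t t0).1) lambda0_gt0 g_int domg ml LD_l (f := f) (M := M) (lambda := lambda).
have thermal f t := integral_thermalized (n := 2 * N) aU bU kappa_gt0 ga_gt0 gb_gt0 scaled mass tauE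
  mD D_ge0 muD (f := f) (t := t).
(* Solves [beta = beta0 * lambda ^+ 2] for [lambda]; the threshold [beta1] corresponds to
   [lambda0]. *)
pose lam beta := Num.sqrt (beta / beta0).
pose beta1 := beta0 * lambda0 ^+ 2.
have lam_ge beta : beta1 <= beta -> lambda0 <= lam beta.
  move=> h; rewrite -(ger0_norm (ltW lambda0_gt0)) -sqrtr_sqr ler_wsqrtr//.
  by rewrite ler_pdivlMr// mulrC.
have lamK beta : beta1 <= beta -> beta = beta0 / (lam beta)^-1 ^+ 2.
  move=> h; rewrite exprVn invrK sqr_sqrtr; first by rewrite mulrCA divff ?mulr1// gt_eqF.
  by rewrite divr_ge0 ?(ltW beta0_gt0)// (le_trans _ h)// mulr_ge0 ?sqr_ge0// ltW.
have lam_gt0 beta : beta1 <= beta -> 0 < (lam beta)^-1.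
  by move=> /lam_ge h; rewrite invr_gt0 (lt_le_trans lambda0_gt0).
have gab_gt0 : 0 < ga * gb by rewrite mulr_gt0.
have one_cont : continuous (fun _ : 'rV[R]_(2 * N) * 'rV[R]_(2 * N) => 1 : R) by exact: cst_continuous.
have lam_oo u : u k @[k --> \oo] --> +oo -> lam (u k) @[k --> \oo] --> +oo.
  move=> /cvgryPge uoo; apply/cvgryPge => A; apply: filterS (uoo (beta0 * A ^+ 2)) => k h.
  by apply: le_trans (ler_norm A) _; rewrite -sqrtr_sqr ler_wsqrtr// ler_pdivlMr// mulrC.
have limit_int (f : 'rV[R]_(2 * N) * 'rV[R]_(2 * N) -> R) : measurable_fun setT f -> (forall q, 0 <= f q) ->
    (\int[tau]_w (limit_integrand ip beta0 l f w)%:E =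
     (ga * gb)%:E * \int[e]_x (f (x, x) * l x)%:E)%E.
  exact: (integral_limit_integrand ga_gt0 gb_gt0 gaE gbE tauE ml l_ge0).
have [|||mu_oo [mu_lim muI]] := @diagonal_weak_limit R (2 * N) (thermalized ip mu) beta1 e l ml l_ge0
  (thermalized_measure ip mu).
(* The total mass is the integral of the test function 1, whose slice integrand is bounded by
   [g]. *)
- move=> beta beta1_le; have [m mE] := thermalized_measure ip mu beta.
  have -> : (thermalized ip mu beta setT = \int[thermalized ip mu beta]_q (1 : R)%:E)%E.
    by rewrite -mE integral_cst// mul1e.
  rewrite (lamK _ beta1_le) thermal ?lam_gt0//.
  apply: lte_mul_pinfty; rewrite ?lee_fin ?invr_ge0 ?(ltW gab_gt0)//.
  have /integrableP[mg g_fin] := g_int.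
  apply: le_lt_trans g_fin; apply: ae_ge0_le_integral => //.
  + by move=> w _; rewrite lee_fin slice_integrand_ge0.
  + by apply/measurable_EFinP; exact: measurable_slice_integrand.
  + exact: measurableT_comp mg.
  + have := slice_dominated (fun t t0 => (null t t0).1) lambda0_gt0 domg
      (lambda := fun=> lam beta) (fun=> lam_ge _ beta1_le).
    apply: filterS => w /(_ 0) h _.
    by rewrite lee_fin /slice_integrand mul1r (le_trans h)// ler_norm.
(* Dominated convergence with test function 1 along any admissible sequence makes the limit
   integrand integrable, hence [l], since its integral is [ga * gb] times that of [l]. *)
- have lam1 k : lambda0 <= lambda0 + k%:R by rewrite lerDl.
  have lam1_oo : (lambda0 + k%:R) @[k --> \oo] --> +oo.
    apply/cvgryPge => A; apply: filterS (nbhs_infty_ger A) => k h.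
    by rewrite (le_trans h)// lerDr ltW.
  have one_le1 (q : 'rV[R]_(2 * N) * 'rV[R]_(2 * N)) : 0 <= (1 : R) <= 1 by rewrite ler01 lexx.
  have [l_int _] := cvg_slices _ 1 _ one_cont one_le1 lam1 lam1_oo.
  have := integrable_fin_num measurableT l_int.
  rewrite [X in X \is a fin_num -> _](limit_int (fun=> 1) _ (fun=> ler01))//.
  have -> : (\int[e]_x (1 * l x)%:E = \int[e]_x (l x)%:E)%E.
    by apply: eq_integral => x _; rewrite mul1r.
  move=> fin; rewrite ltNge leye_eq; apply: contraTN fin => /eqP ->.
  by rewrite mulry gtr0_sg// mul1e.
- move=> f M u cf fM u_ge uoo.
  have f_ge0 q : 0 <= f q by have /andP[] := fM q.
  have mf := continuous_measurable_pair cf.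
  have [_ h] := cvg_slices f M (fun k => lam (u k)) cf fM (fun k => lam_ge _ (u_ge k)) (lam_oo u uoo).
  have -> : (fun k => \int[thermalized ip mu (u k)]_q (f q)%:E)%E = (fun k =>
      ((ga * gb)^-1)%:E * \int[tau]_w (slice_integrand ip beta0 D f (lam (u k))^-1 w)%:E)%E.
    by apply/funext => k; rewrite {1}(lamK _ (u_ge k)) thermal// lam_gt0.
  have -> : (\int[e]_x (f (x, x) * l x)%:E =
      ((ga * gb)^-1)%:E * \int[tau]_w (limit_integrand ip beta0 l f w)%:E)%E.
    by rewrite limit_int// muleA -EFinM mulVf ?mul1e// gt_eqF.
  exact: cvgeZl.
exists mu_oo; split => // f Cbf; have [f_int fE] := muI f Cbf.
have LDl : \forall x \ae e, f (x, x) * LD x = f (x, x) * l x.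
  by apply: filterS LD_l => x ->.
(* [LD] need not be Borel on [E], so integrability is witnessed by the version with [l]. *)
split; first by exists (fun x => f (x, x) * l x).
by rewrite fE; apply: ae_eq_integral_nonmeasurable; apply: filterS LDl => x ->.
Qed.
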